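(* For $n\ge 1$ let $r_n=\max\{\|M\|_{\mathrm{S}}: M\in\mathbb{M}_n(\mathbb{R}),\ |m_{i,j}|\le 1\text{ for all }i,j\}$, where $\|M\|_{\mathrm{S}}=\max\{\|M\circ C\|: C\in\mathbb{M}_n(\mathbb{C}),\ \|C\|=1\}$. Then $r_5=\frac{11}{5}$, $r_6=\frac{1}{3}(4+\sqrt{10})$, and $r_7=\frac{1}{7}(1+12\sqrt{2})$.
   Context: $\|\cdot\|$ is the operator norm (induced by the Euclidean norm) and $\circ$ is the entrywise product of matrices. *)

(* Defs.v *)
From HB Require Import structures.
From mathcomp Require Import all_boot all_order all_algebra.
From mathcomp Require Import boolp classical_sets reals.
From mathcomp Require Import complex.

Set Implicit Arguments.
Unset Strict Implicit.
Unset Printing Implicit Defensive.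

Import Order.TTheory GRing.Theory Num.Theory.
Import ComplexField.Normc.

Local Open Scope classical_set_scope.
Local Open Scope ring_scope.
Local Open Scope complex_scope.

(* The maximum is an attained upper bound; the value is 0 if there is none.
   Below it is only applied to continuous images of nonempty compact sets
   (when n >= 1), where the maximum exists. *)
Definition maximum (R : realType) (A : set R) : R :=
  xget 0 [set x | A x /\ ubound A x].

Lemma maximumE (R : realType) (A : set R) (x : R) :
  A x -> ubound A x -> maximum A = x.
Proof.
move=> Ax ubx; apply: xget_unique => [//|y [Ay uby]].
by apply/eqP; rewrite eq_le ubx // uby.
Qed.

Lemma maximumP (R : realType) (A : set R) :
  maximum A != 0 -> A (maximum A) /\ ubound A (maximum A).
Proof. by rewrite /maximum; case: xgetP => [x _ //|]; rewrite eqxx. Qed.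

Definition l2norm (R : realType) (n : nat) (x : 'cV[R[i]]_n) : R :=
  Num.sqrt (\sum_(i < n) normc (x i 0) ^+ 2).

Definition opnorm (R : realType) (n : nat) (A : 'M[R[i]]_n) : R :=
  sup [set l2norm (A *m x) | x in [set x : 'cV[R[i]]_n | l2norm x <= 1]].

Definition hadamard (R : realType) (n : nat) (A B : 'M[R[i]]_n) : 'M[R[i]]_n :=
  map2_mx *%R A B.

Definition schur_norm (R : realType) (n : nat) (M : 'M[R]_n) : R :=
  maximum [set opnorm (hadamard (map_mx (real_complex R) M) C) |
           C in [set C : 'M[R[i]]_n | opnorm C = 1]].

Definition schur_radius (R : realType) (n : nat) : R :=
  maximum [set schur_norm M |
           M in [set M : 'M[R]_n | forall i j, `|M i j| <= 1]].

(* Main.v *)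
(* If [M = A B] where the rows of [A] have norm at most [1] and the columns of [B] have squared norm
   at most [s], then [||M o C|| <= sqrt s ||C||]. The numbers [Re <z, (M o C) x>] are linear in [M],
   so only sign matrices matter. Appending a row to [M] increases the best [s] by at most [1]; hence
   a [k x n] sign matrix with a factorization of cost [s <= r^2 - (n - k)] cannot be extended to a
   matrix whose Schur norm exceeds [r]. Up to signs and permutations of rows and columns very few
   partial matrices survive this test, and exactly one [n x n] matrix [F] does, for n = 5, 6, 7:
   [J - 2I], [[J - 2I, J], [-J, J - 2I]] and the circulant incidence matrix of the Fano plane.
   For it [F F^T = a^2 I + ((d^2 - a^2) / m) U], with [U] block diagonal with all-ones blocks of
   size [m]. Factoring [(F F^T)^(1/2)] gives the upper bound [r = a + (d - a) / m], and the polar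
   factor [C = (F F^T)^(-1/2) F] attains it on the constant vector. *)

Require Import Defs.
From Stdlib Require Import ZArith.
From mathcomp Require Import all_boot all_order all_algebra.
From mathcomp Require Import boolp classical_sets reals.
From mathcomp Require Import complex.
From mathcomp Require Import zify ssrZ ring lra.

Set Implicit Arguments.
Unset Strict Implicit.
Unset Printing Implicit Defensive.

Import Order.TTheory GRing.Theory Num.Theory.
Import ComplexField.Normc.

Delimit Scope Z_scope with BZ.
Local Open Scope ring_scope.

(** The normalization is deliberately lopsided: every row of [A] has norm at most 1 and the whole
    cost sits on the columns of [B]. A new row can then be given a coordinate of its own, which adds
    exactly 1 to the squared norm of each column of [B] whatever its entries are. So the rows not
    chosen yet cost at most their number, and a partial matrix can be judged without knowing them.
    For a fixed invertible [A] the factor [B = A^-1 M] is forced, and its cost is a separate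
    condition on each column. Undecided entries are handled by testing both signs, and one [A]
    serves many matrices. Taking [A] lower triangular loses nothing, since [A B = (A Q)(Q^T B)] for
    orthogonal [Q]. The obstacle is that [F] has no slack: its best cost is [r^2], which is
    irrational for n = 6, 7, whereas rounded rational certificates can only reach a rational bound
    below [r^2]. Hence [F] is left over by the search and gets an exact algebraic factorization,
    while every other branch closes by integer arithmetic. *)

(** * Euclidean norm, contractions, and the bound given by a factorization *)

Section Euclidean.
Variables (R : realType).
Implicit Types (I : finType).

Lemma sum_cauchy_schwarz I (f g : I -> R) :
  \sum_i f i * g i <= Num.sqrt (\sum_i f i ^+ 2) * Num.sqrt (\sum_i g i ^+ 2).
Proof.
set F := \sum_i f i ^+ 2; set G := \sum_i g i ^+ 2; set S := \sum_i _.
have F0 : 0 <= F by apply: sumr_ge0 => i _; exact: sqr_ge0.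
have G0 : 0 <= G by apply: sumr_ge0 => i _; exact: sqr_ge0.
have quad t : 0 <= t ^+ 2 * F - 2 * t * S + G.
  rewrite [X in 0 <= X](_ : _ = \sum_i (t * f i - g i) ^+ 2).
    by apply: sumr_ge0 => i _; exact: sqr_ge0.
  rewrite /F /S /G !mulr_sumr -sumrB -big_split /=.
  by apply: eq_bigr => i _; ring.
rewrite -sqrtrM // (le_trans (ler_norm _)) // -sqrtr_sqr ler_wsqrtr //.
have [F00|Fn0] := eqVneq F 0.
  have f0 i : f i = 0.
    apply/eqP; rewrite -sqrf_eq0; apply/eqP.
    by apply: (psumr_eq0P _ F00) => // j _; exact: sqr_ge0.
  by rewrite /S big1 ?expr0n ?mulr_ge0 // => i _; rewrite f0 mul0r.
have Fp : 0 < F by rewrite lt_def Fn0.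
have := quad (S / F); rewrite -(pmulr_rge0 _ Fp).
have -> : F * ((S / F) ^+ 2 * F - 2 * (S / F) * S + G) = F * G - S ^+ 2 by field.
by rewrite subr_ge0.
Qed.

Variable n : nat.
Implicit Types (x y z : 'cV[R[i]]_n) (C : 'M[R[i]]_n).

(** The real part of the Hermitian product, that is, the inner product of [C^n] seen as [R^(2n)].
    Only real parts enter the estimates below, so the real Cauchy-Schwarz inequality is enough. *)
Definition rdot x y : R :=
  \sum_i (complex.Re (x i 0) * complex.Re (y i 0) + complex.Im (x i 0) * complex.Im (y i 0)).

Lemma l2normE x : l2norm x = Num.sqrt (rdot x x).
Proof.
congr Num.sqrt; apply: eq_bigr => i _; case: (x i 0) => a b /=.
by rewrite sqr_sqrtr ?addr_ge0 ?sqr_ge0 // !expr2.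
Qed.

Lemma rdot_ge0 x : 0 <= rdot x x.
Proof. by apply: sumr_ge0 => i _; rewrite -!expr2 addr_ge0 ?sqr_ge0. Qed.

Lemma sqr_l2norm x : l2norm x ^+ 2 = rdot x x.
Proof. by rewrite l2normE sqr_sqrtr ?rdot_ge0. Qed.

Lemma l2norm_ge0 x : 0 <= l2norm x.
Proof. exact: sqrtr_ge0. Qed.

Lemma rdot_le x y : rdot x y <= l2norm x * l2norm y.
Proof.
pose coord (u : 'cV[R[i]]_n) (s : 'I_n + 'I_n) : R :=
  match s with inl i => complex.Re (u i 0) | inr i => complex.Im (u i 0) end.
have rdotE u v : rdot u v = \sum_s coord u s * coord v s.
  by rewrite big_sumType /= -big_split.
rewrite !l2normE !rdotE; under [X in Num.sqrt X * _]eq_bigr do rewrite -expr2.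
under [X in _ * Num.sqrt X]eq_bigr do rewrite -expr2.
exact: sum_cauchy_schwarz.
Qed.

Lemma l2normZ (a : R) x : l2norm (real_complex R a *: x) = `|a| * l2norm x.
Proof.
rewrite !l2normE -sqrtr_sqr -sqrtrM ?sqr_ge0 //; congr Num.sqrt.
rewrite /rdot mulr_sumr; apply: eq_bigr => i _; rewrite !mxE.
by case: (x i 0) => u v /=; ring.
Qed.

Lemma l2norm_eq0 x : l2norm x = 0 -> x = 0.
Proof.
move=> x0; have := sqr_l2norm x; rewrite x0 expr0n /= => /esym /eqP.
rewrite psumr_eq0 => [/allP H|i _]; last by rewrite -!expr2 addr_ge0 ?sqr_ge0.
apply/matrixP => i j; rewrite ord1 mxE.
have := H i (mem_index_enum _); case: (x i 0) => a b /=.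
by rewrite -!expr2 paddr_eq0 ?sqr_ge0 // !sqrf_eq0 => /andP[/eqP -> /eqP ->].
Qed.

(** A real matrix acts separately on the real and imaginary parts of [x], and the squared norm is
    the sum of the squared norms of these parts. *)
Lemma l2norm_orthogonal (C : 'M[R]_n) x :
  C^T *m C = 1%:M -> l2norm (map_mx (real_complex R) C *m x) = l2norm x.
Proof.
move=> CC; rewrite !l2normE; congr Num.sqrt.
pose re : 'cV[R]_n := \col_i complex.Re (x i 0).
pose im : 'cV[R]_n := \col_i complex.Im (x i 0).
have parts (u v : 'cV[R]_n) : \sum_i (u i 0 * u i 0 + v i 0 * v i 0) =
    (u^T *m u) 0 0 + (v^T *m v) 0 0.
  by rewrite !mxE -big_split; apply: eq_bigr => i _; rewrite !mxE.
have -> : rdot x x = \sum_i (re i 0 * re i 0 + im i 0 * im i 0).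
  by apply: eq_bigr => i _; rewrite !mxE.
have -> : rdot (map_mx (real_complex R) C *m x) (map_mx (real_complex R) C *m x)
    = \sum_i ((C *m re) i 0 * (C *m re) i 0 + (C *m im) i 0 * (C *m im) i 0).
  apply: eq_bigr => i _.
  have -> : (map_mx (real_complex R) C *m x) i 0
     = Complex ((C *m re) i 0) ((C *m im) i 0).
    rewrite !mxE; apply/eqP; rewrite eq_complex /= !raddf_sum /=.
    by apply/andP; split; apply/eqP; apply: eq_bigr => j _; rewrite !mxE;
      case: (x j 0) => a b /=; ring.
  by [].
by rewrite !parts !trmx_mul -!mulmxA ![C^T *m (_ *m _)]mulmxA CC !mul1mx.
Qed.

(** Pointwise form of operator norm at most 1, free of the supremum and its default value. *)
Definition contraction C := forall x, l2norm (C *m x) <= l2norm x.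

Lemma opnorm1_contraction C : opnorm C = 1 -> contraction C.
Proof.
rewrite /opnorm; set S := (X in sup X) => S1 x.
(* The default value of [sup] is 0, so a supremum equal to 1 is a genuine one. *)
have hS : has_sup S.
  by apply: contrapT => /sup_out S0; move: S1; rewrite S0 => /eqP; rewrite eq_sym oner_eq0.
have [x0|xn0] := eqVneq (l2norm x) 0.
  by rewrite (l2norm_eq0 x0) mulmx0.
have xp : 0 < l2norm x by rewrite lt_def xn0 l2norm_ge0.
have : S (l2norm (C *m (real_complex R (l2norm x)^-1 *: x))).
  exists (real_complex R (l2norm x)^-1 *: x) => //=.
  by rewrite l2normZ gtr0_norm ?invr_gt0 // mulVf.
move=> /(sup_upper_bound hS); rewrite S1 -scalemxAr l2normZ gtr0_norm ?invr_gt0 //.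
by rewrite mulrC ler_pdivrMr // mul1r.
Qed.

Lemma opnorm_le C (r : R) : 0 <= r ->
  (forall x, l2norm (C *m x) <= r * l2norm x) -> opnorm C <= r.
Proof.
move=> r0 Cr; apply: ge_sup.
  exists (l2norm (C *m 0)); exists 0 => //=.
  by rewrite l2normE /rdot big1 ?sqrtr0 ?ler01 // => i _; rewrite !mxE /= !mul0r addr0.
move=> _ [x /= x1 <-]; apply: (le_trans (Cr x)).
by rewrite -[leRHS]mulr1 ler_wpM2l.
Qed.

(** The bound [r] keeps the set bounded above, so that [sup] is not its default value. *)
Lemma le_opnorm C (r : R) x : 0 <= r ->
  (forall y, l2norm (C *m y) <= r * l2norm y) -> l2norm x = 1 ->
  l2norm (C *m x) <= opnorm C.
Proof.
move=> r0 Cr x1; apply: ub_le_sup; last by exists x; rewrite //= x1.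
exists r => _ [y /= y1 <-]; apply: (le_trans (Cr y)).
by rewrite -[leRHS]mulr1 ler_wpM2l.
Qed.

(** The inner dimension [p] is left free, so that additional rows can bring their own
    coordinates. *)
Definition schur_factor (s : R) (M : 'M[R]_n) :=
  exists p (a : 'I_n -> 'I_p -> R) (b : 'I_p -> 'I_n -> R),
  [/\ forall i, \sum_k a i k ^+ 2 <= 1,
      forall j, \sum_k b k j ^+ 2 <= s
    & forall i j, M i j = \sum_k a i k * b k j].

(** Substituting [M = A B] splits the form into the sum over [k] of the real inner products of
    [a_k o z] with [C (b_k o x)]. Cauchy-Schwarz is applied inside each term and then to the sum
    over [k]; the row bound gives a total of at most [||z||^2] for the [a_k o z], and the column
    bound gives [s ||x||^2] for the [b_k o x]. *)
Lemma schur_factor_bilinear s M C x z : schur_factor s M -> contraction C ->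
  \sum_i \sum_j M i j * complex.Re ((z i 0)^*%C * (C i j * x j 0))
    <= Num.sqrt s * l2norm z * l2norm x.
Proof.
move=> [p [a [b [a1 bs Mab]]]] cC.
pose za k : 'cV[R[i]]_n := \col_i (real_complex R (a i k) * z i 0).
pose xb k : 'cV[R[i]]_n := \col_j (real_complex R (b k j) * x j 0).
have -> : \sum_i \sum_j M i j * complex.Re ((z i 0)^*%C * (C i j * x j 0))
   = \sum_k rdot (za k) (C *m xb k).
  rewrite /rdot [RHS]exchange_big /=; apply: eq_bigr => i _.
  under eq_bigr do rewrite Mab mulr_suml.
  rewrite exchange_big /=; apply: eq_bigr => k _.
  rewrite !mxE !raddf_sum /= !mulr_sumr -big_split /=.
  apply: eq_bigr => j _; rewrite !mxE.
  by case: (z i 0) (x j 0) (C i j) => z1 z2 [x1 x2] [c1 c2] /=; ring.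
apply: (@le_trans _ _ (\sum_k l2norm (za k) * l2norm (xb k))).
  apply: ler_sum => k _; apply: (le_trans (rdot_le _ _)).
  by rewrite ler_wpM2l ?l2norm_ge0.
apply: (le_trans (sum_cauchy_schwarz _ _)).
have sumza : \sum_k l2norm (za k) ^+ 2 <= l2norm z ^+ 2.
  under eq_bigr do rewrite sqr_l2norm.
  rewrite sqr_l2norm /rdot exchange_big /=; apply: ler_sum => i _.
  apply: (@le_trans _ _ ((\sum_k a i k ^+ 2) *
     (complex.Re (z i 0) * complex.Re (z i 0) + complex.Im (z i 0) * complex.Im (z i 0)))).
    rewrite mulr_suml le_eqVlt; apply/orP; left; apply/eqP.
    by apply: eq_bigr => k _; rewrite mxE; case: (z i 0) => u v /=; ring.
  by rewrite -[leRHS]mul1r ler_wpM2r // -!expr2 addr_ge0 ?sqr_ge0.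
have sumxb : \sum_k l2norm (xb k) ^+ 2 <= s * l2norm x ^+ 2.
  under eq_bigr do rewrite sqr_l2norm.
  rewrite sqr_l2norm /rdot exchange_big /= mulr_sumr; apply: ler_sum => j _.
  apply: (@le_trans _ _ ((\sum_k b k j ^+ 2) *
     (complex.Re (x j 0) * complex.Re (x j 0) + complex.Im (x j 0) * complex.Im (x j 0)))).
    rewrite mulr_suml le_eqVlt; apply/orP; left; apply/eqP.
    by apply: eq_bigr => k _; rewrite mxE; case: (x j 0) => u v /=; ring.
  by rewrite ler_wpM2r // -!expr2 addr_ge0 ?sqr_ge0.
(* If [s < 0], then [sumxb] forces [x] to have norm 0, and both sides vanish. *)
have [s0|s0] := leP 0 s; last first.
  have [|] := boolP (l2norm x == 0) => [/eqP x0|xn0].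
    move: sumxb; rewrite x0 expr0n mulr0 mulr0 => h.
    have -> : \sum_k l2norm (xb k) ^+ 2 = 0.
      by apply: le_anti; rewrite h sumr_ge0 // => k _; exact: sqr_ge0.
    by rewrite sqrtr0 mulr0.
  have : 0 <= s * l2norm x ^+ 2.
    by apply: le_trans sumxb; apply: sumr_ge0 => k _; exact: sqr_ge0.
  by rewrite pmulr_lge0 ?leNgt ?s0 // lt_def sqrf_eq0 xn0 sqr_ge0.
apply: (@le_trans _ _ (Num.sqrt (l2norm z ^+ 2) * Num.sqrt (s * l2norm x ^+ 2))).
  by apply: ler_pM; rewrite ?sqrtr_ge0 // ler_wsqrtr.
by rewrite (sqrtrM _ s0) !sqrtr_sqr !ger0_norm ?l2norm_ge0 // mulrCA mulrA.
Qed.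

Definition sign_matrix (M : 'M[R]_n) := forall i j, M i j = 1 \/ M i j = -1.

(** With [z = (M o C) x] fixed, [||z||^2] is the value at [M] of a real linear form in the entries.
    Over the cube of matrices with entries in [-1, 1] such a form is largest at a sign matrix, where
    the factorization bounds it by [sqrt s ||z|| ||x||]; dividing by [||z||] concludes. *)
Lemma hadamard_le (s : R) (M : 'M[R]_n) C x :
  (forall E, sign_matrix E -> schur_factor s E) -> (forall i j, `|M i j| <= 1) ->
  contraction C ->
  l2norm (hadamard (map_mx (real_complex R) M) C *m x) <= Num.sqrt s * l2norm x.
Proof.
move=> sE M1 cC; set z := _ *m x.
have [z0|zn0] := eqVneq (l2norm z) 0.
  by rewrite z0 mulr_ge0 ?sqrtr_ge0 ?l2norm_ge0.
have zp : 0 < l2norm z by rewrite lt_def zn0 l2norm_ge0.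
rewrite -(ler_pM2l zp) -expr2 mulrA [l2norm z * _]mulrC.
pose w i j := complex.Re ((z i 0)^*%C * (C i j * x j 0)).
(* [E] copies the signs of the coefficients [w], so each [E i j * w i j] is [|w i j|], which
   dominates [M i j * w i j]. *)
pose E : 'M[R]_n := \matrix_(i, j) if 0 <= w i j then 1 else -1.
have sEE : sign_matrix E by move=> i j; rewrite mxE; case: ifP; [left|right].
apply: le_trans (schur_factor_bilinear x z (sE E sEE) cC).
rewrite sqr_l2norm [leLHS](_ : _ = \sum_i \sum_j M i j * w i j).
  apply: ler_sum => i _; apply: ler_sum => j _; rewrite -/(w i j) mxE.
  apply: (le_trans (ler_norm _)); rewrite normrM.
  apply: (@le_trans _ _ `|w i j|); first by rewrite -[leRHS]mul1r ler_wpM2r.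
  by case: (leP 0 (w i j)) => h; [rewrite mul1r ger0_norm | rewrite mulN1r ltr0_norm].
apply: eq_bigr => i _.
have -> : complex.Re (z i 0) * complex.Re (z i 0) + complex.Im (z i 0) * complex.Im (z i 0)
   = complex.Re ((z i 0)^*%C * z i 0) by case: (z i 0) => a b /=; ring.
have zE : z i 0 = \sum_j hadamard (map_mx (real_complex R) M) C i j * x j 0 by rewrite /z mxE.
rewrite {2}zE mulr_sumr raddf_sum /=; apply: eq_bigr => j _.
have -> : hadamard (map_mx (real_complex R) M) C i j = real_complex R (M i j) * C i j.
  by rewrite !mxE.
by rewrite /w; case: (z i 0) (C i j) (x j 0) => z1 z2 [c1 c2] [x1 x2] /=; ring.
Qed.

(** The factorizations bound every Schur norm by [r]. Equality is witnessed by real data: an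
    orthogonal [C] has operator norm 1, and a unit eigenvector of [M o C] for the eigenvalue [r]
    shows that the bound is attained. *)
Lemma schur_radiusE (r : R) (M C : 'M[R]_n) (x : 'cV[R]_n) : 0 <= r ->
  (forall E, sign_matrix E -> schur_factor (r ^+ 2) E) ->
  sign_matrix M -> C^T *m C = 1%:M -> x^T *m x = 1%:M ->
  map2_mx *%R M C *m x = r *: x -> schur_radius R n = r.
Proof.
move=> r0 sE sM CC xx MCx.
have sr : Num.sqrt (r ^+ 2) = r by rewrite sqrtr_sqr ger0_norm.
have had (N : 'M[R]_n) D : (forall i j, `|N i j| <= 1) -> contraction D -> forall x,
    l2norm (hadamard (map_mx (real_complex R) N) D *m x) <= r * l2norm x.
  by move=> N1 cD y; rewrite -sr; exact: hadamard_le.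
have M1 i j : `|M i j| <= 1 by case: (sM i j) => ->; rewrite ?normrN normr1.
pose Cc := map_mx (real_complex R) C; pose xc := map_mx (real_complex R) x.
have isoC y : l2norm (Cc *m y) = l2norm y by exact: l2norm_orthogonal.
have xc1 : l2norm xc = 1.
  have -> : l2norm xc = Num.sqrt ((x^T *m x) 0 0).
    rewrite l2normE mxE; congr Num.sqrt; apply: eq_bigr => i _.
    by rewrite !mxE /= mulr0 addr0.
  by rewrite xx mxE sqrtr1.
have C1 : opnorm Cc = 1.
  apply: le_anti; rewrite opnorm_le ?ler01 // => [|y]; last by rewrite isoC mul1r.
  rewrite -{1}xc1 -(isoC xc) (@le_opnorm _ 1) // => y.
  by rewrite isoC mul1r.
have MC : opnorm (hadamard (map_mx (real_complex R) M) Cc) = r.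
  have hC : contraction Cc by move=> y; rewrite isoC.
  apply: le_anti; rewrite opnorm_le //=; last by move=> y; exact: had.
  have <- : l2norm (hadamard (map_mx (real_complex R) M) Cc *m xc) = r.
    rewrite [_ *m _](_ : _ = real_complex R r *: xc).
      by rewrite l2normZ xc1 mulr1 ger0_norm.
    have := congr1 (map_mx (real_complex R)) MCx.
    rewrite map_mxM map_mxZ => <-; congr (_ *m _).
    by apply/matrixP => i j; rewrite !mxE rmorphM.
  by apply: le_opnorm r0 _ xc1 => y; exact: had.
have le_schur (N : 'M[R]_n) : (forall i j, `|N i j| <= 1) -> schur_norm N <= r.
  move=> N1; rewrite /schur_norm.
  (* The value 0, which is also the default of [maximum], is at most [r]; any other value is
     attained by some [D]. *)
  set m := maximum _; have [m0|/maximumP [[D /= D1 mD] _]] := eqVneq m 0.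
    by rewrite m0.
  rewrite /m -mD.
  by apply: opnorm_le => // y; apply: had => //; exact: opnorm1_contraction.
have schurM : schur_norm M = r.
  apply: maximumE; first by exists Cc.
  move=> _ [D /= D1 <-].
  by apply: opnorm_le => // y; apply: had => //; exact: opnorm1_contraction.
apply: maximumE; first by exists M.
by move=> _ [N /= N1 <-]; exact: le_schur.
Qed.

End Euclidean.

(** * Executable checker for certificates and search trees *)

Fixpoint bits (n z : nat) : seq bool :=
  if n is n'.+1 then odd z :: bits n' z./2 else [::].

Definition flip (e : bool) (x : seq bool) : seq bool := map (addb e) x.

(** [s] lists the source of each new position, and [mask] is indexed by new positions. *)
Definition act (s : seq nat) (mask x : seq bool) : seq bool :=
  map (fun jm => nth false x jm.1 (+) jm.2) (zip s mask).

Fixpoint dot (t y : seq Z) : Z :=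
  match t, y with
  | a :: t', b :: y' => (a * b + dot t' y')%BZ
  | _, _ => 0%BZ
  end.

(* [(al, T)] stands for the lower triangular [A = T / al]; row [i] of [T] lists its first [i + 1]
   entries. *)
Definition certificate := (Z * seq (seq Z))%type.

(** Positive last entries are positive pivots: they make [T] invertible and keep the common
    denominator of the forward substitution positive. The last test says that the rows of [T / al]
    have norm at most 1. *)
Definition wf_certificate (ce : certificate) : bool :=
  let: (al, T) := ce in
  Z.ltb 0 al &&
  all (fun i => let t := nth [::] T i in
    [&& size t == i.+1, Z.ltb 0 (last 0%BZ t) & Z.leb (dot t t) (al * al)]) (iota 0 (size T)).

(* Forward substitution for [T b = al c], where [y / D] is the part of [b] already computed. *)
Fixpoint solve (al : Z) (T : seq (seq Z)) (c : seq bool) (D : Z) (y : seq Z) : Z * seq Z :=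
  match T, c with
  | t :: T', e :: c' =>
    let d := last 0%BZ t in
    solve al T' c' (D * d)%BZ
      (rcons (map (Z.mul d) y) ((if e then - al else al) * D - dot t y)%BZ)
  | _, _ => (D, y)
  end.

(** [y / D] is the column of [B = A^-1 M] that belongs to the column [c] of [M]; the test is
    [||y / D||^2 <= p / q] with denominators cleared. *)
Definition column_ok (p q : Z) (ce : certificate) (c : seq bool) : bool :=
  let: (D, y) := solve ce.1 ce.2 c 1%BZ [::] in
  Z.leb (q * dot y y) (p * (D * D)).

(* How to dispose of a new row [y] below the rows [X]:
   - [Dup i]: [y] repeats row [i] of [X];
   - [Cut i sel]: certificate [i] applies to the rows of [y :: X] selected by [sel], where
     [2 a + e] selects row [a], negated if [e = 1];
   - [Same i s m]: permuting the columns by [s] and negating those in [m] turns [y :: X] into the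
     [i]-th matrix of the next level, up to signs of rows;
   - [Split j h0 h1]: branch on entry [j] of [y]. *)
Inductive hint :=
  | Dup of nat
  | Cut of nat & seq nat
  | Same of nat & seq nat & nat
  | Split of nat & hint & hint.

(* Entries [None] of [y] are not decided yet. *)
Fixpoint check (n : nat) (p q : Z) (certs : seq certificate) (next : seq (seq (seq bool)))
    (X : seq (seq bool)) (h : hint) (y : seq (option bool)) : bool :=
  match h with
  | Dup i =>
    [&& y == map some (nth [::] X i), (i < size X)%N & Z.leb (q * (Z.of_nat n - 1)) p]
  | Cut i sel =>
    let ce := nth (1%BZ, [::]) certs i in
    (* [p' / q] is [p / q] less 1 for each of the rows outside the selection, present or still to
       come. *)
    let p' := (p - q * (Z.of_nat n - Z.of_nat (size sel)))%BZ in
    [&& uniq [seq k./2 | k <- sel], all (fun k => k./2 <= size X)%N sel,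
        (i < size certs)%N, size ce.2 == size sel &
        (* Columns are tested independently of each other, so an undecided entry of [y] costs two
           tests of its column and no branching over the whole row. *)
        all (fun j => all (fun b =>
               column_ok p' q ce
                 [seq odd k (+) (if k./2 is l.+1 then nth false (nth [::] X l) j else b)
                 | k <- sel])
             (if nth None y j is Some b then [:: b] else [:: false; true]))
          (iota 0 n)]
  | Same i s m =>
    let X' := nth [::] next i in
    (* A list of length [n] that contains every [j < n] is a permutation. *)
    [&& (i < size next)%N, size X' == (size X).+1, size s == n,
        all (fun j => j \in s) (iota 0 n), size y == n, all isSome y &
        all (fun x => let x' := act s (bits n m) x in (x' \in X') || (flip true x' \in X'))
          (pmap id y :: X)]
  | Split j h0 h1 =>
    check n p q certs next X h0 (set_nth None y j (Some false)) &&
    check n p q certs next X h1 (set_nth None y j (Some true))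
  end.

(** After the last level the only matrix to which [Same] may refer is [final]. *)
Fixpoint check_levels n p q certs (S : seq (seq (seq nat * hint))) (final : seq nat) : bool :=
  if S is L :: S' then
    let next := if S' is L' :: _ then [seq map (bits n) rh.1 | rh <- L']
                else [:: map (bits n) final] in
    all (fun rh => (size rh.1 < n)%N &&
           (* Rows matter only up to sign, so the first entry of the new row may be taken to be
              +1. *)
           check n p q certs next (map (bits n) rh.1) rh.2 (Some false :: nseq n.-1 None)) L
    && check_levels n p q certs S' final
  else true.

(** * Factorizations of lists of rows and correctness of certificates *)

Section RowFactor.
Variables (R : realType) (n : nat).
Implicit Types (X Y : seq (seq bool)) (s t : R).

Local Notation sgn b := ((-1) ^+ (b : bool) : R).

(* The factorization [M = A B] of [schur_factor], read off the rows of [M] only, so that it is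
   insensitive to the order, repetitions and signs of the rows; bit [true] stands for [-1]. *)
Definition row_factor s X :=
  exists p (b : 'I_p -> nat -> R),
  (forall j, (j < n)%N -> \sum_k b k j ^+ 2 <= s) /\
  forall x, x \in X -> exists a : 'I_p -> R, \sum_k a k ^+ 2 <= 1 /\
    forall j, (j < n)%N -> sgn (nth false x j) = \sum_k a k * b k j.

(** All rows share [b]; the sign of a row is absorbed by its own vector [a], whose norm does not
    change. *)
Lemma row_factor_sub s X Y :
  (forall y, y \in Y -> exists e, exists2 x, x \in X &
     forall j, (j < n)%N -> nth false y j = e (+) nth false x j) ->
  row_factor s X -> row_factor s Y.
Proof.
move=> YX [p [b [bs Xa]]]; exists p, b; split=> // y /YX [e [x /Xa [a [a1 xa]] yx]].
exists (fun k => sgn e * a k); split.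
  by under eq_bigr do rewrite exprMn sqrr_sign mul1r.
move=> j jn; rewrite yx // signr_addb xa // mulr_sumr.
by apply: eq_bigr => k _; rewrite mulrA.
Qed.

Lemma row_factor_subset s X Y : {subset Y <= X} -> row_factor s X -> row_factor s Y.
Proof. by move=> YX; apply: row_factor_sub => y /YX; exists false, y. Qed.

Lemma row_factor_le s t X : s <= t -> row_factor s X -> row_factor t X.
Proof.
move=> st [p [b [bs Xa]]]; exists p, b; split=> // j jn.
exact: le_trans (bs j jn) st.
Qed.

Lemma row_factor_nil : row_factor 0 [::].
Proof. by exists 0%N, (fun _ _ => 0); split=> // j _; rewrite big_ord0. Qed.

(** A fresh coordinate 0 carries the new row: its [a] is the unit vector there, [b] holds the signs
    of [y] there, and the old rows get 0. Each column gains the square of a sign. *)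
Lemma row_factor_cons s X y : row_factor s X -> row_factor (1 + s) (y :: X).
Proof.
move=> [p [b [bs Xa]]].
exists p.+1, (fun k j => if unlift ord0 k is Some k' then b k' j else sgn (nth false y j)).
split=> [j jn|x]; first by rewrite big_ord_recl unlift_none sqrr_sign lerD2l;
  under eq_bigr do rewrite liftK; exact: bs.
rewrite inE => /predU1P [->|/Xa [a [a1 xa]]].
  exists (fun k => (k == ord0)%:R); split.
    by rewrite big_ord_recl big1 ?addr0 ?expr1n // => k _; rewrite expr0n.
  move=> j jn; rewrite big_ord_recl unlift_none mul1r big1 ?addr0 // => k _.
  by rewrite mul0r.
exists (fun k => if unlift ord0 k is Some k' then a k' else 0); split.
  by rewrite big_ord_recl unlift_none expr0n add0r; under eq_bigr do rewrite liftK.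
move=> j jn; rewrite big_ord_recl unlift_none mul0r add0r xa //.
by apply: eq_bigr => k _; rewrite liftK.
Qed.

Lemma row_factor_cat s X Y : row_factor s X -> row_factor ((size Y)%:R + s) (Y ++ X).
Proof.
move=> sX; elim: Y => [|y Y IH] /=; first by rewrite add0r.
by rewrite -natr1 addrAC addrC; exact: row_factor_cons.
Qed.

(** Permuting and negating columns changes [b] only and preserves the column norms; [index j sg] is
    the inverse permutation. *)
Lemma row_factor_act s X sg mask : size sg = n -> size mask = n ->
  (forall j, (j < n)%N -> j \in sg) ->
  row_factor s (map (act sg mask) X) -> row_factor s X.
Proof.
move=> ssg smask insg [p [b [bs Xa]]].
have idx j : (j < n)%N -> (index j sg < n)%N by move=> jn; rewrite -ssg index_mem; exact: insg.
exists p, (fun k j => sgn (nth false mask (index j sg)) * b k (index j sg)); split.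
  move=> j jn; under eq_bigr do rewrite exprMn sqrr_sign mul1r.
  exact/bs/idx.
move=> x xX; have [a [a1 xa]] := Xa _ (map_f (act sg mask) xX).
exists a; split=> // j jn; under eq_bigr do rewrite mulrCA.
rewrite -mulr_sumr -xa ?idx // -signr_addb; congr (_ ^+ _).
rewrite (nth_map (0%N, false)) ?size_zip ?ssg ?smask ?minnn ?idx // nth_zip ?ssg ?smask //=.
by rewrite nth_index ?insg // addbCA addbb addbF.
Qed.

(** The checker computes with binary integers [Z] so that it can be evaluated; [phi] carries its
    verdicts to [R]. *)
Definition phi (z : Z) : R := (int_of_Z z)%:~R.

Lemma phiD x y : phi (x + y)%BZ = phi x + phi y.
Proof. by rewrite /phi (rmorphD int_of_Z) rmorphD. Qed.
Lemma phiN x : phi (- x)%BZ = - phi x.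
Proof. by rewrite /phi (rmorphN int_of_Z) rmorphN. Qed.
Lemma phiB x y : phi (x - y)%BZ = phi x - phi y.
Proof. by rewrite /phi (rmorphB int_of_Z) rmorphB. Qed.
Lemma phiM x y : phi (x * y)%BZ = phi x * phi y.
Proof. by rewrite /phi (rmorphM int_of_Z) rmorphM. Qed.
Lemma phi_nat k : phi (Z.of_nat k) = k%:R.
Proof. by rewrite /phi -[Z.of_nat k]/(Z_of_int k) Z_of_intK. Qed.
Lemma phi_le x y : Z.leb x y -> phi x <= phi y.
Proof. by move=> h; rewrite /phi ler_int; lia. Qed.
Lemma phi_gt0 x : Z.ltb 0 x -> 0 < phi x.
Proof. by move=> h; rewrite /phi ltr0z; lia. Qed.
Lemma phi0 : phi 0%BZ = 0. Proof. by []. Qed.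

Lemma dot_take (t y : seq Z) : dot t (take (size t) y) = dot t y.
Proof. by elim: t y => [|a t IH] [|b y] //=; rewrite IH. Qed.

Lemma phi_dot_scale d (t y : seq Z) : phi (dot t (map (Z.mul d) y)) = phi d * phi (dot t y).
Proof.
elim: t y => [|a t IH] [|b y] /=; rewrite ?phi0 ?mulr0 //.
by rewrite !phiD !phiM IH; ring.
Qed.

Lemma phi_dot_rcons (t y : seq Z) e : size t = (size y).+1 ->
  phi (dot t (rcons y e)) = phi (dot t y) + phi (last 0%BZ t) * phi e.
Proof.
elim: y t => [|b y IH] [|a t] //= [st].
  by case: t st => //= _; rewrite phiD phiM !phi0 addr0 add0r.
rewrite !phiD IH // addrA; congr (_ + phi _ * _).
by case: t st.
Qed.

Lemma phi_dotE m (t y : seq Z) : (size t <= m)%N ->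
  phi (dot t y) = \sum_(k < m) phi (nth 0%BZ t k) * phi (nth 0%BZ y k).
Proof.
elim: m t y => [|m IH] [|a t] [|b y] //= tm; rewrite ?big_ord0 ?phi0 //;
  try by rewrite big1 // => k _; rewrite /= ?nth_nil ?phi0 ?mul0r ?mulr0.
by rewrite big_ord_recl phiD phiM (IH t y).
Qed.

(** Each step multiplies the denominator by the pivot instead of dividing. The part already solved
    is therefore only rescaled, numerators and denominator by the same positive [K], and equations
    solved earlier persist. In the recursion [T] and [c] are the remaining equations, which is why
    row [i] of [T] has length [size y + i + 1]. *)
Lemma solveP al (T : seq (seq Z)) c D y : size c = size T -> Z.ltb 0 D ->
  (forall i, (i < size T)%N -> size (nth [::] T i) = (size y + i).+1 /\
     Z.ltb 0 (last 0%BZ (nth [::] T i))) ->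
  let: (D', y') := solve al T c D y in
  [/\ Z.ltb 0 D', size y' = (size y + size T)%N,
      exists2 K, Z.ltb 0 K & D' = (D * K)%BZ /\ take (size y) y' = map (Z.mul K) y
    & forall i, (i < size T)%N ->
        phi (dot (nth [::] T i) y') = sgn (nth false c i) * phi al * phi D'].
Proof.
elim: T c D y => [|t T IH] [|e c] //= D y => [_ D0 _|[sc] D0 wf].
  split=> //; first by rewrite addn0.
  exists 1%BZ => //; split; first by rewrite Z.mul_1_r.
  rewrite take_size -[LHS]map_id; apply: eq_map => z. by rewrite Z.mul_1_l.
have [st d0] := wf 0%N isT; rewrite /= addn0 in st d0.
set d := last _ t in d0 *; set y1 := rcons _ _.
have sy1 : size y1 = (size y).+1 by rewrite size_rcons size_map.
have /(IH c (D * d)%BZ y1 sc) : Z.ltb 0 (D * d) by lia.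
have wf1 i : (i < size T)%N -> size (nth [::] T i) = (size y1 + i).+1 /\
    Z.ltb 0 (last 0%BZ (nth [::] T i)).
  by move=> iT; have [s1 s2] := wf i.+1 iT; split=> //; rewrite sy1 addSn -addnS.
move=> /(_ wf1); case: solve => D' y' [D'0 sy' [K K0 [D'K Ky]] dotT].
split=> //; first by rewrite sy' sy1 addSnnS.
  exists (d * K)%BZ; [lia | split; first by rewrite D'K Z.mul_assoc].
  have -> : take (size y) y' = take (size y) (take (size y1) y').
    by rewrite take_takel // sy1.
  rewrite Ky /y1 map_rcons -cats1 take_cat size_map size_map ltnn subnn cats0.
  by rewrite -map_comp; apply: eq_map => z /=; lia.
case=> [_|i iT]; last exact: dotT.
(* The row [t] sees only the prefix of [y'] as long as [y1], and that prefix is [K] times [y1]; so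
   the equation for the newest unknown can be checked on [y1]. *)
rewrite /= -(dot_take t y') st -sy1 Ky phi_dot_scale /y1 phi_dot_rcons; last first.
  by rewrite size_map st.
rewrite phi_dot_scale phiB phiM -/d D'K !phiM.
have -> : phi (if e then (- al)%BZ else al) = sgn e * phi al.
  by case: (e); rewrite ?phiN ?expr1 ?mulN1r ?expr0 ?mul1r.
ring.
Qed.

(** [a] is a row of [T / al] and [b] is the solution [y / D], computed for each column on its own;
    [T y = al D c] says that their product is the sign matrix. *)
Lemma row_factor_certificate p q ce X : wf_certificate ce -> Z.ltb 0 q ->
  size ce.2 = size X ->
  (forall j, (j < n)%N -> column_ok p q ce [seq nth false x j | x <- X]) ->
  row_factor (phi p / phi q) X.
Proof.
case: ce => al T /= /andP [al0 /allP wf] q0 sT col.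
have {}wf i : (i < size T)%N -> [/\ size (nth [::] T i) = i.+1,
    Z.ltb 0 (last 0%BZ (nth [::] T i)) & Z.leb (dot (nth [::] T i) (nth [::] T i)) (al * al)].
  by move=> iT; have := wf i; rewrite mem_iota iT => /(_ isT) /and3P[/eqP].
pose m := size X.
pose r j := solve al T [seq nth false x j | x <- X] 1%BZ [::].
have rP j : let: (D', y') := r j in [/\ Z.ltb 0 D', size y' = m &
    forall i, (i < m)%N -> phi (dot (nth [::] T i) y') =
       sgn (nth false (nth [::] X i) j) * phi al * phi D'].
  have := @solveP al T [seq nth false x j | x <- X] 1%BZ [::].
  have wf0 i : (i < size T)%N -> size (nth [::] T i) = (size (@nil Z) + i).+1 /\
      Z.ltb 0 (last 0%BZ (nth [::] T i)) by case/wf.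
  rewrite size_map sT -/(r j) add0n => /(_ erefl isT); rewrite -sT => /(_ wf0).
  case: (r j) => D' y' [D0 sy _ dT]; split=> [//||i im]; first by rewrite sy sT.
  by rewrite dT ?sT // (nth_map [::]).
exists m, (fun k j => phi (nth 0%BZ (r j).2 k) / phi (r j).1); split.
  move=> j jn; have := col j jn; rewrite /column_ok -/(r j).
  case: (r j) (rP j) => D' y' [D0 sy _] /= h.
  under eq_bigr do rewrite expr_div_n expr2.
  rewrite -mulr_suml -phi_dotE ?sy // ler_pdivrMr ?exprn_gt0 ?phi_gt0 //.
  rewrite mulrAC ler_pdivlMr ?phi_gt0 // mulrC.
  by move: (phi_le h); rewrite !phiM expr2.
move=> x xX; pose i := index x X; have im : (i < m)%N by rewrite index_mem.
have [sTi Ti0 Tin] : [/\ size (nth [::] T i) = i.+1,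
    Z.ltb 0 (last 0%BZ (nth [::] T i)) & Z.leb (dot (nth [::] T i) (nth [::] T i)) (al * al)].
  by apply: wf; rewrite sT.
have Tim : (size (nth [::] T i) <= m)%N by rewrite sTi.
exists (fun k => phi (nth 0%BZ (nth [::] T i) k) / phi al); split.
  under eq_bigr do rewrite expr_div_n expr2.
  rewrite -mulr_suml -phi_dotE // ler_pdivrMr ?exprn_gt0 ?phi_gt0 // mul1r expr2 -phiM.
  exact: phi_le.
move=> j jn; case: (r j) (rP j) => D' y' [D0 sy /(_ i im)] /=.
under eq_bigr do rewrite mulrACA.
rewrite -mulr_suml -(phi_dotE _ Tim) => ->.
rewrite nth_index // -invfM -[X in X / _]mulrA mulfK // mulf_neq0 //.
  by rewrite gt_eqF ?phi_gt0.
by rewrite gt_eqF ?phi_gt0.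
Qed.

(** * Soundness of the search *)

Variables (t : R) (p q : Z).
Hypotheses (q0 : Z.ltb 0 q) (pqt : phi p / phi q <= t).

(** The claim that the search establishes for each partial matrix: no way of filling it up to [n]
    rows leads to a Schur norm above [sqrt t]. *)
Definition completable X :=
  forall Y, all (fun y => size y == n) Y -> (size X + size Y)%N = n -> row_factor t (X ++ Y).

Definition consistent (pt : seq (option bool)) (y : seq bool) :=
  size y = n /\ forall j b, nth None pt j = Some b -> nth false y j = b.

(** A repeated row is free. The other [n - 1] rows cost 1 each, and [n - 1 <= p / q] is what the
    check compares. *)
Lemma completable_dup X y i Y : nth [::] X i = y -> (i < size X)%N ->
  Z.leb (q * (Z.of_nat n - 1)) p -> (size X + size Y).+1 = n ->
  row_factor t (y :: X ++ Y).
Proof.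
move=> Xi iX pq XY.
apply: (@row_factor_subset _ (X ++ Y)).
  move=> z; rewrite inE => /predU1P [->|//].
  by rewrite mem_cat -Xi mem_nth.
rewrite -[X ++ Y]cats0; apply: row_factor_le (row_factor_cat _ row_factor_nil).
apply: le_trans pqt; rewrite addr0 size_cat ler_pdivlMr ?phi_gt0 //.
move: (phi_le pq); rewrite phiM phiB phi_nat -XY -natr1 [phi 1]/1%:~R.
by rewrite addrK mulrC.
Qed.

(** The certificate pays for the selected rows; each of the other rows is appended at cost 1. This
    makes the verdict independent of the rows in [Y]. *)
Lemma completable_cut ce sel X y Y : wf_certificate ce ->
  uniq [seq k./2 | k <- sel] -> all (fun k => k./2 <= size X)%N sel -> size ce.2 = size sel ->
  (forall j, (j < n)%N ->
     column_ok (p - q * (Z.of_nat n - Z.of_nat (size sel)))%BZ q ce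
       [seq odd k (+) nth false (nth [::] (y :: X) k./2) j | k <- sel]) ->
  all (fun x => size x == n) (y :: X ++ Y) -> size (y :: X ++ Y) = n ->
  row_factor t (y :: X ++ Y).
Proof.
move=> wf us /allP sX sT col szs sz; set W := y :: X ++ Y.
pose I := [seq k./2 | k <- sel].
(* [Z0] holds the rows outside the selection and [V] the selected ones with the signs asked for by
   [sel]; up to sign, every row of [W] occurs in [Z0 ++ V]. *)
pose Z0 := [seq nth [::] W i | i <- iota 0 n & i \notin I].
pose V := [seq flip (odd k) (nth [::] (y :: X) k./2) | k <- sel].
have Wi k : k \in sel -> nth [::] (y :: X) k./2 = nth [::] W k./2 /\ (k./2 < n)%N.
  move=> /sX kX; split; last by rewrite -sz /= ltnS size_cat (leq_trans kX) ?leq_addr.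
  by rewrite /W -cat_cons nth_cat /= ltnS kX.
have flipn e x j : size x = n -> (j < n)%N -> nth false (flip e x) j = e (+) nth false x j.
  by move=> sx jn; rewrite (nth_map false) ?sx.
have szW i : (i < n)%N -> size (nth [::] W i) = n.
  by move=> iN; apply/eqP; apply: (allP szs); rewrite mem_nth // sz.
have fV : row_factor (phi (p - q * (Z.of_nat n - Z.of_nat (size sel)))%BZ / phi q) V.
  apply: (row_factor_certificate wf q0); first by rewrite size_map.
  move=> j jn; have := col j jn; congr column_ok; rewrite -map_comp.
  apply/eq_in_map => k ks /=; have [E kn] := Wi k ks.
  by rewrite flipn // E szW.
apply: (@row_factor_sub _ (Z0 ++ V)).
  move=> w wW; have iN : (index w W < n)%N by rewrite -sz index_mem.
  have [/mapP [k ks ik]|iI] := boolP (index w W \in I).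
    exists (odd k), (flip (odd k) (nth [::] (y :: X) k./2)).
      by rewrite mem_cat; apply/orP; right; exact: (map_f (fun k => flip _ _) ks).
    move=> j jn; have [E kn] := Wi k ks.
    by rewrite flipn // E ?szW // addbA addbb -ik nth_index.
  exists false, w => //; rewrite mem_cat; apply/orP; left.
  by apply/mapP; exists (index w W); rewrite ?nth_index // mem_filter iI mem_iota.
apply: row_factor_le (row_factor_cat _ fV).
apply: le_trans pqt; rewrite size_map.
have -> : size [seq i <- iota 0 n | i \notin I] = (n - size sel)%N.
  have : perm_eq [seq i <- iota 0 n | i \in I] I.
    apply: uniq_perm => //; first by rewrite filter_uniq ?iota_uniq.
    move=> i; rewrite mem_filter mem_iota add0n /= andb_idr //.
    by case/mapP => k /Wi [_ kn] ->.
  move=> /perm_size; rewrite size_map => <-.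
  have := count_predC (mem I) (iota 0 n); rewrite size_iota => cI.
  have -> : size [seq i <- iota 0 n | i \notin I] = count (predC (mem I)) (iota 0 n).
    by rewrite size_filter.
  by rewrite -[X in (X - _)%N]cI size_filter addKn.
(* Needed to match the truncated subtraction that counts [Z0] with the subtraction in [Z] made by
   the checker. *)
have sn : (size sel <= n)%N.
  rewrite -(size_map (fun k => k./2) sel) -[leqRHS](size_iota 0).
  by apply: uniq_leq_size => // i /mapP [k /Wi [_ kn] ->]; rewrite mem_iota.
rewrite phiB phiM phiB !phi_nat natrB // mulrBl [phi q * _]mulrC mulfK ?gt_eqF ?phi_gt0 //.
by rewrite addrC subrK.
Qed.

Lemma size_bits z : size (bits n z) = n.
Proof. by elim: (n) z => [|n' IH] z //=; rewrite IH. Qed.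

(** The column operation is applied to the rows still to come as well: [X'] is completed by the
    images of [Z0], and the factorization found is pulled back. *)
Lemma completable_same (s : seq nat) mask X X' (Z0 : seq (seq bool)) :
  completable X' -> size mask = n -> size s = n ->
  (forall j, (j < n)%N -> j \in s) -> all (fun x => size x == n) X' ->
  size X' = size X -> (size X + size Z0)%N = n ->
  (forall x, x \in X -> act s mask x \in X' \/ flip true (act s mask x) \in X') ->
  row_factor t (X ++ Z0).
Proof.
move=> cX' sm ss ins sX' szX szZ XX'; apply: (row_factor_act ss sm ins).
have sact x : size (act s mask x) = n by rewrite size_map size_zip ss sm minnn.
have := cX' (map (act s mask) Z0); rewrite size_map szX => /(_ _ szZ).
have -> : all (fun y => size y == n) (map (act s mask) Z0).
  by apply/allP => _ /mapP [x _ ->]; rewrite sact.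
move=> /(_ isT); apply: row_factor_sub => y; rewrite map_cat mem_cat => /orP [|yZ]; last first.
  by exists false, y => //; rewrite mem_cat yZ orbT.
case/mapP => x /XX' [] h ->.
  by exists false, (act s mask x) => //; rewrite mem_cat h.
exists true, (flip true (act s mask x)); first by rewrite mem_cat h.
by move=> j jn; rewrite (nth_map false) ?sact // addTb negbK.
Qed.

(** Induction on the tree for one fixed true row [y], with the partial row [pt] generalized. At a
    [Split] only the branch that agrees with [y] is followed, and [pt] remains consistent with
    [y]. *)
Lemma check_sound certs next X h pt y Y :
  check n p q certs next X h pt -> all wf_certificate certs ->
  (forall X', X' \in next -> completable X' /\ all (fun x => size x == n) X') ->
  consistent pt y ->
  all (fun x => size x == n) (y :: X ++ Y) -> size (y :: X ++ Y) = n ->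
  row_factor t (y :: X ++ Y).
Proof.
move=> + wf cnext + sall sz.
elim: h pt => [i|i sel|i s m|j h0 IH0 h1 IH1] pt /=.
- move=> /and3P[/eqP ptE iX pq] [sy cy].
  apply: (completable_dup _ iX pq); last by move: sz; rewrite /= size_cat.
  have sXi : size (nth [::] X i) = n.
    by apply/eqP; apply: (allP sall); rewrite inE mem_cat mem_nth ?orbT.
  apply: (@eq_from_nth _ false); first by rewrite sXi sy.
  move=> j jn; apply/esym/cy; rewrite ptE (nth_map false) //.
- move=> /and5P[us sX ic /eqP sT /allP col] [sy cy].
  apply: (@completable_cut (nth (1%BZ, [::]) certs i) sel) => //.
    by apply: (allP wf); rewrite mem_nth.
  move=> j jn; have := col j; rewrite mem_iota jn => /(_ isT) /allP /(_ (nth false y j)).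
  have -> : nth false y j \in (if nth None pt j is Some b then [:: b] else [:: false; true]).
    case E: (nth None pt j) => [b|]; first by rewrite (cy _ _ E) inE.
    by case: (nth false y j).
  move=> /(_ isT); congr column_ok; apply: eq_map => k.
  by case: (k./2).
- move=> /and5P[inx /eqP sX' /eqP ss /allP ins] /and3P[/eqP spt /allP somept XX'] [sy cy].
  move/(@allP _ (fun x => let x' := act s (bits n m) x in
     (x' \in nth [::] next i) || (flip true x' \in nth [::] next i)) (pmap id pt :: X)): XX' => XX'.
  have [cX' aX'] := cnext _ (mem_nth [::] inx).
  rewrite -cat_cons; apply: (@completable_same s (bits n m) _ _ _ cX') => //.
  + by rewrite size_bits.
  + by move=> j jn; apply: ins; rewrite mem_iota.
  + by move: sz; rewrite /= size_cat.
  + have -> : y = pmap id pt.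
      have ptE : pt = map some y.
        apply: (@eq_from_nth _ None); first by rewrite size_map spt.
        move=> j jp; rewrite (nth_map false) ?sy -?spt //.
        have := somept _ (mem_nth None jp).
        by case E: (nth None pt j) => [b|] // _; rewrite (cy _ _ E).
      by rewrite ptE; elim: (y) => //= a z IH; rewrite -IH.
    by move=> x /XX' /orP.
(* Writing the true entry of [y] at position [j] preserves consistency, whatever stood there
   before. *)
- move=> /andP[c0 c1] [sy cy]; case yj: (nth false y j).
    apply: (IH1 _ c1); split=> // k b; rewrite nth_set_nth /=.
    by case: eqP => [-> [<-]|_ /cy].
  apply: (IH0 _ c0); split=> // k b; rewrite nth_set_nth /=.
  by case: eqP => [-> [<-]|_ /cy].
Qed.

Hypothesis n0 : (0 < n)%N.

(** Since [X] has fewer than [n] rows, a completion has a next row; multiplying it by its first sign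
    gives the normalized row on which the tree branches. *)
Lemma completableP X : (size X < n)%N -> all (fun x => size x == n) X ->
  (forall y Y, consistent (Some false :: nseq n.-1 None) y ->
     all (fun x => size x == n) (y :: X ++ Y) -> size (y :: X ++ Y) = n ->
     row_factor t (y :: X ++ Y)) ->
  completable X.
Proof.
move=> Xn sX yY [|y Y] /=; first by rewrite addn0 => _ XE; rewrite XE ltnn in Xn.
move=> /andP[/eqP sy sY] sz.
have sy' : size (flip (head false y) y) = n by rewrite size_map.
apply: (@row_factor_sub _ (flip (head false y) y :: X ++ Y)).
  move=> x; rewrite mem_cat inE orbCA => /predU1P[->|xXY].
    exists (head false y), (flip (head false y) y); first by rewrite mem_head.
    by move=> j jn; rewrite (nth_map false) ?sy // addbA addbb.
  by exists false, x => //; rewrite inE mem_cat xXY orbT.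
apply: yY.
- split=> //; case: (y) sy => [/esym n00|a z _]; first by move: n0; rewrite n00.
  case=> [|j] b /=; first by case=> <-; rewrite addbb.
  by rewrite nth_nseq; case: ifP.
- by rewrite /= sy' eqxx all_cat sX sY.
- by rewrite /= size_cat -addnS.
Qed.

(** Induction from the last level back to the first: the verdict on a level relies only on the one
    after it, through [Same]. *)
Lemma check_levels_sound certs S final :
  check_levels n p q certs S final -> all wf_certificate certs ->
  completable (map (bits n) final) ->
  forall X : seq nat, X \in map fst (head [::] S) -> completable (map (bits n) X).
Proof.
have bitsn (X : seq nat) : all (fun x => size x == n) (map (bits n) X).
  by apply/allP => _ /mapP [z _ ->]; rewrite size_bits.
have all_fst (P : seq nat * hint -> bool) L : all P L ->
    forall X : seq nat, X \in map fst L -> exists2 h, P (X, h) & true.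
  elim: L => [//|[X h] L IH] /= /andP[PX /IH {}IH] Z; rewrite inE.
  by case/predU1P => [->|/IH//]; exists h.
move=> + wf cfinal; elim: S => [//|L S IH] /= /andP[/all_fst cL /IH {}IH].
move=> X /cL [h /= /andP[szX chk] _].
apply: completableP; rewrite ?size_map // => y Y cy sall sz.
apply: (check_sound chk wf _ cy sall sz) => X'.
case: S IH {cL chk} => [|L' S] IH.
  by rewrite inE => /eqP ->; split.
rewrite (map_comp (map (bits n)) fst) => /mapP [X0 X0L ->].
by split=> //; exact: IH.
Qed.

(** The search starts from the single row of all +1, and negating columns brings any matrix to that
    form. *)
Lemma row_factor_search certs S final M :
  check_levels n p q certs S final -> all wf_certificate certs ->
  map fst (head [::] S) = [:: [:: 0%N]] ->
  row_factor t (map (bits n) final) -> size final = n ->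
  all (fun x => size x == n) M -> size M = n -> row_factor t M.
Proof.
move=> chk wf S0 ffin szfin sM szM.
have cfin : completable (map (bits n) final).
  (* [final] already has [n] rows, so its only completion is itself. *)
  move=> [|y Y] _; first by rewrite cats0.
  by rewrite size_map szfin /= => E; exfalso; lia.
have c0 := check_levels_sound chk wf cfin; rewrite S0 in c0.
have {c0} := c0 [:: 0%N] (mem_head _ _).
case: M sM szM => [|y M] /=; first by move=> _ n00; move: n0; rewrite -n00.
move=> /andP[/eqP sy sM] szM c0; rewrite -cat1s.
(* Used as a column mask, the first row [y] turns itself into all +1. *)
apply: (@completable_same (iota 0 n) y [:: y] _ _ c0) => //.
- by rewrite size_iota.
- by move=> j jn; rewrite mem_iota.
- by rewrite /= size_bits eqxx.
move=> x; rewrite inE => /eqP ->; left; rewrite inE; apply/eqP.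
apply: (@eq_from_nth _ false).
  by rewrite size_bits size_map size_zip size_iota sy minnn.
rewrite size_map size_zip size_iota sy minnn => j jn.
rewrite (nth_map (0%N, false)) ?size_zip ?size_iota ?sy ?minnn // nth_zip ?size_iota ?sy //=.
rewrite nth_iota // addbb.
elim: (n) j {jn} => [|n' IH] [|j] //=.
Qed.

End RowFactor.

(** * The exact factorization and the polar factor of the extremal matrix *)

Section Extremal.
Variables (R : realType) (n : nat).

Lemma schur_factor_rows t (E : 'M[R]_n) : sign_matrix E ->
  row_factor n t [seq [seq E i j == -1 | j <- enum 'I_n] | i <- enum 'I_n] ->
  schur_factor t E.
Proof.
move=> sE [p [b [bt Ea]]].
have /fin_all_exists [a aP] (i : 'I_n) : exists a : 'I_p -> R, \sum_k a k ^+ 2 <= 1 /\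
    forall j : 'I_n, E i j = \sum_k a k * b k j.
  have [|a [a1 aE]] := Ea [seq E i j == -1 | j <- enum 'I_n].
    by apply/mapP; exists i => //; rewrite mem_enum.
  exists a; split=> // j; rewrite -aE // (nth_map j) ?size_enum_ord // nth_ord_enum.
  case: (sE i j) => ->; rewrite ?eqxx ?expr1 //.
  by rewrite -subr_eq0 opprK (_ : (1 + 1 == 0) = false) ?expr0 // -(natrD _ 1 1) pnatr_eq0.
exists p, a, (fun k (j : 'I_n) => b k j); split; [|by move=> j; exact: bt|];
  by move=> i; case: (aP i).
Qed.

Definition sign_mx (X : seq (seq bool)) : 'M[R]_n :=
  \matrix_(i, j) (-1) ^+ nth false (nth [::] X i) j.

Lemma row_factor_sign_mx t X : size X = n ->
  schur_factor t (sign_mx X) -> row_factor n t X.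
Proof.
move=> sX [p [a [b [a1 bt FE]]]].
exists p, (fun k j => if insub j is Some j' then b k j' else 0); split.
  by move=> j jn; rewrite insubT /=.
move=> x xX; have iN : (index x X < n)%N by rewrite -sX index_mem.
exists (a (Ordinal iN)); split=> // j jn; rewrite insubT /=.
by rewrite -FE mxE /= nth_index.
Qed.

Variables (m a d : R) (U F : 'M[R]_n).
Hypotheses (m0 : 0 < m) (a0 : 0 < a) (d0 : 0 < d).
Hypotheses (UU : U *m U = m *: U) (Ut : U^T = U) (U1 : forall i, U i i = 1).
Hypotheses (FF : F *m F^T = (a ^+ 2)%:M + ((d ^+ 2 - a ^+ 2) / m) *: U)
  (FUF : forall j, (F^T *m U *m F) j j = d ^+ 2) (sF : sign_matrix F).

(* Acts as [y] on the range of [U] and as [x] on its kernel. *)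
Let blk (x y : R) : 'M[R]_n := x%:M + ((y - x) / m) *: U.

(** [U / m] is a projection, so these matrices multiply eigenvalue by eigenvalue. Roots and inverses
    of [F F^T] are thus obtained by taking them in the two arguments. *)
Lemma blkM x y x' y' : blk x y *m blk x' y' = blk (x * x') (y * y').
Proof.
have mn0 : m != 0 by rewrite gt_eqF.
rewrite /blk mulmxDl !mulmxDr -scalar_mxM -!scalemxAl -!scalemxAr UU.
rewrite mul_scalar_mx mul_mx_scalar !scalerA -!addrA -!scalerDl.
by congr (_ + _ *: _); field.
Qed.

Lemma blk_tr x y : (blk x y)^T = blk x y.
Proof. by rewrite /blk linearD /= linearZ /= Ut tr_scalar_mx. Qed.

Lemma blk1 : blk 1 1 = 1%:M.
Proof. by rewrite /blk subrr mul0r scale0r addr0. Qed.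

Lemma blk_diag x y i : blk x y i i = x + (y - x) / m.
Proof. by rewrite !mxE eqxx U1 mulr1. Qed.

Lemma F_col j : (F^T *m F) j j = n%:R.
Proof.
rewrite mxE -[n in RHS]card_ord -sumr_const; apply: eq_bigr => i _; rewrite mxE.
by case: (sF i j) => ->; ring.
Qed.

Lemma F_row i : (F *m F^T) i i = n%:R.
Proof.
rewrite mxE -[n in RHS]card_ord -sumr_const; apply: eq_bigr => j _; rewrite mxE.
by case: (sF i j) => ->; ring.
Qed.

Let r := a + (d - a) / m.

(** [A] is the fourth root of [F F^T] divided by [sqrt r], and [B = A^-1 F]. Then [A A^T] is
    [(F F^T)^(1/2) / r], whose diagonal is constantly 1, and [B^T B] is [r F^T (F F^T)^(-1/2) F],
    whose diagonal turns out to be [r^2]. *)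
Lemma schur_factor_extremal : 0 < r -> schur_factor (r ^+ 2) F.
Proof.
move=> r0; pose al := Num.sqrt a; pose de := Num.sqrt d; pose s := Num.sqrt r.
have al0 : 0 < al by rewrite sqrtr_gt0.
have de0 : 0 < de by rewrite sqrtr_gt0.
have s0 : 0 < s by rewrite sqrtr_gt0.
have al2 : al ^+ 2 = a by rewrite sqr_sqrtr // ltW.
have de2 : de ^+ 2 = d by rewrite sqr_sqrtr // ltW.
have s2 : s ^+ 2 = r by rewrite sqr_sqrtr // ltW.
exists n, (fun i k => blk al de i k / s), (fun k j => s * (blk al^-1 de^-1 *m F) k j); split.
- move=> i; under eq_bigr do rewrite expr_div_n s2.
  rewrite -mulr_suml ler_pdivrMr // mul1r.
  have -> : \sum_k blk al de i k ^+ 2 = (blk al de *m (blk al de)^T) i i.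
    by rewrite [RHS]mxE; apply: eq_bigr => k _; rewrite [_^T _ _]mxE expr2.
  by rewrite blk_tr blkM blk_diag -!expr2 al2 de2.
- move=> j; under eq_bigr do rewrite exprMn s2.
  rewrite -mulr_sumr expr2 ler_pM2l //; set B := _ *m F.
  have -> : \sum_k B k j ^+ 2 = (B^T *m B) j j.
    by rewrite [RHS]mxE; apply: eq_bigr => k _; rewrite [_^T _ _]mxE expr2.
  rewrite /B trmx_mul blk_tr -mulmxA [blk _ _ *m (_ *m _)]mulmxA blkM.
  rewrite -!expr2 !exprVn al2 de2 {1}/blk mulmxDl mulmxDr mul_scalar_mx -!scalemxAl -!scalemxAr.
  rewrite mulmxA mxE [X in X + _]mxE [X in _ + X]mxE F_col FUF.
  (* Comparing diagonals of [F F^T] expresses [n] through [a], [d] and [m]; with it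
     [n / a + (1 / d - 1 / a) d^2 / m] collapses to [r]. *)
  have nE : n%:R = a ^+ 2 + (d ^+ 2 - a ^+ 2) / m.
    by rewrite -(F_row j) FF; exact: blk_diag.
  rewrite nE /r le_eqVlt; apply/orP; left; apply/eqP.
  by field; rewrite !gt_eqF.
move=> i j; have FE : F = blk al de *m (blk al^-1 de^-1 *m F).
  by rewrite mulmxA blkM !mulfV ?gt_eqF // blk1 mul1mx.
rewrite {1}FE [LHS]mxE; apply: eq_bigr => k _.
by rewrite mulrA divfK // gt_eqF.
Qed.

(** Row [i] of [F o C] sums to the diagonal entry of [C F^T = (F F^T)^(1/2)], which is [r] for every
    [i]; so the constant vector is an eigenvector. *)
Lemma schur_radius_extremal : (0 < n)%N -> 0 < r ->
  (forall E : 'M[R]_n, sign_matrix E -> schur_factor (r ^+ 2) E) -> schur_radius R n = r.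
Proof.
move=> n0 r0 sE; have nr0 : 0 < n%:R :> R by rewrite ltr0n.
have FFb : F *m F^T = blk (a ^+ 2) (d ^+ 2) by [].
pose C := blk a^-1 d^-1 *m F.
have CC : C *m C^T = 1%:M.
  rewrite /C trmx_mul blk_tr mulmxA -[_ *m F *m _]mulmxA FFb !blkM -blk1.
  by congr blk; field; rewrite gt_eqF.
have FC i : \sum_j F i j * C i j = r.
  have -> : \sum_j F i j * C i j = (C *m F^T) i i.
    by rewrite mxE; apply: eq_bigr => j _; rewrite mulrC [F^T _ _]mxE.
  rewrite /C -mulmxA FFb blkM blk_diag /r.
  by field; rewrite !gt_eqF.
apply: (@schur_radiusE R n r F C (const_mx (Num.sqrt n%:R)^-1)) => //; first exact: ltW.
- exact: mulmx1C.
- apply/matrixP => i j; rewrite !ord1 !mxE eqxx.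
  under eq_bigr do rewrite !mxE -expr2 exprVn sqr_sqrtr ?ler0n //.
  by rewrite sumr_const card_ord -[X in X = _]mulr_natr mulVf ?gt_eqF.
apply/matrixP => i j; rewrite !mxE -(FC i) mulr_suml.
by apply: eq_bigr => k _; rewrite !mxE.
Qed.

End Extremal.

(** * From integer checks to the value of the Schur radius *)

Section Search.
Variables (R : realType) (n : nat).

Local Notation phi := (@phi R).

Definition zmx (X : seq (seq Z)) : 'M[R]_n :=
  \matrix_(i, j) phi (nth 0%BZ (nth [::] X i) j).

Definition signs (x : seq bool) : seq Z := map (fun b : bool => if b then (-1)%BZ else 1%BZ) x.

Definition blocks (m : nat) : seq (seq Z) :=
  mkseq (fun i => mkseq (fun j => if (i %/ m == j %/ m)%N then 1%BZ else 0%BZ) n) n.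

Definition transpose (X : seq (seq Z)) : seq (seq Z) :=
  mkseq (fun j => mkseq (fun i => nth 0%BZ (nth [::] X i) j) n) n.

(* [X X^T = A I + ((D - A) / m) U] and [(X^T U X) j j = D], where [U = blocks m]. *)
Definition extremal (m : nat) (A D : Z) (X : seq (seq Z)) : bool :=
  let U := blocks m in
  let Xt := transpose X in
  [&& all (fun i => all (fun j => Z.eqb (Z.of_nat m * dot (nth [::] X i) (nth [::] X j))
             ((if i == j then Z.of_nat m * A else 0) + (D - A) * nth 0%BZ (nth [::] U i) j))
           (iota 0 n)) (iota 0 n),
      all (fun i => all (fun j => Z.eqb (dot (nth [::] U i) (nth [::] U j))
             (Z.of_nat m * nth 0%BZ (nth [::] U i) j)) (iota 0 n)) (iota 0 n)
    & all (fun j => Z.eqb (dot (nth [::] Xt j)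
             (mkseq (fun i => dot (nth [::] U i) (nth [::] Xt j)) n)) D) (iota 0 n)].

Definition search (m : nat) (A D p q : Z) certs S final : bool :=
  [&& Z.ltb 0 q, all wf_certificate certs, map fst (head [::] S) == [:: [:: 0%N]],
      check_levels n p q certs S final, size final == n
    & extremal m A D (map signs (map (bits n) final))].

Lemma zmx_mul_tr X Y (i j : 'I_n) : (size (nth [::] X i) <= n)%N ->
  (zmx X *m (zmx Y)^T) i j = phi (dot (nth [::] X i) (nth [::] Y j)).
Proof.
by move=> sX; rewrite mxE (phi_dotE _ _ sX); apply: eq_bigr => k _; rewrite !mxE.
Qed.

Lemma zmx_signs X : size X = n -> all (fun x => size x == n) X ->
  zmx (map signs X) = sign_mx R n X.
Proof.
move=> sX /allP sXn; apply/matrixP => i j; rewrite !mxE (nth_map [::]) ?sX //.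
rewrite (nth_map false); first by case: nth; rewrite ?expr1 ?expr0 /phi //= NegzE mulrNz.
by rewrite (eqP (sXn _ (mem_nth [::] _))) ?sX.
Qed.

(** Only the squares [A = a^2] and [D = d^2] enter the matrix identities, so these can be checked in
    integers although [a] or [d] may be irrational. The search uses a rational lower bound [p / q]
    of [r^2]. *)
Lemma schur_radius_search (m : nat) (A D p q : Z) certs S final (a d : R) :
  (0 < n)%N -> (0 < m)%N -> 0 < a -> 0 < d -> a ^+ 2 = phi A -> d ^+ 2 = phi D ->
  0 < a + (d - a) / m%:R -> phi p / phi q <= (a + (d - a) / m%:R) ^+ 2 ->
  search m A D p q certs S final ->
  schur_radius R n = a + (d - a) / m%:R.
Proof.
move=> n0 m0 a0 d0 aA dD r0 pq /and5P[q0 wf /eqP S0 chk /andP[/eqP sfin]].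
set X := map (bits n) final; set Z0 := map signs X; set U := blocks m.
have mR0 : 0 < m%:R :> R by rewrite ltr0n.
move=> /and3P[/allP gramX /allP gramU /allP formX].
have sX : size X = n by rewrite size_map.
have sXn : all (fun x => size x == n) X.
  by apply/allP => _ /mapP [z _ ->]; rewrite size_bits.
have szX (i : 'I_n) : (size (nth [::] Z0 i) <= n)%N.
  rewrite (nth_map [::]) ?sX // size_map.
  by rewrite (eqP (allP sXn _ (mem_nth [::] _))) ?sX.
have szU (i : 'I_n) : (size (nth [::] U i) <= n)%N by rewrite nth_mkseq // size_mkseq.
have memi (i : 'I_n) : nat_of_ord i \in iota 0 n by rewrite mem_iota /=.
have UE (i j : 'I_n) : zmx U i j = if (i %/ m == j %/ m)%N then 1 else 0.
  by rewrite mxE !nth_mkseq //; case: ifP.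
have Ut : (zmx U)^T = zmx U by apply/matrixP => i j; rewrite [LHS]mxE !UE eq_sym.
have U1 i : zmx U i i = 1 by rewrite UE eqxx.
have UU : zmx U *m zmx U = m%:R *: zmx U.
  rewrite -{2}Ut; apply/matrixP => i j; rewrite zmx_mul_tr // [RHS]mxE.
  by have /allP /(_ j (memi j)) /Z.eqb_eq -> := gramU i (memi i); rewrite phiM phi_nat mxE.
have FF : zmx Z0 *m (zmx Z0)^T = (a ^+ 2)%:M + ((d ^+ 2 - a ^+ 2) / m%:R) *: zmx U.
  apply/matrixP => i j; rewrite zmx_mul_tr // !mxE aA dD.
  have /allP /(_ j (memi j)) /Z.eqb_eq := gramX i (memi i).
  move=> /(congr1 phi); rewrite phiM phi_nat phiD phiM phiB => E.
  (* [extremal] checks the identity multiplied by [m], which avoids division in [Z]. *)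
  apply: (mulfI (lt0r_neq0 mR0)); rewrite E mulrDr; congr (_ + _); last by field; rewrite gt_eqF.
  rewrite -val_eqE /=; case: eqP => _; rewrite ?mulr0n ?mulr0 ?phi0 // mulr1n phiM phi_nat //.
have FUF j : ((zmx Z0)^T *m zmx U *m zmx Z0) j j = d ^+ 2.
  have /Z.eqb_eq /(congr1 phi) := formX j (memi j).
  rewrite dD => <-; rewrite (@phi_dotE _ n) ?nth_mkseq ?size_mkseq // -mulmxA mxE.
  apply: eq_bigr => i _; rewrite !nth_mkseq // [_^T _ _]mxE [zmx Z0 _ _]mxE; congr (_ * _).
  rewrite (@phi_dotE _ n) ?size_mkseq // mxE; apply: eq_bigr => k _.
  by rewrite UE [zmx Z0 _ _]mxE !nth_mkseq //; case: ifP.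
have sF : sign_matrix (zmx Z0).
  by rewrite zmx_signs // => i j; rewrite mxE; case: nth; [right|left].
apply: (schur_radius_extremal mR0 a0 d0 UU Ut U1 FF sF n0 r0) => E sE.
apply: (schur_factor_rows sE).
(* Every sign matrix completes the root of the search. What remains is the factorization of [final],
   at cost exactly [r^2]. *)
apply: (row_factor_search q0 pq n0 chk wf S0) => //.
- apply: row_factor_sign_mx => //; rewrite -zmx_signs //.
  exact: (schur_factor_extremal mR0 a0 d0 UU Ut U1 FF FUF sF r0).
- by apply/allP => _ /mapP [i _ ->]; rewrite size_map size_enum_ord.
by rewrite size_map size_enum_ord.
Qed.

End Search.

(* Level [k] of each search lists the surviving [k x n] sign matrices up to equivalence, row [z]
   being [bits n z]. The trees and the certificates were found numerically. *)

Definition certificates5 : seq certificate := ([:: (35, [:: [:: 35]; [:: 7; 34]; [:: -7; 9;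
  33]])])%BZ.

Definition search5 : seq (seq (seq nat * hint)) := [:: [:: ([:: 0], Split 1 (Split 2 (Split 3 (Split
  4 (Dup 0) (Same 0 [:: 0; 1; 2; 3; 4] 16)) (Split 4 (Same 0 [:: 0; 1; 2; 4; 3] 16) (Same 1 [:: 0;
  1; 2; 3; 4] 24))) (Split 3 (Split 4 (Same 0 [:: 0; 1; 3; 4; 2] 16) (Same 1 [:: 0; 1; 3; 2; 4] 24))
  (Split 4 (Same 1 [:: 0; 1; 4; 2; 3] 24) (Same 1 [:: 2; 3; 4; 0; 1] 24)))) (Split 2 (Split 3 (Split
  4 (Same 0 [:: 0; 2; 3; 4; 1] 16) (Same 1 [:: 0; 2; 3; 1; 4] 24)) (Split 4 (Same 1 [:: 0; 2; 4; 1;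
  3] 24) (Same 1 [:: 1; 3; 4; 0; 2] 24))) (Split 3 (Split 4 (Same 1 [:: 0; 3; 4; 1; 2] 24) (Same 1
  [:: 1; 2; 4; 0; 3] 24)) (Split 4 (Same 1 [:: 1; 2; 3; 0; 4] 24) (Same 0 [:: 1; 2; 3; 4; 0]
  16)))))]; [:: ([:: 0; 16], Split 4 (Cut 0 [:: 0; 2; 4]) (Cut 0 [:: 0; 3; 5])); ([:: 0; 24], Split
  3 (Split 4 (Cut 0 [:: 0; 2; 4]) (Split 1 (Split 2 (Cut 0 [:: 0; 2; 5]) (Same 0 [:: 0; 1; 4; 3; 2]
  20)) (Split 2 (Same 0 [:: 0; 2; 4; 3; 1] 20) (Same 0 [:: 1; 2; 3; 4; 0] 20)))) (Split 4 (Split 1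
  (Split 2 (Cut 0 [:: 0; 2; 5]) (Same 0 [:: 0; 1; 3; 4; 2] 20)) (Split 2 (Same 0 [:: 0; 2; 3; 4; 1]
  20) (Same 0 [:: 1; 2; 4; 3; 0] 20))) (Cut 0 [:: 0; 3; 5])))]; [:: ([:: 0; 20; 24], Split 2 (Split
  1 (Cut 0 [:: 0; 2; 7]) (Split 3 (Split 4 (Cut 0 [:: 0; 2; 4]) (Same 0 [:: 0; 4; 2; 3; 1] 18)) (Cut
  0 [:: 0; 5; 7]))) (Split 3 (Cut 0 [:: 0; 4; 6]) (Split 4 (Split 1 (Same 1 [:: 0; 1; 3; 2; 4] 12)
  (Same 0 [:: 1; 4; 2; 3; 0] 18)) (Cut 0 [:: 0; 3; 7]))))]; [:: ([:: 0; 18; 20; 24], Split 1 (Split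
  2 (Cut 0 [:: 0; 2; 9]) (Cut 0 [:: 0; 5; 7])) (Split 2 (Cut 0 [:: 0; 4; 6]) (Split 3 (Cut 0 [:: 0;
  6; 8]) (Split 4 (Same 0 [:: 0; 4; 1; 2; 3] 29) (Cut 0 [:: 0; 3; 9]))))); ([:: 0; 12; 20; 24],
  Split 2 (Split 3 (Cut 0 [:: 0; 2; 4]) (Cut 0 [:: 0; 7; 9])) (Split 3 (Cut 0 [:: 0; 6; 8]) (Cut 0
  [:: 0; 3; 5])))]].

Definition certificates6 : seq certificate := ([:: (60, [:: [:: 60]; [:: 9; 59]; [:: 4; 8; 59]; [::
  -9; 21; -11; 54]]); (35, [:: [:: 35]; [:: 0; 35]; [:: 0; 7; 34]; [:: 7; 0; 0; 34]; [:: -7; 0; 0;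
  9; 33]; [:: 0; 7; -9; 0; 0; 33]]); (300, [:: [:: 300]; [:: -4; 299]; [:: -10; 52; 295]; [:: -43;
  9; 2; 296]; [:: -53; 7; 50; 11; 290]; [:: -19; 52; -2; 50; -13; 290]])])%BZ.

Definition search6 : seq (seq (seq nat * hint)) := [:: [:: ([:: 0], Split 1 (Split 2 (Split 3 (Split
  4 (Split 5 (Dup 0) (Same 2 [:: 0; 1; 2; 3; 4; 5] 32)) (Split 5 (Same 2 [:: 0; 1; 2; 3; 5; 4] 32)
  (Same 0 [:: 0; 1; 2; 3; 4; 5] 48))) (Split 4 (Split 5 (Same 2 [:: 0; 1; 2; 4; 5; 3] 32) (Same 0
  [:: 0; 1; 2; 4; 3; 5] 48)) (Split 5 (Same 0 [:: 0; 1; 2; 5; 3; 4] 48) (Same 1 [:: 0; 1; 2; 3; 4;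
  5] 56)))) (Split 3 (Split 4 (Split 5 (Same 2 [:: 0; 1; 3; 4; 5; 2] 32) (Same 0 [:: 0; 1; 3; 4; 2;
  5] 48)) (Split 5 (Same 0 [:: 0; 1; 3; 5; 2; 4] 48) (Same 1 [:: 0; 1; 3; 2; 4; 5] 56))) (Split 4
  (Split 5 (Same 0 [:: 0; 1; 4; 5; 2; 3] 48) (Same 1 [:: 0; 1; 4; 2; 3; 5] 56)) (Split 5 (Same 1 [::
  0; 1; 5; 2; 3; 4] 56) (Same 0 [:: 2; 3; 4; 5; 0; 1] 48))))) (Split 2 (Split 3 (Split 4 (Split 5
  (Same 2 [:: 0; 2; 3; 4; 5; 1] 32) (Same 0 [:: 0; 2; 3; 4; 1; 5] 48)) (Split 5 (Same 0 [:: 0; 2; 3;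
  5; 1; 4] 48) (Same 1 [:: 0; 2; 3; 1; 4; 5] 56))) (Split 4 (Split 5 (Same 0 [:: 0; 2; 4; 5; 1; 3]
  48) (Same 1 [:: 0; 2; 4; 1; 3; 5] 56)) (Split 5 (Same 1 [:: 0; 2; 5; 1; 3; 4] 56) (Same 0 [:: 1;
  3; 4; 5; 0; 2] 48)))) (Split 3 (Split 4 (Split 5 (Same 0 [:: 0; 3; 4; 5; 1; 2] 48) (Same 1 [:: 0;
  3; 4; 1; 2; 5] 56)) (Split 5 (Same 1 [:: 0; 3; 5; 1; 2; 4] 56) (Same 0 [:: 1; 2; 4; 5; 0; 3] 48)))
  (Split 4 (Split 5 (Same 1 [:: 0; 4; 5; 1; 2; 3] 56) (Same 0 [:: 1; 2; 3; 5; 0; 4] 48)) (Split 5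
  (Same 0 [:: 1; 2; 3; 4; 0; 5] 48) (Same 2 [:: 1; 2; 3; 4; 5; 0] 32))))))]; [:: ([:: 0; 48], Split
  1 (Split 2 (Split 3 (Split 4 (Split 5 (Dup 0) (Same 4 [:: 0; 1; 2; 3; 5; 4] 16)) (Split 5 (Same 4
  [:: 0; 1; 2; 3; 4; 5] 16) (Dup 1))) (Split 4 (Split 5 (Same 3 [:: 0; 1; 2; 4; 5; 3] 0) (Same 1 [::
  0; 1; 2; 5; 4; 3] 40)) (Split 5 (Same 1 [:: 0; 1; 2; 4; 5; 3] 40) (Same 3 [:: 0; 1; 2; 4; 5; 3]
  24)))) (Split 3 (Split 4 (Split 5 (Same 3 [:: 0; 1; 3; 4; 5; 2] 0) (Same 1 [:: 0; 1; 3; 5; 4; 2]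
  40)) (Split 5 (Same 1 [:: 0; 1; 3; 4; 5; 2] 40) (Same 3 [:: 0; 1; 3; 4; 5; 2] 24))) (Split 4
  (Split 5 (Same 0 [:: 4; 5; 2; 3; 0; 1] 12) (Same 2 [:: 0; 1; 2; 3; 4; 5] 0)) (Split 5 (Same 2 [::
  0; 1; 2; 3; 5; 4] 0) (Same 0 [:: 4; 5; 0; 1; 2; 3] 12))))) (Split 2 (Split 3 (Split 4 (Split 5
  (Same 3 [:: 0; 2; 3; 4; 5; 1] 0) (Same 1 [:: 0; 2; 3; 5; 4; 1] 40)) (Split 5 (Same 1 [:: 0; 2; 3;
  4; 5; 1] 40) (Same 3 [:: 0; 2; 3; 4; 5; 1] 24))) (Split 4 (Split 5 (Same 0 [:: 4; 5; 1; 3; 0; 2]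
  12) (Same 2 [:: 0; 2; 1; 3; 4; 5] 0)) (Split 5 (Same 2 [:: 0; 2; 1; 3; 5; 4] 0) (Same 0 [:: 4; 5;
  0; 2; 1; 3] 12)))) (Split 3 (Split 4 (Split 5 (Same 0 [:: 4; 5; 1; 2; 0; 3] 12) (Same 2 [:: 0; 3;
  1; 2; 4; 5] 0)) (Split 5 (Same 2 [:: 0; 3; 1; 2; 5; 4] 0) (Same 0 [:: 4; 5; 0; 3; 1; 2] 12)))
  (Split 4 (Split 5 (Same 3 [:: 1; 2; 3; 4; 5; 0] 24) (Same 1 [:: 1; 2; 3; 4; 5; 0] 40)) (Split 5
  (Same 1 [:: 1; 2; 3; 5; 4; 0] 40) (Same 3 [:: 1; 2; 3; 4; 5; 0] 0)))))); ([:: 0; 56], Split 1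
  (Split 2 (Split 3 (Split 4 (Split 5 (Dup 0) (Same 3 [:: 0; 1; 2; 3; 4; 5] 32)) (Split 5 (Same 3
  [:: 0; 1; 2; 3; 5; 4] 32) (Same 3 [:: 0; 1; 2; 4; 5; 3] 24))) (Split 4 (Split 5 (Same 3 [:: 0; 1;
  2; 4; 5; 3] 32) (Same 3 [:: 0; 1; 2; 3; 5; 4] 24)) (Split 5 (Same 3 [:: 0; 1; 2; 3; 4; 5] 24) (Dup
  1)))) (Split 3 (Split 4 (Split 5 (Same 3 [:: 3; 4; 5; 0; 1; 2] 32) (Same 2 [:: 0; 1; 3; 4; 5; 2]
  48)) (Split 5 (Same 2 [:: 0; 1; 3; 5; 4; 2] 48) (Same 2 [:: 0; 1; 4; 5; 3; 2] 44))) (Split 4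
  (Split 5 (Same 2 [:: 0; 1; 4; 5; 3; 2] 48) (Same 2 [:: 0; 1; 3; 5; 4; 2] 44)) (Split 5 (Same 2 [::
  0; 1; 3; 4; 5; 2] 44) (Same 3 [:: 3; 4; 5; 0; 1; 2] 24))))) (Split 2 (Split 3 (Split 4 (Split 5
  (Same 3 [:: 3; 4; 5; 0; 2; 1] 32) (Same 2 [:: 0; 2; 3; 4; 5; 1] 48)) (Split 5 (Same 2 [:: 0; 2; 3;
  5; 4; 1] 48) (Same 2 [:: 0; 2; 4; 5; 3; 1] 44))) (Split 4 (Split 5 (Same 2 [:: 0; 2; 4; 5; 3; 1]
  48) (Same 2 [:: 0; 2; 3; 5; 4; 1] 44)) (Split 5 (Same 2 [:: 0; 2; 3; 4; 5; 1] 44) (Same 3 [:: 3;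
  4; 5; 0; 2; 1] 24)))) (Split 3 (Split 4 (Split 5 (Same 3 [:: 3; 4; 5; 1; 2; 0] 24) (Same 2 [:: 1;
  2; 3; 4; 5; 0] 44)) (Split 5 (Same 2 [:: 1; 2; 3; 5; 4; 0] 44) (Same 2 [:: 1; 2; 4; 5; 3; 0] 48)))
  (Split 4 (Split 5 (Same 2 [:: 1; 2; 4; 5; 3; 0] 44) (Same 2 [:: 1; 2; 3; 5; 4; 0] 48)) (Split 5
  (Same 2 [:: 1; 2; 3; 4; 5; 0] 48) (Same 3 [:: 3; 4; 5; 1; 2; 0] 32)))))); ([:: 0; 32], Split 1
  (Split 2 (Split 3 (Split 4 (Split 5 (Dup 0) (Dup 1)) (Split 5 (Same 4 [:: 0; 1; 2; 3; 4; 5] 0)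
  (Same 4 [:: 0; 1; 2; 3; 4; 5] 32))) (Split 4 (Split 5 (Same 4 [:: 0; 1; 2; 4; 3; 5] 0) (Same 4 [::
  0; 1; 2; 4; 3; 5] 32)) (Split 5 (Same 3 [:: 0; 1; 2; 3; 4; 5] 0) (Same 3 [:: 0; 1; 2; 3; 4; 5]
  32)))) (Split 3 (Split 4 (Split 5 (Same 4 [:: 0; 1; 3; 4; 2; 5] 0) (Same 4 [:: 0; 1; 3; 4; 2; 5]
  32)) (Split 5 (Same 3 [:: 0; 1; 3; 2; 4; 5] 0) (Same 3 [:: 0; 1; 3; 2; 4; 5] 32))) (Split 4 (Split
  5 (Same 3 [:: 0; 1; 4; 2; 3; 5] 0) (Same 3 [:: 0; 1; 4; 2; 3; 5] 32)) (Split 5 (Same 3 [:: 2; 3;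
  4; 0; 1; 5] 32) (Same 3 [:: 2; 3; 4; 0; 1; 5] 0))))) (Split 2 (Split 3 (Split 4 (Split 5 (Same 4
  [:: 0; 2; 3; 4; 1; 5] 0) (Same 4 [:: 0; 2; 3; 4; 1; 5] 32)) (Split 5 (Same 3 [:: 0; 2; 3; 1; 4; 5]
  0) (Same 3 [:: 0; 2; 3; 1; 4; 5] 32))) (Split 4 (Split 5 (Same 3 [:: 0; 2; 4; 1; 3; 5] 0) (Same 3
  [:: 0; 2; 4; 1; 3; 5] 32)) (Split 5 (Same 3 [:: 1; 3; 4; 0; 2; 5] 32) (Same 3 [:: 1; 3; 4; 0; 2;
  5] 0)))) (Split 3 (Split 4 (Split 5 (Same 3 [:: 0; 3; 4; 1; 2; 5] 0) (Same 3 [:: 0; 3; 4; 1; 2; 5]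
  32)) (Split 5 (Same 3 [:: 1; 2; 4; 0; 3; 5] 32) (Same 3 [:: 1; 2; 4; 0; 3; 5] 0))) (Split 4 (Split
  5 (Same 3 [:: 1; 2; 3; 0; 4; 5] 32) (Same 3 [:: 1; 2; 3; 0; 4; 5] 0)) (Split 5 (Same 4 [:: 1; 2;
  3; 4; 0; 5] 32) (Same 4 [:: 1; 2; 3; 4; 0; 5] 0))))))]; [:: ([:: 0; 12; 48], Split 1 (Cut 0 [:: 0;
  4; 2; 7]) (Split 2 (Split 3 (Cut 0 [:: 0; 2; 6; 4]) (Split 4 (Split 5 (Cut 0 [:: 0; 2; 4; 6])
  (Same 1 [:: 0; 1; 2; 3; 4; 5] 0)) (Split 5 (Same 1 [:: 0; 1; 2; 3; 5; 4] 0) (Cut 0 [:: 0; 3; 5;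
  7])))) (Split 3 (Split 4 (Split 5 (Cut 0 [:: 0; 2; 4; 6]) (Same 1 [:: 0; 1; 3; 2; 4; 5] 0)) (Split
  5 (Same 1 [:: 0; 1; 3; 2; 5; 4] 0) (Cut 0 [:: 0; 3; 5; 7]))) (Cut 0 [:: 0; 3; 7; 5])))); ([:: 0;
  40; 48], Split 3 (Split 4 (Split 5 (Cut 0 [:: 4; 1; 6; 3]) (Split 1 (Split 2 (Cut 0 [:: 2; 0; 6;
  4]) (Same 0 [:: 0; 1; 5; 3; 4; 2] 36)) (Split 2 (Same 0 [:: 0; 2; 5; 3; 4; 1] 36) (Same 3 [:: 1;
  2; 0; 3; 4; 5] 0)))) (Split 5 (Cut 0 [:: 2; 0; 6; 5]) (Cut 0 [:: 2; 1; 4; 7]))) (Split 4 (Split 5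
  (Cut 0 [:: 2; 0; 4; 7]) (Cut 0 [:: 2; 1; 6; 5])) (Split 5 (Split 1 (Split 2 (Same 4 [:: 0; 1; 2;
  4; 3; 5] 24) (Same 3 [:: 0; 1; 2; 3; 4; 5] 0)) (Split 2 (Same 3 [:: 0; 2; 1; 3; 4; 5] 0) (Same 0
  [:: 1; 2; 5; 3; 4; 0] 36))) (Cut 0 [:: 4; 0; 6; 3])))); ([:: 0; 44; 48], Split 4 (Split 1 (Split 5
  (Cut 0 [:: 4; 0; 7; 2]) (Cut 0 [:: 2; 0; 6; 4])) (Split 2 (Split 3 (Split 5 (Cut 0 [:: 4; 1; 6;
  3]) (Same 3 [:: 2; 3; 0; 5; 4; 1] 40)) (Split 5 (Same 1 [:: 4; 5; 3; 1; 0; 2] 12) (Same 5 [:: 0;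
  5; 4; 3; 2; 1] 42))) (Split 3 (Split 5 (Same 1 [:: 4; 5; 2; 1; 0; 3] 12) (Same 5 [:: 0; 5; 4; 2;
  3; 1] 42)) (Split 5 (Cut 0 [:: 2; 0; 4; 7]) (Cut 0 [:: 2; 1; 6; 5]))))) (Split 5 (Split 2 (Split 3
  (Cut 0 [:: 2; 0; 6; 5]) (Split 1 (Same 3 [:: 0; 1; 2; 4; 5; 3] 40) (Same 5 [:: 1; 5; 4; 2; 3; 0]
  42))) (Split 1 (Split 3 (Same 3 [:: 0; 1; 3; 4; 5; 2] 40) (Same 2 [:: 0; 1; 2; 3; 4; 5] 28))
  (Split 3 (Same 5 [:: 1; 5; 4; 3; 2; 0] 42) (Same 3 [:: 2; 3; 1; 5; 4; 0] 40)))) (Split 1 (Cut 0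
  [:: 2; 1; 5; 7]) (Split 2 (Split 3 (Cut 0 [:: 2; 1; 4; 7]) (Same 1 [:: 4; 5; 2; 0; 1; 3] 12))
  (Split 3 (Same 1 [:: 4; 5; 3; 0; 1; 2] 12) (Cut 0 [:: 4; 0; 6; 3])))))); ([:: 0; 24; 32], Split 5
  (Cut 0 [:: 0; 2; 4; 6]) (Cut 0 [:: 0; 3; 5; 7])); ([:: 0; 16; 32], Split 4 (Cut 0 [:: 0; 2; 6; 4])
  (Cut 0 [:: 0; 3; 7; 5]))]; [:: ([:: 0; 36; 40; 48], Split 2 (Split 3 (Split 4 (Split 1 (Cut 0 [::
  4; 0; 6; 2]) (Split 5 (Cut 0 [:: 4; 1; 8; 3]) (Same 3 [:: 0; 5; 2; 3; 4; 1] 34))) (Cut 0 [:: 4; 1;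
  6; 9])) (Split 4 (Cut 0 [:: 4; 1; 8; 7]) (Cut 0 [:: 6; 0; 8; 5]))) (Split 3 (Split 4 (Cut 0 [:: 6;
  1; 8; 5]) (Cut 0 [:: 4; 0; 8; 7])) (Split 4 (Cut 0 [:: 4; 0; 6; 9]) (Split 5 (Split 1 (Same 2 [::
  0; 1; 2; 3; 4; 5] 0) (Same 3 [:: 1; 5; 2; 3; 4; 0] 34)) (Cut 0 [:: 4; 0; 6; 3]))))); ([:: 0; 42;
  12; 48], Split 1 (Cut 0 [:: 0; 6; 2; 9]) (Split 2 (Split 3 (Cut 0 [:: 0; 2; 8; 6]) (Split 4 (Cut 0
  [:: 2; 0; 6; 4]) (Split 5 (Same 0 [:: 0; 2; 1; 3; 4; 5] 0) (Cut 0 [:: 2; 1; 6; 5])))) (Split 3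
  (Split 4 (Split 5 (Cut 0 [:: 0; 2; 6; 8]) (Same 0 [:: 0; 4; 1; 5; 2; 3] 0)) (Split 5 (Same 0 [::
  4; 3; 5; 2; 0; 1] 10) (Cut 0 [:: 0; 3; 7; 9]))) (Cut 0 [:: 0; 3; 9; 7])))); ([:: 0; 28; 44; 48],
  Split 1 (Split 4 (Split 5 (Cut 0 [:: 4; 0; 6; 2]) (Cut 0 [:: 2; 0; 5; 6])) (Split 5 (Cut 0 [:: 2;
  0; 7; 4]) (Cut 0 [:: 2; 1; 5; 9]))) (Split 2 (Split 3 (Split 4 (Split 5 (Cut 0 [:: 4; 1; 6; 3])
  (Cut 0 [:: 2; 0; 6; 5])) (Split 5 (Cut 0 [:: 2; 0; 4; 7]) (Cut 0 [:: 2; 1; 4; 9]))) (Split 4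
  (Split 5 (Same 0 [:: 0; 1; 2; 3; 4; 5] 0) (Same 0 [:: 1; 0; 2; 3; 4; 5] 28)) (Split 5 (Same 0 [::
  0; 1; 3; 2; 4; 5] 28) (Same 0 [:: 1; 0; 3; 2; 4; 5] 0)))) (Split 3 (Split 4 (Split 5 (Same 0 [::
  0; 1; 3; 2; 4; 5] 0) (Same 0 [:: 1; 0; 3; 2; 4; 5] 28)) (Split 5 (Same 0 [:: 0; 1; 2; 3; 4; 5] 28)
  (Same 0 [:: 1; 0; 2; 3; 4; 5] 0))) (Split 4 (Split 5 (Cut 0 [:: 2; 0; 4; 9]) (Cut 0 [:: 2; 1; 4;
  7])) (Split 5 (Cut 0 [:: 2; 1; 6; 5]) (Cut 0 [:: 4; 0; 6; 3])))))); ([:: 0; 28; 40; 48], Split 3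
  (Split 4 (Split 5 (Cut 0 [:: 6; 1; 8; 3]) (Split 2 (Cut 0 [:: 2; 0; 6; 5]) (Split 1 (Same 2 [:: 0;
  1; 5; 3; 4; 2] 36) (Same 1 [:: 1; 0; 2; 3; 4; 5] 0)))) (Split 5 (Cut 0 [:: 2; 0; 8; 7]) (Cut 0 [::
  2; 1; 6; 9]))) (Split 4 (Split 5 (Cut 0 [:: 2; 0; 6; 9]) (Cut 0 [:: 2; 1; 8; 7])) (Split 1 (Cut 0
  [:: 6; 0; 8; 4]) (Split 5 (Split 2 (Same 1 [:: 0; 1; 2; 3; 4; 5] 0) (Cut 0 [:: 2; 1; 6; 5])) (Cut
  0 [:: 6; 0; 8; 3]))))); ([:: 0; 24; 40; 48], Split 3 (Split 4 (Split 5 (Cut 0 [:: 4; 1; 6; 3])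
  (Cut 0 [:: 2; 0; 6; 5])) (Split 5 (Cut 0 [:: 2; 0; 4; 7]) (Cut 0 [:: 2; 1; 4; 9]))) (Split 4
  (Split 5 (Cut 0 [:: 2; 0; 4; 9]) (Cut 0 [:: 2; 1; 4; 7])) (Split 5 (Cut 0 [:: 2; 1; 6; 5]) (Cut 0
  [:: 4; 0; 6; 3])))); ([:: 0; 42; 44; 48], Split 1 (Split 4 (Split 2 (Cut 0 [:: 4; 0; 6; 2]) (Cut 0
  [:: 2; 0; 5; 6])) (Split 5 (Split 3 (Cut 0 [:: 2; 0; 8; 5]) (Split 2 (Same 1 [:: 0; 1; 2; 4; 5; 3]
  40) (Same 0 [:: 1; 0; 2; 3; 4; 5] 28))) (Cut 0 [:: 2; 1; 7; 9]))) (Split 4 (Split 2 (Cut 0 [:: 2;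
  0; 7; 4]) (Split 3 (Split 5 (Same 0 [:: 4; 0; 5; 3; 2; 1] 48) (Same 1 [:: 0; 5; 4; 2; 1; 3] 26))
  (Cut 0 [:: 4; 0; 6; 9]))) (Split 3 (Split 2 (Cut 0 [:: 4; 0; 8; 7]) (Split 5 (Same 1 [:: 3; 4; 5;
  1; 2; 0] 26) (Same 0 [:: 4; 3; 5; 0; 1; 2] 10))) (Split 5 (Split 2 (Same 0 [:: 1; 3; 2; 0; 5; 4]
  28) (Same 1 [:: 3; 2; 1; 5; 4; 0] 40)) (Cut 0 [:: 4; 0; 8; 3])))))]; [:: ([:: 0; 10; 28; 44; 48],
  Split 4 (Split 5 (Cut 0 [:: 0; 2; 4; 10]) (Cut 1 [:: 0; 2; 4; 7; 9; 10])) (Split 5 (Cut 1 [:: 0;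
  2; 4; 6; 8; 10]) (Cut 0 [:: 0; 3; 5; 11]))); ([:: 0; 26; 28; 40; 48], Split 3 (Split 4 (Split 1
  (Cut 2 [:: 2; 6; 4; 9; 1; 11]) (Split 2 (Cut 0 [:: 2; 0; 4; 7]) (Split 5 (Cut 0 [:: 8; 1; 10; 3])
  (Same 0 [:: 0; 1; 2; 5; 3; 4] 48)))) (Split 5 (Cut 0 [:: 2; 0; 10; 9]) (Cut 0 [:: 2; 1; 8; 11])))
  (Split 4 (Split 5 (Cut 0 [:: 2; 0; 8; 11]) (Cut 0 [:: 2; 1; 10; 9])) (Split 1 (Cut 0 [:: 8; 0; 10;
  6]) (Cut 2 [:: 2; 6; 4; 9; 0; 11])))); ([:: 0; 28; 36; 40; 48], Split 2 (Split 3 (Split 4 (Cut 2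
  [:: 2; 7; 4; 9; 1; 11]) (Cut 0 [:: 6; 1; 8; 11])) (Split 4 (Cut 0 [:: 6; 1; 10; 9]) (Cut 0 [:: 8;
  0; 10; 7]))) (Split 3 (Split 4 (Cut 0 [:: 8; 1; 10; 7]) (Cut 0 [:: 6; 0; 10; 9])) (Split 4 (Cut 0
  [:: 6; 0; 8; 11]) (Cut 2 [:: 2; 7; 4; 9; 0; 11])))); ([:: 0; 34; 36; 40; 48], Split 1 (Split 2
  (Split 3 (Cut 2 [:: 2; 5; 11; 7; 1; 9]) (Cut 0 [:: 4; 1; 6; 9])) (Split 3 (Cut 0 [:: 4; 1; 8; 7])
  (Cut 0 [:: 6; 0; 8; 5]))) (Split 2 (Split 3 (Cut 0 [:: 6; 1; 8; 5]) (Cut 0 [:: 4; 0; 8; 7]))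
  (Split 3 (Cut 0 [:: 4; 0; 6; 9]) (Cut 2 [:: 2; 5; 11; 7; 0; 9]))))]].

Definition certificates7 : seq certificate := ([:: (28, [:: [:: 28]; [:: 9; 26]; [:: -2; 10; 26];
  [:: -2; 10; -6; 25]]); (10, [:: [:: 10]; [:: 0; 10]; [:: 3; 3; 9]; [:: -3; 3; 0; 9]]); (300, [::
  [:: 300]; [:: 34; 298]; [:: 14; 33; 297]; [:: 14; 33; 9; 297]; [:: -35; 129; -48; -47; 260]]);
  (150, [:: [:: 150]; [:: 30; 146]; [:: -30; 37; 142]; [:: 6; 29; 0; 147]; [:: 6; 29; 0; -37;
  142]]); (300, [:: [:: 300]; [:: 92; 285]; [:: -19; -9; 299]; [:: 19; 9; -7; 299]; [:: -56; 55;
  -25; 24; 287]; [:: -28; 74; -2; 2; 26; 288]]); (500, [:: [:: 500]; [:: -19; 499]; [:: 132; 12;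
  482]; [:: -129; 72; 78; 471]; [:: 4; 61; -36; 17; 494]; [:: -33; 33; -56; -17; 66; 489]]); (300,
  [:: [:: 300]; [:: 74; 290]; [:: 15; 4; 299]; [:: 6; -1; -43; 296]; [:: -54; 71; 14; 4; 286]; [::
  -48; 76; 8; 9; 10; 285]]); (500, [:: [:: 500]; [:: 77; 494]; [:: -44; 42; 496]; [:: -54; 14; -21;
  496]; [:: 41; 99; 12; 43; 486]; [:: -73; 175; 5; -7; -76; 456]]); (90, [:: [:: 90]; [:: 0; 90];
  [:: 18; 0; 88]; [:: 18; 0; -22; 85]; [:: 0; 18; 0; 0; 88]; [:: 0; 18; 0; 0; -22; 85]]); (500, [::
  [:: 500]; [:: -85; 492]; [:: 22; 15; 499]; [:: 10; 18; -71; 494]; [:: 100; 144; 2; 10; 468]; [::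
  -50; 93; 21; 11; -108; 476]]); (500, [:: [:: 500]; [:: -43; 498]; [:: 109; -34; 486]; [:: -43; 95;
  -28; 488]; [:: -63; 17; -49; 11; 493]; [:: -14; 69; -6; 57; 97; 482]]); (300, [:: [:: 300]; [::
  -7; 299]; [:: -7; 4; 299]; [:: -25; 23; -25; 297]; [:: 76; 1; -2; -2; 290]; [:: -45; 23; -28; -41;
  77; 281]; [:: 37; 47; 32; 24; 2; 7; 291]]); (500, [:: [:: 500]; [:: -26; 499]; [:: -111; 20; 487];
  [:: 44; 47; -35; 494]; [:: 27; 29; -24; -51; 495]; [:: 35; 39; -30; -46; 96; 484]; [:: -37; 102;
  24; 34; 36; 39; 483]]); (500, [:: [:: 500]; [:: 15; 499]; [:: -49; 14; 497]; [:: -45; 17; -24;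
  497]; [:: -81; 39; -37; -42; 488]; [:: 25; 121; 33; 32; 33; 481]; [:: 55; 94; 43; 47; 53; -128;
  463]])])%BZ.

Definition search7 : seq (seq (seq nat * hint)) := [:: [:: ([:: 0], Split 1 (Split 2 (Split 3 (Split
  4 (Split 5 (Split 6 (Dup 0) (Same 0 [:: 0; 1; 2; 3; 4; 5; 6] 64)) (Split 6 (Same 0 [:: 0; 1; 2; 3;
  4; 6; 5] 64) (Same 1 [:: 0; 1; 2; 3; 4; 5; 6] 96))) (Split 5 (Split 6 (Same 0 [:: 0; 1; 2; 3; 5;
  6; 4] 64) (Same 1 [:: 0; 1; 2; 3; 5; 4; 6] 96)) (Split 6 (Same 1 [:: 0; 1; 2; 3; 6; 4; 5] 96)
  (Same 2 [:: 0; 1; 2; 3; 4; 5; 6] 112)))) (Split 4 (Split 5 (Split 6 (Same 0 [:: 0; 1; 2; 4; 5; 6;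
  3] 64) (Same 1 [:: 0; 1; 2; 4; 5; 3; 6] 96)) (Split 6 (Same 1 [:: 0; 1; 2; 4; 6; 3; 5] 96) (Same 2
  [:: 0; 1; 2; 4; 3; 5; 6] 112))) (Split 5 (Split 6 (Same 1 [:: 0; 1; 2; 5; 6; 3; 4] 96) (Same 2 [::
  0; 1; 2; 5; 3; 4; 6] 112)) (Split 6 (Same 2 [:: 0; 1; 2; 6; 3; 4; 5] 112) (Same 2 [:: 3; 4; 5; 6;
  0; 1; 2] 112))))) (Split 3 (Split 4 (Split 5 (Split 6 (Same 0 [:: 0; 1; 3; 4; 5; 6; 2] 64) (Same 1
  [:: 0; 1; 3; 4; 5; 2; 6] 96)) (Split 6 (Same 1 [:: 0; 1; 3; 4; 6; 2; 5] 96) (Same 2 [:: 0; 1; 3;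
  4; 2; 5; 6] 112))) (Split 5 (Split 6 (Same 1 [:: 0; 1; 3; 5; 6; 2; 4] 96) (Same 2 [:: 0; 1; 3; 5;
  2; 4; 6] 112)) (Split 6 (Same 2 [:: 0; 1; 3; 6; 2; 4; 5] 112) (Same 2 [:: 2; 4; 5; 6; 0; 1; 3]
  112)))) (Split 4 (Split 5 (Split 6 (Same 1 [:: 0; 1; 4; 5; 6; 2; 3] 96) (Same 2 [:: 0; 1; 4; 5; 2;
  3; 6] 112)) (Split 6 (Same 2 [:: 0; 1; 4; 6; 2; 3; 5] 112) (Same 2 [:: 2; 3; 5; 6; 0; 1; 4] 112)))
  (Split 5 (Split 6 (Same 2 [:: 0; 1; 5; 6; 2; 3; 4] 112) (Same 2 [:: 2; 3; 4; 6; 0; 1; 5] 112))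
  (Split 6 (Same 2 [:: 2; 3; 4; 5; 0; 1; 6] 112) (Same 1 [:: 2; 3; 4; 5; 6; 0; 1] 96)))))) (Split 2
  (Split 3 (Split 4 (Split 5 (Split 6 (Same 0 [:: 0; 2; 3; 4; 5; 6; 1] 64) (Same 1 [:: 0; 2; 3; 4;
  5; 1; 6] 96)) (Split 6 (Same 1 [:: 0; 2; 3; 4; 6; 1; 5] 96) (Same 2 [:: 0; 2; 3; 4; 1; 5; 6]
  112))) (Split 5 (Split 6 (Same 1 [:: 0; 2; 3; 5; 6; 1; 4] 96) (Same 2 [:: 0; 2; 3; 5; 1; 4; 6]
  112)) (Split 6 (Same 2 [:: 0; 2; 3; 6; 1; 4; 5] 112) (Same 2 [:: 1; 4; 5; 6; 0; 2; 3] 112))))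
  (Split 4 (Split 5 (Split 6 (Same 1 [:: 0; 2; 4; 5; 6; 1; 3] 96) (Same 2 [:: 0; 2; 4; 5; 1; 3; 6]
  112)) (Split 6 (Same 2 [:: 0; 2; 4; 6; 1; 3; 5] 112) (Same 2 [:: 1; 3; 5; 6; 0; 2; 4] 112)))
  (Split 5 (Split 6 (Same 2 [:: 0; 2; 5; 6; 1; 3; 4] 112) (Same 2 [:: 1; 3; 4; 6; 0; 2; 5] 112))
  (Split 6 (Same 2 [:: 1; 3; 4; 5; 0; 2; 6] 112) (Same 1 [:: 1; 3; 4; 5; 6; 0; 2] 96))))) (Split 3
  (Split 4 (Split 5 (Split 6 (Same 1 [:: 0; 3; 4; 5; 6; 1; 2] 96) (Same 2 [:: 0; 3; 4; 5; 1; 2; 6]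
  112)) (Split 6 (Same 2 [:: 0; 3; 4; 6; 1; 2; 5] 112) (Same 2 [:: 1; 2; 5; 6; 0; 3; 4] 112)))
  (Split 5 (Split 6 (Same 2 [:: 0; 3; 5; 6; 1; 2; 4] 112) (Same 2 [:: 1; 2; 4; 6; 0; 3; 5] 112))
  (Split 6 (Same 2 [:: 1; 2; 4; 5; 0; 3; 6] 112) (Same 1 [:: 1; 2; 4; 5; 6; 0; 3] 96)))) (Split 4
  (Split 5 (Split 6 (Same 2 [:: 0; 4; 5; 6; 1; 2; 3] 112) (Same 2 [:: 1; 2; 3; 6; 0; 4; 5] 112))
  (Split 6 (Same 2 [:: 1; 2; 3; 5; 0; 4; 6] 112) (Same 1 [:: 1; 2; 3; 5; 6; 0; 4] 96))) (Split 5
  (Split 6 (Same 2 [:: 1; 2; 3; 4; 0; 5; 6] 112) (Same 1 [:: 1; 2; 3; 4; 6; 0; 5] 96)) (Split 6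
  (Same 1 [:: 1; 2; 3; 4; 5; 0; 6] 96) (Same 0 [:: 1; 2; 3; 4; 5; 6; 0] 64)))))))]; [:: ([:: 0; 64],
  Split 1 (Split 2 (Split 3 (Split 4 (Split 5 (Split 6 (Dup 0) (Dup 1)) (Split 6 (Same 0 [:: 0; 1;
  2; 3; 4; 5; 6] 0) (Same 0 [:: 0; 1; 2; 3; 4; 5; 6] 64))) (Split 5 (Split 6 (Same 0 [:: 0; 1; 2; 3;
  5; 4; 6] 0) (Same 0 [:: 0; 1; 2; 3; 5; 4; 6] 64)) (Split 6 (Same 2 [:: 0; 1; 2; 3; 4; 5; 6] 0)
  (Same 2 [:: 0; 1; 2; 3; 4; 5; 6] 64)))) (Split 4 (Split 5 (Split 6 (Same 0 [:: 0; 1; 2; 4; 5; 3;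
  6] 0) (Same 0 [:: 0; 1; 2; 4; 5; 3; 6] 64)) (Split 6 (Same 2 [:: 0; 1; 2; 4; 3; 5; 6] 0) (Same 2
  [:: 0; 1; 2; 4; 3; 5; 6] 64))) (Split 5 (Split 6 (Same 2 [:: 0; 1; 2; 5; 3; 4; 6] 0) (Same 2 [::
  0; 1; 2; 5; 3; 4; 6] 64)) (Split 6 (Same 1 [:: 0; 1; 2; 3; 4; 5; 6] 0) (Same 1 [:: 3; 4; 5; 0; 1;
  2; 6] 0))))) (Split 3 (Split 4 (Split 5 (Split 6 (Same 0 [:: 0; 1; 3; 4; 5; 2; 6] 0) (Same 0 [::
  0; 1; 3; 4; 5; 2; 6] 64)) (Split 6 (Same 2 [:: 0; 1; 3; 4; 2; 5; 6] 0) (Same 2 [:: 0; 1; 3; 4; 2;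
  5; 6] 64))) (Split 5 (Split 6 (Same 2 [:: 0; 1; 3; 5; 2; 4; 6] 0) (Same 2 [:: 0; 1; 3; 5; 2; 4; 6]
  64)) (Split 6 (Same 1 [:: 0; 1; 3; 2; 4; 5; 6] 0) (Same 1 [:: 2; 4; 5; 0; 1; 3; 6] 0)))) (Split 4
  (Split 5 (Split 6 (Same 2 [:: 0; 1; 4; 5; 2; 3; 6] 0) (Same 2 [:: 0; 1; 4; 5; 2; 3; 6] 64)) (Split
  6 (Same 1 [:: 0; 1; 4; 2; 3; 5; 6] 0) (Same 1 [:: 2; 3; 5; 0; 1; 4; 6] 0))) (Split 5 (Split 6
  (Same 1 [:: 0; 1; 5; 2; 3; 4; 6] 0) (Same 1 [:: 2; 3; 4; 0; 1; 5; 6] 0)) (Split 6 (Same 2 [:: 2;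
  3; 4; 5; 0; 1; 6] 64) (Same 2 [:: 2; 3; 4; 5; 0; 1; 6] 0)))))) (Split 2 (Split 3 (Split 4 (Split 5
  (Split 6 (Same 0 [:: 0; 2; 3; 4; 5; 1; 6] 0) (Same 0 [:: 0; 2; 3; 4; 5; 1; 6] 64)) (Split 6 (Same
  2 [:: 0; 2; 3; 4; 1; 5; 6] 0) (Same 2 [:: 0; 2; 3; 4; 1; 5; 6] 64))) (Split 5 (Split 6 (Same 2 [::
  0; 2; 3; 5; 1; 4; 6] 0) (Same 2 [:: 0; 2; 3; 5; 1; 4; 6] 64)) (Split 6 (Same 1 [:: 0; 2; 3; 1; 4;
  5; 6] 0) (Same 1 [:: 1; 4; 5; 0; 2; 3; 6] 0)))) (Split 4 (Split 5 (Split 6 (Same 2 [:: 0; 2; 4; 5;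
  1; 3; 6] 0) (Same 2 [:: 0; 2; 4; 5; 1; 3; 6] 64)) (Split 6 (Same 1 [:: 0; 2; 4; 1; 3; 5; 6] 0)
  (Same 1 [:: 1; 3; 5; 0; 2; 4; 6] 0))) (Split 5 (Split 6 (Same 1 [:: 0; 2; 5; 1; 3; 4; 6] 0) (Same
  1 [:: 1; 3; 4; 0; 2; 5; 6] 0)) (Split 6 (Same 2 [:: 1; 3; 4; 5; 0; 2; 6] 64) (Same 2 [:: 1; 3; 4;
  5; 0; 2; 6] 0))))) (Split 3 (Split 4 (Split 5 (Split 6 (Same 2 [:: 0; 3; 4; 5; 1; 2; 6] 0) (Same 2
  [:: 0; 3; 4; 5; 1; 2; 6] 64)) (Split 6 (Same 1 [:: 0; 3; 4; 1; 2; 5; 6] 0) (Same 1 [:: 1; 2; 5; 0;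
  3; 4; 6] 0))) (Split 5 (Split 6 (Same 1 [:: 0; 3; 5; 1; 2; 4; 6] 0) (Same 1 [:: 1; 2; 4; 0; 3; 5;
  6] 0)) (Split 6 (Same 2 [:: 1; 2; 4; 5; 0; 3; 6] 64) (Same 2 [:: 1; 2; 4; 5; 0; 3; 6] 0)))) (Split
  4 (Split 5 (Split 6 (Same 1 [:: 0; 4; 5; 1; 2; 3; 6] 0) (Same 1 [:: 1; 2; 3; 0; 4; 5; 6] 0))
  (Split 6 (Same 2 [:: 1; 2; 3; 5; 0; 4; 6] 64) (Same 2 [:: 1; 2; 3; 5; 0; 4; 6] 0))) (Split 5
  (Split 6 (Same 2 [:: 1; 2; 3; 4; 0; 5; 6] 64) (Same 2 [:: 1; 2; 3; 4; 0; 5; 6] 0)) (Split 6 (Same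
  0 [:: 1; 2; 3; 4; 5; 0; 6] 64) (Same 0 [:: 1; 2; 3; 4; 5; 0; 6] 0))))))); ([:: 0; 96], Split 1
  (Split 2 (Split 3 (Split 4 (Split 5 (Split 6 (Dup 0) (Same 0 [:: 0; 1; 2; 3; 4; 6; 5] 32)) (Split
  6 (Same 0 [:: 0; 1; 2; 3; 4; 5; 6] 32) (Dup 1))) (Split 5 (Split 6 (Same 2 [:: 0; 1; 2; 3; 5; 6;
  4] 0) (Same 4 [:: 0; 1; 2; 3; 6; 5; 4] 80)) (Split 6 (Same 4 [:: 0; 1; 2; 3; 5; 6; 4] 80) (Same 2
  [:: 0; 1; 2; 3; 5; 6; 4] 48)))) (Split 4 (Split 5 (Split 6 (Same 2 [:: 0; 1; 2; 4; 5; 6; 3] 0)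
  (Same 4 [:: 0; 1; 2; 4; 6; 5; 3] 80)) (Split 6 (Same 4 [:: 0; 1; 2; 4; 5; 6; 3] 80) (Same 2 [:: 0;
  1; 2; 4; 5; 6; 3] 48))) (Split 5 (Split 6 (Same 6 [:: 0; 1; 2; 3; 4; 5; 6] 0) (Same 3 [:: 0; 1; 2;
  3; 4; 5; 6] 0)) (Split 6 (Same 3 [:: 0; 1; 2; 3; 4; 6; 5] 0) (Same 6 [:: 0; 1; 2; 3; 4; 5; 6]
  96))))) (Split 3 (Split 4 (Split 5 (Split 6 (Same 2 [:: 0; 1; 3; 4; 5; 6; 2] 0) (Same 4 [:: 0; 1;
  3; 4; 6; 5; 2] 80)) (Split 6 (Same 4 [:: 0; 1; 3; 4; 5; 6; 2] 80) (Same 2 [:: 0; 1; 3; 4; 5; 6; 2]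
  48))) (Split 5 (Split 6 (Same 6 [:: 0; 1; 3; 2; 4; 5; 6] 0) (Same 3 [:: 0; 1; 3; 2; 4; 5; 6] 0))
  (Split 6 (Same 3 [:: 0; 1; 3; 2; 4; 6; 5] 0) (Same 6 [:: 0; 1; 3; 2; 4; 5; 6] 96)))) (Split 4
  (Split 5 (Split 6 (Same 6 [:: 0; 1; 4; 2; 3; 5; 6] 0) (Same 3 [:: 0; 1; 4; 2; 3; 5; 6] 0)) (Split
  6 (Same 3 [:: 0; 1; 4; 2; 3; 6; 5] 0) (Same 6 [:: 0; 1; 4; 2; 3; 5; 6] 96))) (Split 5 (Split 6
  (Same 6 [:: 2; 3; 4; 0; 1; 5; 6] 96) (Same 3 [:: 2; 3; 4; 0; 1; 6; 5] 0)) (Split 6 (Same 3 [:: 2;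
  3; 4; 0; 1; 5; 6] 0) (Same 6 [:: 2; 3; 4; 0; 1; 5; 6] 0)))))) (Split 2 (Split 3 (Split 4 (Split 5
  (Split 6 (Same 2 [:: 0; 2; 3; 4; 5; 6; 1] 0) (Same 4 [:: 0; 2; 3; 4; 6; 5; 1] 80)) (Split 6 (Same
  4 [:: 0; 2; 3; 4; 5; 6; 1] 80) (Same 2 [:: 0; 2; 3; 4; 5; 6; 1] 48))) (Split 5 (Split 6 (Same 6
  [:: 0; 2; 3; 1; 4; 5; 6] 0) (Same 3 [:: 0; 2; 3; 1; 4; 5; 6] 0)) (Split 6 (Same 3 [:: 0; 2; 3; 1;
  4; 6; 5] 0) (Same 6 [:: 0; 2; 3; 1; 4; 5; 6] 96)))) (Split 4 (Split 5 (Split 6 (Same 6 [:: 0; 2;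
  4; 1; 3; 5; 6] 0) (Same 3 [:: 0; 2; 4; 1; 3; 5; 6] 0)) (Split 6 (Same 3 [:: 0; 2; 4; 1; 3; 6; 5]
  0) (Same 6 [:: 0; 2; 4; 1; 3; 5; 6] 96))) (Split 5 (Split 6 (Same 6 [:: 1; 3; 4; 0; 2; 5; 6] 96)
  (Same 3 [:: 1; 3; 4; 0; 2; 6; 5] 0)) (Split 6 (Same 3 [:: 1; 3; 4; 0; 2; 5; 6] 0) (Same 6 [:: 1;
  3; 4; 0; 2; 5; 6] 0))))) (Split 3 (Split 4 (Split 5 (Split 6 (Same 6 [:: 0; 3; 4; 1; 2; 5; 6] 0)
  (Same 3 [:: 0; 3; 4; 1; 2; 5; 6] 0)) (Split 6 (Same 3 [:: 0; 3; 4; 1; 2; 6; 5] 0) (Same 6 [:: 0;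
  3; 4; 1; 2; 5; 6] 96))) (Split 5 (Split 6 (Same 6 [:: 1; 2; 4; 0; 3; 5; 6] 96) (Same 3 [:: 1; 2;
  4; 0; 3; 6; 5] 0)) (Split 6 (Same 3 [:: 1; 2; 4; 0; 3; 5; 6] 0) (Same 6 [:: 1; 2; 4; 0; 3; 5; 6]
  0)))) (Split 4 (Split 5 (Split 6 (Same 6 [:: 1; 2; 3; 0; 4; 5; 6] 96) (Same 3 [:: 1; 2; 3; 0; 4;
  6; 5] 0)) (Split 6 (Same 3 [:: 1; 2; 3; 0; 4; 5; 6] 0) (Same 6 [:: 1; 2; 3; 0; 4; 5; 6] 0)))
  (Split 5 (Split 6 (Same 2 [:: 1; 2; 3; 4; 5; 6; 0] 48) (Same 4 [:: 1; 2; 3; 4; 5; 6; 0] 80))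
  (Split 6 (Same 4 [:: 1; 2; 3; 4; 6; 5; 0] 80) (Same 2 [:: 1; 2; 3; 4; 5; 6; 0] 0))))))); ([:: 0;
  112], Split 1 (Split 2 (Split 3 (Split 4 (Split 5 (Split 6 (Dup 0) (Same 2 [:: 0; 1; 2; 3; 4; 5;
  6] 64)) (Split 6 (Same 2 [:: 0; 1; 2; 3; 4; 6; 5] 64) (Same 2 [:: 0; 1; 2; 3; 5; 6; 4] 48)))
  (Split 5 (Split 6 (Same 2 [:: 0; 1; 2; 3; 5; 6; 4] 64) (Same 2 [:: 0; 1; 2; 3; 4; 6; 5] 48))
  (Split 6 (Same 2 [:: 0; 1; 2; 3; 4; 5; 6] 48) (Dup 1)))) (Split 4 (Split 5 (Split 6 (Same 1 [:: 4;
  5; 6; 0; 1; 2; 3] 64) (Same 3 [:: 0; 1; 2; 4; 5; 6; 3] 96)) (Split 6 (Same 3 [:: 0; 1; 2; 4; 6; 5;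
  3] 96) (Same 3 [:: 0; 1; 2; 5; 6; 4; 3] 88))) (Split 5 (Split 6 (Same 3 [:: 0; 1; 2; 5; 6; 4; 3]
  96) (Same 3 [:: 0; 1; 2; 4; 6; 5; 3] 88)) (Split 6 (Same 3 [:: 0; 1; 2; 4; 5; 6; 3] 88) (Same 1
  [:: 4; 5; 6; 0; 1; 2; 3] 56))))) (Split 3 (Split 4 (Split 5 (Split 6 (Same 1 [:: 4; 5; 6; 0; 1; 3;
  2] 64) (Same 3 [:: 0; 1; 3; 4; 5; 6; 2] 96)) (Split 6 (Same 3 [:: 0; 1; 3; 4; 6; 5; 2] 96) (Same 3
  [:: 0; 1; 3; 5; 6; 4; 2] 88))) (Split 5 (Split 6 (Same 3 [:: 0; 1; 3; 5; 6; 4; 2] 96) (Same 3 [::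
  0; 1; 3; 4; 6; 5; 2] 88)) (Split 6 (Same 3 [:: 0; 1; 3; 4; 5; 6; 2] 88) (Same 1 [:: 4; 5; 6; 0; 1;
  3; 2] 56)))) (Split 4 (Split 5 (Split 6 (Same 6 [:: 4; 5; 6; 2; 3; 0; 1] 24) (Same 5 [:: 4; 5; 2;
  3; 0; 1; 6] 76)) (Split 6 (Same 5 [:: 4; 6; 2; 3; 0; 1; 5] 76) (Same 5 [:: 5; 6; 0; 1; 2; 3; 4]
  76))) (Split 5 (Split 6 (Same 5 [:: 5; 6; 2; 3; 0; 1; 4] 76) (Same 5 [:: 4; 6; 0; 1; 2; 3; 5] 76))
  (Split 6 (Same 5 [:: 4; 5; 0; 1; 2; 3; 6] 76) (Same 6 [:: 4; 5; 6; 0; 1; 2; 3] 24)))))) (Split 2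
  (Split 3 (Split 4 (Split 5 (Split 6 (Same 1 [:: 4; 5; 6; 0; 2; 3; 1] 64) (Same 3 [:: 0; 2; 3; 4;
  5; 6; 1] 96)) (Split 6 (Same 3 [:: 0; 2; 3; 4; 6; 5; 1] 96) (Same 3 [:: 0; 2; 3; 5; 6; 4; 1] 88)))
  (Split 5 (Split 6 (Same 3 [:: 0; 2; 3; 5; 6; 4; 1] 96) (Same 3 [:: 0; 2; 3; 4; 6; 5; 1] 88))
  (Split 6 (Same 3 [:: 0; 2; 3; 4; 5; 6; 1] 88) (Same 1 [:: 4; 5; 6; 0; 2; 3; 1] 56)))) (Split 4
  (Split 5 (Split 6 (Same 6 [:: 4; 5; 6; 1; 3; 0; 2] 24) (Same 5 [:: 4; 5; 1; 3; 0; 2; 6] 76))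
  (Split 6 (Same 5 [:: 4; 6; 1; 3; 0; 2; 5] 76) (Same 5 [:: 5; 6; 0; 2; 1; 3; 4] 76))) (Split 5
  (Split 6 (Same 5 [:: 5; 6; 1; 3; 0; 2; 4] 76) (Same 5 [:: 4; 6; 0; 2; 1; 3; 5] 76)) (Split 6 (Same
  5 [:: 4; 5; 0; 2; 1; 3; 6] 76) (Same 6 [:: 4; 5; 6; 0; 2; 1; 3] 24))))) (Split 3 (Split 4 (Split 5
  (Split 6 (Same 6 [:: 4; 5; 6; 1; 2; 0; 3] 24) (Same 5 [:: 4; 5; 1; 2; 0; 3; 6] 76)) (Split 6 (Same
  5 [:: 4; 6; 1; 2; 0; 3; 5] 76) (Same 5 [:: 5; 6; 0; 3; 1; 2; 4] 76))) (Split 5 (Split 6 (Same 5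
  [:: 5; 6; 1; 2; 0; 3; 4] 76) (Same 5 [:: 4; 6; 0; 3; 1; 2; 5] 76)) (Split 6 (Same 5 [:: 4; 5; 0;
  3; 1; 2; 6] 76) (Same 6 [:: 4; 5; 6; 0; 3; 1; 2] 24)))) (Split 4 (Split 5 (Split 6 (Same 1 [:: 4;
  5; 6; 1; 2; 3; 0] 56) (Same 3 [:: 1; 2; 3; 4; 5; 6; 0] 88)) (Split 6 (Same 3 [:: 1; 2; 3; 4; 6; 5;
  0] 88) (Same 3 [:: 1; 2; 3; 5; 6; 4; 0] 96))) (Split 5 (Split 6 (Same 3 [:: 1; 2; 3; 5; 6; 4; 0]
  88) (Same 3 [:: 1; 2; 3; 4; 6; 5; 0] 96)) (Split 6 (Same 3 [:: 1; 2; 3; 4; 5; 6; 0] 96) (Same 1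
  [:: 4; 5; 6; 1; 2; 3; 0] 64)))))))]; [:: ([:: 0; 32; 64], Split 5 (Split 6 (Cut 0 [:: 0; 2; 4; 6])
  (Cut 1 [:: 0; 2; 6; 4])) (Split 6 (Cut 1 [:: 0; 2; 4; 6]) (Cut 0 [:: 0; 3; 5; 7]))); ([:: 0; 56;
  64], Split 1 (Split 2 (Split 6 (Cut 1 [:: 0; 6; 2; 5]) (Cut 0 [:: 0; 6; 2; 5])) (Split 3 (Split 4
  (Split 5 (Split 6 (Cut 0 [:: 0; 2; 4; 6]) (Cut 1 [:: 0; 2; 6; 4])) (Split 6 (Same 11 [:: 0; 1; 3;
  4; 2; 5; 6] 0) (Same 11 [:: 3; 4; 0; 1; 5; 2; 6] 64))) (Split 5 (Split 6 (Same 11 [:: 0; 1; 3; 5;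
  2; 4; 6] 0) (Same 11 [:: 3; 5; 0; 1; 4; 2; 6] 64)) (Split 6 (Same 0 [:: 0; 1; 2; 3; 4; 5; 6] 0)
  (Same 9 [:: 0; 1; 2; 3; 4; 5; 6] 0)))) (Split 4 (Split 5 (Split 6 (Same 11 [:: 0; 1; 4; 5; 2; 3;
  6] 0) (Same 11 [:: 4; 5; 0; 1; 3; 2; 6] 64)) (Split 6 (Same 0 [:: 0; 1; 2; 4; 3; 5; 6] 0) (Same 9
  [:: 0; 1; 2; 4; 3; 5; 6] 0))) (Split 5 (Split 6 (Same 0 [:: 0; 1; 2; 5; 3; 4; 6] 0) (Same 9 [:: 0;
  1; 2; 5; 3; 4; 6] 0)) (Split 6 (Cut 1 [:: 0; 2; 4; 6]) (Cut 0 [:: 0; 3; 5; 7])))))) (Split 3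
  (Split 4 (Split 5 (Split 6 (Cut 0 [:: 0; 2; 4; 6]) (Cut 1 [:: 0; 2; 6; 4])) (Split 2 (Split 6
  (Same 11 [:: 0; 2; 3; 4; 1; 5; 6] 0) (Same 11 [:: 3; 4; 0; 2; 5; 1; 6] 64)) (Split 6 (Same 9 [::
  1; 2; 0; 5; 3; 4; 6] 0) (Same 0 [:: 1; 2; 0; 5; 3; 4; 6] 0)))) (Split 2 (Split 5 (Split 6 (Same 11
  [:: 0; 2; 3; 5; 1; 4; 6] 0) (Same 11 [:: 3; 5; 0; 2; 4; 1; 6] 64)) (Split 6 (Same 0 [:: 0; 2; 1;
  3; 4; 5; 6] 0) (Same 9 [:: 0; 2; 1; 3; 4; 5; 6] 0))) (Split 5 (Split 6 (Same 9 [:: 1; 2; 0; 4; 3;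
  5; 6] 0) (Same 0 [:: 1; 2; 0; 4; 3; 5; 6] 0)) (Split 6 (Same 11 [:: 4; 5; 1; 2; 3; 0; 6] 64) (Same
  11 [:: 1; 2; 4; 5; 0; 3; 6] 0))))) (Split 4 (Split 2 (Split 5 (Split 6 (Same 11 [:: 0; 2; 4; 5; 1;
  3; 6] 0) (Same 11 [:: 4; 5; 0; 2; 3; 1; 6] 64)) (Split 6 (Same 0 [:: 0; 2; 1; 4; 3; 5; 6] 0) (Same
  9 [:: 0; 2; 1; 4; 3; 5; 6] 0))) (Split 5 (Split 6 (Same 9 [:: 1; 2; 0; 3; 4; 5; 6] 0) (Same 0 [::
  1; 2; 0; 3; 4; 5; 6] 0)) (Split 6 (Same 11 [:: 3; 5; 1; 2; 4; 0; 6] 64) (Same 11 [:: 1; 2; 3; 5;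
  0; 4; 6] 0)))) (Split 5 (Split 2 (Split 6 (Same 0 [:: 0; 2; 1; 5; 3; 4; 6] 0) (Same 9 [:: 0; 2; 1;
  5; 3; 4; 6] 0)) (Split 6 (Same 11 [:: 3; 4; 1; 2; 5; 0; 6] 64) (Same 11 [:: 1; 2; 3; 4; 0; 5; 6]
  0))) (Split 6 (Cut 1 [:: 0; 2; 4; 6]) (Cut 0 [:: 0; 3; 5; 7])))))); ([:: 0; 48; 64], Split 4
  (Split 5 (Split 6 (Cut 0 [:: 0; 2; 4; 6]) (Cut 1 [:: 0; 2; 6; 4])) (Split 1 (Split 2 (Split 3
  (Split 6 (Cut 1 [:: 0; 6; 2; 5]) (Cut 0 [:: 0; 6; 2; 5])) (Split 6 (Same 12 [:: 0; 1; 2; 3; 4; 5;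
  6] 0) (Same 5 [:: 0; 1; 2; 3; 4; 5; 6] 0))) (Split 3 (Split 6 (Same 12 [:: 0; 1; 3; 2; 4; 5; 6] 0)
  (Same 5 [:: 0; 1; 3; 2; 4; 5; 6] 0)) (Split 6 (Same 11 [:: 0; 1; 2; 3; 4; 5; 6] 0) (Same 11 [:: 2;
  3; 0; 1; 5; 4; 6] 0)))) (Split 2 (Split 3 (Split 6 (Same 12 [:: 0; 2; 3; 1; 4; 5; 6] 0) (Same 5
  [:: 0; 2; 3; 1; 4; 5; 6] 0)) (Split 6 (Same 11 [:: 0; 2; 1; 3; 4; 5; 6] 0) (Same 11 [:: 1; 3; 0;
  2; 5; 4; 6] 0))) (Split 3 (Split 6 (Same 11 [:: 0; 3; 1; 2; 4; 5; 6] 0) (Same 11 [:: 1; 2; 0; 3;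
  5; 4; 6] 0)) (Split 6 (Same 5 [:: 1; 2; 3; 0; 5; 4; 6] 0) (Same 12 [:: 1; 2; 3; 0; 5; 4; 6]
  0)))))) (Split 5 (Split 1 (Split 2 (Split 3 (Split 6 (Cut 1 [:: 0; 6; 2; 5]) (Cut 0 [:: 0; 6; 2;
  5])) (Split 6 (Same 12 [:: 0; 1; 2; 3; 5; 4; 6] 0) (Same 5 [:: 0; 1; 2; 3; 5; 4; 6] 0))) (Split 3
  (Split 6 (Same 12 [:: 0; 1; 3; 2; 5; 4; 6] 0) (Same 5 [:: 0; 1; 3; 2; 5; 4; 6] 0)) (Split 6 (Same
  11 [:: 0; 1; 2; 3; 5; 4; 6] 0) (Same 11 [:: 2; 3; 0; 1; 4; 5; 6] 0)))) (Split 2 (Split 3 (Split 6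
  (Same 12 [:: 0; 2; 3; 1; 5; 4; 6] 0) (Same 5 [:: 0; 2; 3; 1; 5; 4; 6] 0)) (Split 6 (Same 11 [:: 0;
  2; 1; 3; 5; 4; 6] 0) (Same 11 [:: 1; 3; 0; 2; 4; 5; 6] 0))) (Split 3 (Split 6 (Same 11 [:: 0; 3;
  1; 2; 5; 4; 6] 0) (Same 11 [:: 1; 2; 0; 3; 4; 5; 6] 0)) (Split 6 (Same 5 [:: 1; 2; 3; 0; 4; 5; 6]
  0) (Same 12 [:: 1; 2; 3; 0; 4; 5; 6] 0))))) (Split 6 (Cut 1 [:: 0; 2; 4; 6]) (Cut 0 [:: 0; 3; 5;
  7])))); ([:: 0; 88; 96], Split 1 (Split 2 (Split 3 (Split 4 (Split 5 (Split 6 (Dup 0) (Cut 0 [::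
  2; 0; 4; 6])) (Split 6 (Cut 0 [:: 2; 0; 5; 6]) (Dup 2))) (Split 5 (Split 6 (Same 5 [:: 0; 1; 2; 5;
  3; 6; 4] 64) (Same 12 [:: 0; 1; 2; 6; 5; 4; 3] 40)) (Split 6 (Same 6 [:: 0; 1; 2; 3; 5; 6; 4] 80)
  (Same 5 [:: 0; 1; 2; 6; 3; 5; 4] 104)))) (Split 4 (Split 5 (Split 6 (Same 5 [:: 0; 1; 2; 5; 4; 6;
  3] 64) (Same 12 [:: 0; 1; 2; 6; 5; 3; 4] 40)) (Split 6 (Same 6 [:: 0; 1; 2; 4; 5; 6; 3] 80) (Same
  5 [:: 0; 1; 2; 6; 4; 5; 3] 104))) (Split 5 (Split 6 (Cut 0 [:: 2; 0; 4; 7]) (Dup 1)) (Split 6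
  (Same 2 [:: 0; 1; 2; 3; 4; 5; 6] 56) (Cut 0 [:: 2; 1; 5; 7]))))) (Split 3 (Split 4 (Split 5 (Split
  6 (Same 11 [:: 0; 1; 3; 4; 5; 6; 2] 0) (Same 13 [:: 0; 1; 3; 4; 6; 5; 2] 80)) (Split 6 (Same 10
  [:: 3; 4; 0; 1; 5; 6; 2] 80) (Same 11 [:: 0; 1; 3; 4; 6; 5; 2] 48))) (Split 5 (Split 6 (Same 1 [::
  0; 1; 3; 2; 4; 5; 6] 0) (Same 3 [:: 0; 1; 6; 5; 4; 3; 2] 84)) (Split 6 (Same 4 [:: 0; 1; 2; 3; 4;
  5; 6] 0) (Same 1 [:: 0; 1; 3; 2; 4; 6; 5] 96)))) (Split 4 (Split 5 (Split 6 (Same 1 [:: 0; 1; 4;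
  2; 3; 5; 6] 0) (Same 3 [:: 0; 1; 6; 5; 3; 4; 2] 84)) (Split 6 (Same 4 [:: 0; 1; 2; 4; 3; 5; 6] 0)
  (Same 1 [:: 0; 1; 4; 2; 3; 6; 5] 96))) (Split 5 (Split 6 (Same 18 [:: 3; 4; 5; 2; 6; 0; 1] 116)
  (Same 0 [:: 3; 4; 5; 6; 0; 1; 2] 52)) (Split 6 (Same 16 [:: 0; 1; 2; 3; 4; 5; 6] 0) (Same 18 [::
  3; 4; 6; 2; 5; 0; 1] 96)))))) (Split 2 (Split 3 (Split 4 (Split 5 (Split 6 (Same 11 [:: 0; 2; 3;
  4; 5; 6; 1] 0) (Same 13 [:: 0; 2; 3; 4; 6; 5; 1] 80)) (Split 6 (Same 10 [:: 3; 4; 0; 2; 5; 6; 1]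
  80) (Same 11 [:: 0; 2; 3; 4; 6; 5; 1] 48))) (Split 5 (Split 6 (Same 1 [:: 0; 2; 3; 1; 4; 5; 6] 0)
  (Same 3 [:: 0; 2; 6; 5; 4; 3; 1] 84)) (Split 6 (Same 4 [:: 0; 2; 1; 3; 4; 5; 6] 0) (Same 1 [:: 0;
  2; 3; 1; 4; 6; 5] 96)))) (Split 4 (Split 5 (Split 6 (Same 1 [:: 0; 2; 4; 1; 3; 5; 6] 0) (Same 3
  [:: 0; 2; 6; 5; 3; 4; 1] 84)) (Split 6 (Same 4 [:: 0; 2; 1; 4; 3; 5; 6] 0) (Same 1 [:: 0; 2; 4; 1;
  3; 6; 5] 96))) (Split 5 (Split 6 (Same 18 [:: 3; 4; 5; 1; 6; 0; 2] 116) (Same 0 [:: 3; 4; 5; 6; 0;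
  2; 1] 52)) (Split 6 (Same 16 [:: 0; 2; 1; 3; 4; 5; 6] 0) (Same 18 [:: 3; 4; 6; 1; 5; 0; 2] 96)))))
  (Split 3 (Split 4 (Split 5 (Split 6 (Same 18 [:: 3; 4; 6; 0; 5; 1; 2] 96) (Same 16 [:: 1; 2; 0; 3;
  4; 5; 6] 0)) (Split 6 (Same 0 [:: 3; 4; 5; 6; 1; 2; 0] 52) (Same 18 [:: 3; 4; 5; 0; 6; 1; 2]
  116))) (Split 5 (Split 6 (Same 1 [:: 1; 2; 4; 0; 3; 6; 5] 96) (Same 4 [:: 1; 2; 0; 4; 3; 5; 6] 0))
  (Split 6 (Same 3 [:: 1; 2; 6; 5; 3; 4; 0] 84) (Same 1 [:: 1; 2; 4; 0; 3; 5; 6] 0)))) (Split 4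
  (Split 5 (Split 6 (Same 1 [:: 1; 2; 3; 0; 4; 6; 5] 96) (Same 4 [:: 1; 2; 0; 3; 4; 5; 6] 0)) (Split
  6 (Same 3 [:: 1; 2; 6; 5; 4; 3; 0] 84) (Same 1 [:: 1; 2; 3; 0; 4; 5; 6] 0))) (Split 5 (Split 6
  (Same 11 [:: 1; 2; 3; 4; 6; 5; 0] 48) (Same 10 [:: 3; 4; 1; 2; 5; 6; 0] 80)) (Split 6 (Same 13 [::
  1; 2; 3; 4; 6; 5; 0] 80) (Same 11 [:: 1; 2; 3; 4; 5; 6; 0] 0))))))); ([:: 0; 80; 96], Split 1
  (Split 2 (Split 3 (Split 4 (Split 5 (Split 6 (Dup 0) (Cut 0 [:: 2; 0; 4; 6])) (Split 6 (Cut 0 [::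
  2; 0; 5; 6]) (Dup 2))) (Split 5 (Split 6 (Cut 0 [:: 2; 0; 4; 7]) (Dup 1)) (Split 6 (Same 15 [:: 0;
  1; 2; 3; 5; 4; 6] 48) (Cut 0 [:: 2; 1; 5; 7])))) (Split 4 (Split 5 (Split 6 (Same 12 [:: 0; 1; 2;
  4; 5; 6; 3] 0) (Same 17 [:: 0; 1; 2; 6; 4; 5; 3] 72)) (Split 6 (Same 14 [:: 0; 1; 2; 3; 4; 5; 6]
  0) (Same 12 [:: 0; 1; 2; 6; 4; 5; 3] 40))) (Split 5 (Split 6 (Same 14 [:: 0; 1; 2; 3; 5; 4; 6] 0)
  (Same 12 [:: 0; 1; 2; 6; 5; 4; 3] 40)) (Split 6 (Same 6 [:: 0; 1; 2; 3; 4; 5; 6] 0) (Same 14 [::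
  0; 1; 2; 3; 6; 5; 4] 80))))) (Split 3 (Split 4 (Split 5 (Split 6 (Same 12 [:: 0; 1; 3; 4; 5; 6; 2]
  0) (Same 17 [:: 0; 1; 3; 6; 4; 5; 2] 72)) (Split 6 (Same 14 [:: 0; 1; 3; 2; 4; 5; 6] 0) (Same 12
  [:: 0; 1; 3; 6; 4; 5; 2] 40))) (Split 5 (Split 6 (Same 14 [:: 0; 1; 3; 2; 5; 4; 6] 0) (Same 12 [::
  0; 1; 3; 6; 5; 4; 2] 40)) (Split 6 (Same 6 [:: 0; 1; 3; 2; 4; 5; 6] 0) (Same 14 [:: 0; 1; 3; 2; 6;
  5; 4] 80)))) (Split 4 (Split 5 (Split 6 (Same 10 [:: 0; 1; 2; 3; 4; 5; 6] 0) (Same 13 [:: 0; 1; 2;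
  3; 4; 5; 6] 0)) (Split 6 (Same 10 [:: 2; 3; 0; 1; 6; 5; 4] 80) (Same 10 [:: 0; 1; 2; 3; 6; 4; 5]
  80))) (Split 5 (Split 6 (Same 10 [:: 2; 3; 0; 1; 6; 4; 5] 80) (Same 10 [:: 0; 1; 2; 3; 6; 5; 4]
  80)) (Split 6 (Same 13 [:: 2; 3; 0; 1; 4; 5; 6] 0) (Same 10 [:: 2; 3; 0; 1; 4; 5; 6] 0))))))
  (Split 2 (Split 3 (Split 4 (Split 5 (Split 6 (Same 12 [:: 0; 2; 3; 4; 5; 6; 1] 0) (Same 17 [:: 0;
  2; 3; 6; 4; 5; 1] 72)) (Split 6 (Same 14 [:: 0; 2; 3; 1; 4; 5; 6] 0) (Same 12 [:: 0; 2; 3; 6; 4;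
  5; 1] 40))) (Split 5 (Split 6 (Same 14 [:: 0; 2; 3; 1; 5; 4; 6] 0) (Same 12 [:: 0; 2; 3; 6; 5; 4;
  1] 40)) (Split 6 (Same 6 [:: 0; 2; 3; 1; 4; 5; 6] 0) (Same 14 [:: 0; 2; 3; 1; 6; 5; 4] 80))))
  (Split 4 (Split 5 (Split 6 (Same 10 [:: 0; 2; 1; 3; 4; 5; 6] 0) (Same 13 [:: 0; 2; 1; 3; 4; 5; 6]
  0)) (Split 6 (Same 10 [:: 1; 3; 0; 2; 6; 5; 4] 80) (Same 10 [:: 0; 2; 1; 3; 6; 4; 5] 80))) (Split
  5 (Split 6 (Same 10 [:: 1; 3; 0; 2; 6; 4; 5] 80) (Same 10 [:: 0; 2; 1; 3; 6; 5; 4] 80)) (Split 6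
  (Same 13 [:: 1; 3; 0; 2; 4; 5; 6] 0) (Same 10 [:: 1; 3; 0; 2; 4; 5; 6] 0))))) (Split 3 (Split 4
  (Split 5 (Split 6 (Same 10 [:: 0; 3; 1; 2; 4; 5; 6] 0) (Same 13 [:: 0; 3; 1; 2; 4; 5; 6] 0))
  (Split 6 (Same 10 [:: 1; 2; 0; 3; 6; 5; 4] 80) (Same 10 [:: 0; 3; 1; 2; 6; 4; 5] 80))) (Split 5
  (Split 6 (Same 10 [:: 1; 2; 0; 3; 6; 4; 5] 80) (Same 10 [:: 0; 3; 1; 2; 6; 5; 4] 80)) (Split 6
  (Same 13 [:: 1; 2; 0; 3; 4; 5; 6] 0) (Same 10 [:: 1; 2; 0; 3; 4; 5; 6] 0)))) (Split 4 (Split 5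
  (Split 6 (Same 14 [:: 1; 2; 3; 0; 6; 5; 4] 80) (Same 6 [:: 1; 2; 3; 0; 4; 5; 6] 0)) (Split 6 (Same
  12 [:: 1; 2; 3; 6; 5; 4; 0] 40) (Same 14 [:: 1; 2; 3; 0; 5; 4; 6] 0))) (Split 5 (Split 6 (Same 12
  [:: 1; 2; 3; 6; 4; 5; 0] 40) (Same 14 [:: 1; 2; 3; 0; 4; 5; 6] 0)) (Split 6 (Same 17 [:: 1; 2; 3;
  6; 4; 5; 0] 72) (Same 12 [:: 1; 2; 3; 4; 5; 6; 0] 0))))))); ([:: 0; 76; 112], Split 1 (Split 2
  (Split 3 (Split 4 (Split 5 (Split 6 (Dup 0) (Cut 0 [:: 2; 0; 4; 6])) (Split 6 (Same 11 [:: 2; 3;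
  0; 1; 6; 4; 5] 64) (Same 11 [:: 0; 1; 2; 3; 6; 5; 4] 48))) (Split 5 (Split 6 (Same 11 [:: 2; 3; 0;
  1; 6; 5; 4] 64) (Same 11 [:: 0; 1; 2; 3; 6; 4; 5] 48)) (Split 6 (Cut 0 [:: 2; 0; 5; 6]) (Dup 2))))
  (Split 4 (Split 5 (Split 6 (Same 11 [:: 4; 5; 0; 1; 6; 2; 3] 64) (Same 11 [:: 0; 1; 4; 5; 6; 3; 2]
  48)) (Split 6 (Same 4 [:: 0; 1; 2; 4; 6; 5; 3] 96) (Same 1 [:: 0; 1; 6; 2; 5; 4; 3] 84))) (Split 5
  (Split 6 (Same 4 [:: 0; 1; 2; 5; 6; 4; 3] 96) (Same 1 [:: 0; 1; 6; 2; 4; 5; 3] 84)) (Split 6 (Same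
  16 [:: 4; 5; 2; 0; 1; 6; 3] 60) (Same 9 [:: 0; 1; 6; 2; 4; 5; 3] 116))))) (Split 3 (Split 4 (Split
  5 (Split 6 (Same 11 [:: 4; 5; 0; 1; 6; 3; 2] 64) (Same 11 [:: 0; 1; 4; 5; 6; 2; 3] 48)) (Split 6
  (Same 4 [:: 0; 1; 3; 4; 6; 5; 2] 96) (Same 1 [:: 0; 1; 6; 3; 5; 4; 2] 84))) (Split 5 (Split 6
  (Same 4 [:: 0; 1; 3; 5; 6; 4; 2] 96) (Same 1 [:: 0; 1; 6; 3; 4; 5; 2] 84)) (Split 6 (Same 16 [::
  4; 5; 3; 0; 1; 6; 2] 60) (Same 9 [:: 0; 1; 6; 3; 4; 5; 2] 116)))) (Split 4 (Split 5 (Split 6 (Cut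
  0 [:: 2; 0; 4; 7]) (Dup 1)) (Split 6 (Same 16 [:: 2; 3; 4; 0; 1; 6; 5] 60) (Same 9 [:: 0; 1; 6; 4;
  2; 3; 5] 116))) (Split 5 (Split 6 (Same 16 [:: 2; 3; 5; 0; 1; 6; 4] 60) (Same 9 [:: 0; 1; 6; 5; 2;
  3; 4] 116)) (Split 6 (Same 7 [:: 0; 1; 4; 5; 2; 3; 6] 60) (Cut 0 [:: 2; 1; 5; 7])))))) (Split 2
  (Split 3 (Split 4 (Split 5 (Split 6 (Same 9 [:: 4; 5; 6; 0; 2; 3; 1] 64) (Same 16 [:: 2; 3; 0; 4;
  5; 6; 1] 96)) (Split 6 (Same 1 [:: 2; 3; 6; 5; 1; 0; 4] 24) (Same 4 [:: 2; 3; 5; 0; 6; 1; 4] 52)))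
  (Split 5 (Split 6 (Same 1 [:: 2; 3; 6; 4; 1; 0; 5] 24) (Same 4 [:: 2; 3; 4; 0; 6; 1; 5] 52))
  (Split 6 (Same 11 [:: 2; 3; 4; 5; 6; 1; 0] 44) (Same 11 [:: 4; 5; 2; 3; 6; 0; 1] 44)))) (Split 4
  (Split 5 (Split 6 (Same 1 [:: 4; 5; 6; 3; 1; 0; 2] 24) (Same 4 [:: 4; 5; 3; 0; 6; 1; 2] 52))
  (Split 6 (Same 8 [:: 6; 1; 4; 3; 2; 5; 0] 42) (Same 8 [:: 6; 0; 5; 2; 3; 4; 1] 42))) (Split 5
  (Split 6 (Same 8 [:: 6; 1; 5; 3; 2; 4; 0] 42) (Same 8 [:: 6; 0; 4; 2; 3; 5; 1] 42)) (Split 6 (Same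
  4 [:: 4; 5; 2; 1; 6; 0; 3] 52) (Same 1 [:: 4; 5; 6; 2; 0; 1; 3] 24))))) (Split 3 (Split 4 (Split 5
  (Split 6 (Same 1 [:: 4; 5; 6; 2; 1; 0; 3] 24) (Same 4 [:: 4; 5; 2; 0; 6; 1; 3] 52)) (Split 6 (Same
  8 [:: 6; 1; 4; 2; 3; 5; 0] 42) (Same 8 [:: 6; 0; 5; 3; 2; 4; 1] 42))) (Split 5 (Split 6 (Same 8
  [:: 6; 1; 5; 2; 3; 4; 0] 42) (Same 8 [:: 6; 0; 4; 3; 2; 5; 1] 42)) (Split 6 (Same 4 [:: 4; 5; 3;
  1; 6; 0; 2] 52) (Same 1 [:: 4; 5; 6; 3; 0; 1; 2] 24)))) (Split 4 (Split 5 (Split 6 (Same 11 [:: 4;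
  5; 2; 3; 6; 1; 0] 44) (Same 11 [:: 2; 3; 4; 5; 6; 0; 1] 44)) (Split 6 (Same 4 [:: 2; 3; 4; 1; 6;
  0; 5] 52) (Same 1 [:: 2; 3; 6; 4; 0; 1; 5] 24))) (Split 5 (Split 6 (Same 4 [:: 2; 3; 5; 1; 6; 0;
  4] 52) (Same 1 [:: 2; 3; 6; 5; 0; 1; 4] 24)) (Split 6 (Same 16 [:: 2; 3; 1; 4; 5; 6; 0] 96) (Same
  9 [:: 4; 5; 6; 1; 2; 3; 0] 64))))))); ([:: 0; 24; 96], Split 3 (Split 4 (Split 5 (Split 6 (Cut 0
  [:: 0; 2; 4; 6]) (Split 1 (Split 2 (Cut 1 [:: 0; 4; 2; 7]) (Same 10 [:: 0; 1; 3; 4; 2; 5; 6] 0))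
  (Split 2 (Same 10 [:: 0; 2; 3; 4; 1; 5; 6] 0) (Same 18 [:: 1; 2; 0; 6; 5; 3; 4] 0)))) (Split 6
  (Split 1 (Split 2 (Cut 1 [:: 0; 4; 2; 7]) (Same 10 [:: 0; 1; 3; 4; 2; 6; 5] 0)) (Split 2 (Same 10
  [:: 0; 2; 3; 4; 1; 6; 5] 0) (Same 18 [:: 1; 2; 0; 5; 6; 3; 4] 0))) (Cut 1 [:: 0; 2; 6; 4])))
  (Split 1 (Split 2 (Split 5 (Split 6 (Cut 1 [:: 0; 6; 2; 5]) (Same 14 [:: 0; 1; 2; 3; 5; 6; 4] 96))
  (Split 6 (Same 14 [:: 0; 1; 2; 3; 6; 5; 4] 96) (Cut 0 [:: 0; 6; 2; 5]))) (Split 5 (Split 6 (Same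
  10 [:: 0; 1; 5; 6; 2; 3; 4] 0) (Same 1 [:: 0; 1; 2; 3; 4; 5; 6] 0)) (Split 6 (Same 1 [:: 0; 1; 2;
  3; 4; 6; 5] 0) (Same 18 [:: 0; 1; 2; 3; 4; 5; 6] 0)))) (Split 2 (Split 5 (Split 6 (Same 10 [:: 0;
  2; 5; 6; 1; 3; 4] 0) (Same 1 [:: 0; 2; 1; 3; 4; 5; 6] 0)) (Split 6 (Same 1 [:: 0; 2; 1; 3; 4; 6;
  5] 0) (Same 18 [:: 0; 2; 1; 3; 4; 5; 6] 0))) (Split 5 (Split 6 (Same 18 [:: 1; 2; 0; 4; 3; 5; 6]
  0) (Same 1 [:: 1; 2; 0; 4; 3; 6; 5] 0)) (Split 6 (Same 1 [:: 1; 2; 0; 4; 3; 5; 6] 0) (Same 10 [::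
  1; 2; 5; 6; 0; 4; 3] 0)))))) (Split 4 (Split 1 (Split 2 (Split 5 (Split 6 (Cut 1 [:: 0; 6; 2; 5])
  (Same 14 [:: 0; 1; 2; 4; 5; 6; 3] 96)) (Split 6 (Same 14 [:: 0; 1; 2; 4; 6; 5; 3] 96) (Cut 0 [::
  0; 6; 2; 5]))) (Split 5 (Split 6 (Same 10 [:: 0; 1; 5; 6; 2; 4; 3] 0) (Same 1 [:: 0; 1; 2; 4; 3;
  5; 6] 0)) (Split 6 (Same 1 [:: 0; 1; 2; 4; 3; 6; 5] 0) (Same 18 [:: 0; 1; 2; 4; 3; 5; 6] 0))))
  (Split 2 (Split 5 (Split 6 (Same 10 [:: 0; 2; 5; 6; 1; 4; 3] 0) (Same 1 [:: 0; 2; 1; 4; 3; 5; 6]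
  0)) (Split 6 (Same 1 [:: 0; 2; 1; 4; 3; 6; 5] 0) (Same 18 [:: 0; 2; 1; 4; 3; 5; 6] 0))) (Split 5
  (Split 6 (Same 18 [:: 1; 2; 0; 3; 4; 5; 6] 0) (Same 1 [:: 1; 2; 0; 3; 4; 6; 5] 0)) (Split 6 (Same
  1 [:: 1; 2; 0; 3; 4; 5; 6] 0) (Same 10 [:: 1; 2; 5; 6; 0; 3; 4] 0))))) (Split 5 (Split 6 (Cut 1
  [:: 0; 2; 4; 6]) (Split 1 (Split 2 (Cut 0 [:: 0; 4; 2; 7]) (Same 18 [:: 0; 1; 2; 5; 6; 3; 4] 0))
  (Split 2 (Same 18 [:: 0; 2; 1; 5; 6; 3; 4] 0) (Same 10 [:: 1; 2; 3; 4; 0; 6; 5] 0)))) (Split 6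
  (Split 1 (Split 2 (Cut 0 [:: 0; 4; 2; 7]) (Same 18 [:: 0; 1; 2; 6; 5; 3; 4] 0)) (Split 2 (Same 18
  [:: 0; 2; 1; 6; 5; 3; 4] 0) (Same 10 [:: 1; 2; 3; 4; 0; 5; 6] 0))) (Cut 0 [:: 0; 3; 5; 7])))))];
  [:: ([:: 0; 52; 56; 64], Split 6 (Cut 2 [:: 0; 2; 4; 6; 8]) (Cut 2 [:: 0; 3; 5; 7; 9])); ([:: 0;
  84; 24; 96], Split 2 (Split 3 (Split 5 (Split 1 (Cut 3 [:: 2; 0; 4; 6; 8]) (Split 4 (Split 6 (Cut
  3 [:: 0; 2; 4; 6; 8]) (Same 11 [:: 0; 2; 3; 4; 1; 5; 6] 0)) (Split 6 (Same 11 [:: 0; 2; 5; 6; 1;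
  3; 4] 0) (Same 7 [:: 0; 1; 2; 3; 4; 5; 6] 0)))) (Split 4 (Cut 3 [:: 2; 0; 7; 5; 8]) (Split 1
  (Split 6 (Same 4 [:: 0; 1; 2; 3; 6; 5; 4] 96) (Cut 0 [:: 0; 8; 2; 7])) (Split 6 (Same 3 [:: 0; 1;
  2; 3; 4; 5; 6] 0) (Same 13 [:: 0; 1; 2; 3; 4; 5; 6] 0))))) (Split 6 (Cut 3 [:: 0; 6; 4; 2; 9])
  (Split 4 (Split 5 (Split 1 (Same 4 [:: 0; 1; 2; 5; 4; 3; 6] 96) (Same 3 [:: 0; 1; 2; 5; 6; 3; 4]
  0)) (Cut 3 [:: 0; 8; 4; 2; 7])) (Split 1 (Cut 0 [:: 0; 6; 2; 9]) (Split 5 (Same 13 [:: 0; 1; 2; 5;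
  6; 3; 4] 0) (Cut 0 [:: 0; 3; 7; 9])))))) (Split 4 (Split 3 (Split 6 (Split 5 (Cut 0 [:: 0; 2; 6;
  8]) (Split 1 (Same 15 [:: 0; 1; 3; 4; 2; 6; 5] 0) (Same 13 [:: 1; 0; 2; 5; 6; 3; 4] 0))) (Cut 3
  [:: 0; 7; 5; 3; 8])) (Split 1 (Split 5 (Split 6 (Same 15 [:: 0; 1; 5; 6; 2; 4; 3] 0) (Same 19 [::
  0; 1; 5; 2; 6; 3; 4] 0)) (Split 6 (Same 14 [:: 0; 1; 2; 3; 4; 5; 6] 0) (Same 17 [:: 0; 1; 2; 3; 4;
  5; 6] 0))) (Split 5 (Split 6 (Same 13 [:: 1; 0; 2; 3; 4; 5; 6] 0) (Same 3 [:: 1; 0; 2; 3; 4; 5; 6]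
  0)) (Split 6 (Same 7 [:: 1; 0; 2; 3; 4; 5; 6] 0) (Same 11 [:: 1; 2; 5; 6; 0; 3; 4] 0))))) (Split 5
  (Cut 3 [:: 0; 9; 5; 3; 6]) (Split 6 (Split 1 (Split 3 (Same 19 [:: 0; 1; 3; 2; 4; 5; 6] 0) (Same
  17 [:: 0; 1; 2; 5; 6; 3; 4] 0)) (Split 3 (Same 3 [:: 1; 0; 2; 5; 6; 3; 4] 0) (Same 11 [:: 1; 2; 3;
  4; 0; 5; 6] 0))) (Cut 3 [:: 0; 3; 5; 7; 9]))))); ([:: 0; 56; 88; 96], Split 3 (Split 4 (Split 5
  (Split 6 (Cut 2 [:: 4; 1; 6; 8; 3]) (Cut 2 [:: 2; 0; 6; 8; 5])) (Split 6 (Cut 2 [:: 2; 0; 4; 8;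
  7]) (Cut 2 [:: 2; 1; 4; 6; 9]))) (Split 1 (Split 2 (Split 5 (Split 6 (Cut 2 [:: 4; 0; 6; 9; 2])
  (Cut 2 [:: 2; 0; 5; 8; 6])) (Split 6 (Cut 2 [:: 2; 0; 7; 8; 4]) (Cut 2 [:: 2; 1; 5; 7; 9])))
  (Split 5 (Split 6 (Same 19 [:: 0; 1; 2; 3; 4; 5; 6] 0) (Same 19 [:: 0; 1; 2; 4; 3; 6; 5] 56))
  (Split 6 (Same 19 [:: 0; 1; 2; 4; 3; 5; 6] 56) (Same 19 [:: 0; 1; 2; 3; 4; 6; 5] 96)))) (Split 2
  (Split 5 (Split 6 (Same 19 [:: 0; 2; 1; 3; 4; 5; 6] 0) (Same 19 [:: 0; 2; 1; 4; 3; 6; 5] 56))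
  (Split 6 (Same 19 [:: 0; 2; 1; 4; 3; 5; 6] 56) (Same 19 [:: 0; 2; 1; 3; 4; 6; 5] 96))) (Split 5
  (Split 6 (Same 19 [:: 1; 2; 0; 4; 3; 6; 5] 96) (Same 19 [:: 1; 2; 0; 3; 4; 5; 6] 56)) (Split 6
  (Same 19 [:: 1; 2; 0; 3; 4; 6; 5] 56) (Same 19 [:: 1; 2; 0; 4; 3; 5; 6] 0)))))) (Split 4 (Split 1
  (Split 2 (Split 5 (Split 6 (Cut 2 [:: 4; 0; 6; 9; 2]) (Cut 2 [:: 2; 0; 5; 8; 6])) (Split 6 (Cut 2
  [:: 2; 0; 7; 8; 4]) (Cut 2 [:: 2; 1; 5; 7; 9]))) (Split 5 (Split 6 (Same 19 [:: 0; 1; 2; 4; 3; 5;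
  6] 0) (Same 19 [:: 0; 1; 2; 3; 4; 6; 5] 56)) (Split 6 (Same 19 [:: 0; 1; 2; 3; 4; 5; 6] 56) (Same
  19 [:: 0; 1; 2; 4; 3; 6; 5] 96)))) (Split 2 (Split 5 (Split 6 (Same 19 [:: 0; 2; 1; 4; 3; 5; 6] 0)
  (Same 19 [:: 0; 2; 1; 3; 4; 6; 5] 56)) (Split 6 (Same 19 [:: 0; 2; 1; 3; 4; 5; 6] 56) (Same 19 [::
  0; 2; 1; 4; 3; 6; 5] 96))) (Split 5 (Split 6 (Same 19 [:: 1; 2; 0; 3; 4; 6; 5] 96) (Same 19 [:: 1;
  2; 0; 4; 3; 5; 6] 56)) (Split 6 (Same 19 [:: 1; 2; 0; 4; 3; 6; 5] 56) (Same 19 [:: 1; 2; 0; 3; 4;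
  5; 6] 0))))) (Split 5 (Split 6 (Cut 2 [:: 2; 0; 4; 6; 9]) (Cut 2 [:: 2; 1; 4; 8; 7])) (Split 6
  (Cut 2 [:: 2; 1; 6; 8; 5]) (Cut 2 [:: 4; 0; 6; 8; 3]))))); ([:: 0; 84; 88; 96], Split 2 (Split 3
  (Split 5 (Split 1 (Split 6 (Cut 2 [:: 4; 0; 6; 9; 2]) (Cut 3 [:: 2; 0; 4; 6; 8])) (Split 4 (Split
  6 (Cut 2 [:: 4; 1; 6; 8; 3]) (Same 8 [:: 0; 2; 3; 4; 6; 5; 1] 80)) (Split 6 (Same 7 [:: 0; 2; 3;
  1; 4; 5; 6] 0) (Same 8 [:: 0; 6; 5; 4; 2; 3; 1] 74)))) (Split 4 (Split 6 (Cut 3 [:: 2; 0; 5; 7;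
  8]) (Cut 2 [:: 2; 1; 4; 6; 9])) (Split 1 (Split 6 (Same 9 [:: 0; 1; 2; 3; 5; 6; 4] 80) (Cut 2 [::
  2; 1; 5; 7; 9])) (Split 6 (Same 2 [:: 0; 1; 2; 3; 4; 5; 6] 0) (Same 7 [:: 0; 2; 3; 1; 4; 6; 5]
  96))))) (Split 5 (Split 6 (Cut 3 [:: 2; 0; 9; 5; 6]) (Split 1 (Cut 2 [:: 2; 0; 5; 8; 6]) (Split 4
  (Same 7 [:: 0; 6; 5; 1; 4; 2; 3] 82) (Cut 2 [:: 2; 1; 4; 8; 7])))) (Split 6 (Split 4 (Cut 2 [:: 2;
  0; 6; 8; 5]) (Split 1 (Same 19 [:: 0; 1; 2; 4; 3; 6; 5] 56) (Same 7 [:: 1; 6; 5; 0; 4; 3; 2] 82)))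
  (Cut 3 [:: 2; 1; 9; 4; 7])))) (Split 3 (Split 5 (Split 6 (Cut 3 [:: 2; 0; 9; 4; 7]) (Split 1 (Cut
  2 [:: 2; 0; 7; 8; 4]) (Split 4 (Same 7 [:: 0; 6; 5; 1; 4; 3; 2] 82) (Cut 2 [:: 2; 1; 6; 8; 5]))))
  (Split 6 (Split 4 (Cut 2 [:: 2; 0; 4; 8; 7]) (Split 1 (Same 19 [:: 0; 1; 3; 4; 2; 6; 5] 56) (Same
  7 [:: 1; 6; 5; 0; 4; 2; 3] 82))) (Cut 3 [:: 2; 1; 9; 5; 6]))) (Split 4 (Split 1 (Split 5 (Split 6
  (Same 19 [:: 0; 1; 5; 4; 6; 2; 3] 0) (Same 9 [:: 0; 1; 6; 5; 3; 2; 4] 52)) (Split 6 (Same 5 [:: 0;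
  1; 2; 3; 4; 5; 6] 0) (Same 19 [:: 0; 1; 6; 4; 5; 2; 3] 20))) (Split 5 (Split 6 (Same 7 [:: 1; 2;
  3; 0; 4; 6; 5] 96) (Same 2 [:: 1; 0; 2; 3; 4; 5; 6] 0)) (Split 6 (Same 8 [:: 1; 6; 5; 4; 2; 3; 0]
  74) (Same 7 [:: 1; 2; 3; 0; 4; 5; 6] 0)))) (Split 5 (Split 6 (Cut 2 [:: 2; 0; 4; 6; 9]) (Cut 3 [::
  2; 1; 5; 7; 8])) (Split 6 (Split 1 (Same 5 [:: 0; 1; 6; 5; 4; 3; 2] 84) (Same 8 [:: 1; 2; 3; 4; 6;
  5; 0] 80)) (Cut 2 [:: 4; 0; 6; 8; 3])))))); ([:: 0; 52; 88; 96], Split 1 (Split 4 (Split 5 (Split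
  2 (Split 6 (Cut 2 [:: 4; 1; 7; 8; 3]) (Cut 3 [:: 2; 0; 5; 6; 8])) (Split 3 (Split 6 (Cut 2 [:: 4;
  0; 7; 9; 2]) (Same 1 [:: 0; 1; 3; 4; 6; 5; 2] 80)) (Split 6 (Same 14 [:: 0; 1; 4; 2; 3; 5; 6] 0)
  (Same 5 [:: 0; 1; 2; 4; 3; 5; 6] 0)))) (Split 3 (Split 6 (Cut 3 [:: 2; 0; 4; 7; 8]) (Cut 2 [:: 2;
  1; 5; 6; 9])) (Split 2 (Split 6 (Same 1 [:: 0; 1; 2; 4; 5; 6; 3] 80) (Cut 2 [:: 2; 1; 4; 7; 9]))
  (Split 6 (Same 5 [:: 0; 1; 3; 4; 2; 6; 5] 0) (Same 14 [:: 0; 1; 4; 2; 3; 6; 5] 96))))) (Split 5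
  (Split 6 (Cut 3 [:: 2; 0; 9; 4; 6]) (Split 2 (Cut 2 [:: 2; 0; 4; 8; 6]) (Split 3 (Same 19 [:: 0;
  1; 3; 4; 2; 6; 5] 56) (Cut 2 [:: 2; 1; 5; 8; 7])))) (Split 6 (Split 2 (Split 3 (Cut 2 [:: 2; 0; 6;
  8; 4]) (Same 19 [:: 0; 1; 2; 4; 3; 5; 6] 56)) (Cut 2 [:: 2; 1; 7; 8; 5])) (Cut 3 [:: 2; 1; 9; 5;
  7])))) (Split 2 (Split 3 (Split 4 (Split 5 (Split 6 (Cut 2 [:: 4; 1; 6; 8; 3]) (Same 11 [:: 2; 4;
  0; 3; 6; 5; 1] 80)) (Split 6 (Same 11 [:: 3; 4; 0; 2; 5; 6; 1] 80) (Cut 2 [:: 2; 1; 4; 6; 9])))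
  (Split 5 (Split 6 (Same 3 [:: 0; 2; 3; 1; 4; 5; 6] 0) (Same 2 [:: 2; 0; 6; 5; 4; 3; 1] 84)) (Split
  6 (Same 2 [:: 3; 0; 5; 6; 4; 2; 1] 84) (Same 3 [:: 0; 2; 3; 1; 4; 6; 5] 96)))) (Split 4 (Split 5
  (Split 6 (Same 13 [:: 2; 5; 4; 0; 6; 3; 1] 96) (Cut 2 [:: 2; 0; 6; 8; 5])) (Split 6 (Same 12 [::
  0; 1; 2; 3; 4; 5; 6] 0) (Same 13 [:: 2; 6; 4; 0; 5; 3; 1] 114))) (Split 5 (Split 6 (Same 13 [:: 3;
  5; 4; 1; 6; 2; 0] 114) (Cut 2 [:: 2; 1; 4; 8; 7])) (Split 6 (Same 12 [:: 1; 0; 3; 2; 4; 6; 5] 0)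
  (Same 13 [:: 3; 6; 4; 1; 5; 2; 0] 96))))) (Split 3 (Split 4 (Split 5 (Split 6 (Same 13 [:: 3; 6;
  4; 0; 5; 2; 1] 96) (Same 12 [:: 0; 1; 3; 2; 4; 6; 5] 0)) (Split 6 (Cut 2 [:: 2; 0; 4; 8; 7]) (Same
  13 [:: 3; 5; 4; 0; 6; 2; 1] 114))) (Split 5 (Split 6 (Same 13 [:: 2; 6; 4; 1; 5; 3; 0] 114) (Same
  12 [:: 1; 0; 2; 3; 4; 5; 6] 0)) (Split 6 (Cut 2 [:: 2; 1; 6; 8; 5]) (Same 13 [:: 2; 5; 4; 1; 6; 3;
  0] 96)))) (Split 4 (Split 5 (Split 6 (Same 3 [:: 1; 2; 3; 0; 4; 6; 5] 96) (Same 2 [:: 3; 1; 5; 6;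
  4; 2; 0] 84)) (Split 6 (Same 2 [:: 2; 1; 6; 5; 4; 3; 0] 84) (Same 3 [:: 1; 2; 3; 0; 4; 5; 6] 0)))
  (Split 5 (Split 6 (Cut 2 [:: 2; 0; 4; 6; 9]) (Same 11 [:: 3; 4; 1; 2; 5; 6; 0] 80)) (Split 6 (Same
  11 [:: 2; 4; 1; 3; 6; 5; 0] 80) (Cut 2 [:: 4; 0; 6; 8; 3]))))))); ([:: 0; 104; 48; 64], Split 6
  (Cut 2 [:: 0; 2; 5; 6; 8]) (Cut 2 [:: 0; 3; 4; 7; 9])); ([:: 0; 56; 80; 96], Split 3 (Split 4
  (Split 5 (Split 6 (Cut 2 [:: 4; 1; 6; 8; 3]) (Cut 2 [:: 2; 0; 6; 8; 5])) (Split 6 (Split 1 (Split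
  2 (Cut 2 [:: 2; 0; 4; 7; 8]) (Same 4 [:: 0; 1; 3; 2; 4; 5; 6] 0)) (Split 2 (Same 4 [:: 0; 2; 3; 1;
  4; 5; 6] 0) (Same 15 [:: 1; 2; 0; 3; 6; 5; 4] 80))) (Cut 2 [:: 2; 1; 4; 6; 9]))) (Split 5 (Split 6
  (Split 1 (Split 2 (Cut 0 [:: 2; 0; 4; 6]) (Same 4 [:: 0; 1; 3; 2; 5; 4; 6] 0)) (Split 2 (Same 4
  [:: 0; 2; 3; 1; 5; 4; 6] 0) (Same 15 [:: 1; 2; 0; 3; 6; 4; 5] 80))) (Cut 2 [:: 2; 1; 4; 8; 7]))
  (Split 1 (Split 2 (Split 6 (Cut 2 [:: 2; 0; 6; 8; 4]) (Cut 0 [:: 2; 1; 7; 9])) (Split 6 (Same 9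
  [:: 0; 1; 2; 3; 4; 5; 6] 0) (Same 4 [:: 0; 1; 3; 2; 6; 5; 4] 80))) (Split 2 (Split 6 (Same 9 [::
  0; 2; 1; 3; 4; 5; 6] 0) (Same 4 [:: 0; 2; 3; 1; 6; 5; 4] 80)) (Split 6 (Same 1 [:: 1; 2; 0; 3; 4;
  5; 6] 0) (Same 15 [:: 1; 2; 0; 3; 4; 5; 6] 0)))))) (Split 4 (Split 5 (Split 1 (Split 2 (Split 6
  (Cut 2 [:: 4; 0; 7; 9; 2]) (Same 18 [:: 0; 1; 2; 6; 4; 5; 3] 72)) (Split 6 (Same 15 [:: 0; 1; 2;
  3; 4; 5; 6] 0) (Same 1 [:: 0; 1; 2; 3; 4; 5; 6] 0))) (Split 2 (Split 6 (Same 15 [:: 0; 2; 1; 3; 4;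
  5; 6] 0) (Same 1 [:: 0; 2; 1; 3; 4; 5; 6] 0)) (Split 6 (Same 4 [:: 1; 2; 3; 0; 6; 5; 4] 80) (Same
  9 [:: 1; 2; 0; 3; 4; 5; 6] 0)))) (Split 6 (Cut 2 [:: 2; 0; 4; 8; 7]) (Split 1 (Split 2 (Cut 2 [::
  2; 1; 5; 6; 9]) (Same 15 [:: 0; 1; 2; 3; 6; 4; 5] 80)) (Split 2 (Same 15 [:: 0; 2; 1; 3; 6; 4; 5]
  80) (Same 4 [:: 1; 2; 3; 0; 5; 4; 6] 0))))) (Split 5 (Split 6 (Cut 2 [:: 2; 0; 4; 6; 9]) (Split 1
  (Split 2 (Cut 2 [:: 2; 1; 5; 8; 7]) (Same 15 [:: 0; 1; 2; 3; 6; 5; 4] 80)) (Split 2 (Same 15 [::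
  0; 2; 1; 3; 6; 5; 4] 80) (Same 4 [:: 1; 2; 3; 0; 4; 5; 6] 0)))) (Split 6 (Cut 2 [:: 2; 1; 6; 8;
  5]) (Cut 2 [:: 4; 0; 6; 8; 3]))))); ([:: 0; 60; 76; 112], Split 1 (Split 2 (Split 3 (Split 6 (Cut
  2 [:: 4; 0; 7; 8; 2]) (Cut 2 [:: 2; 0; 5; 6; 8])) (Split 4 (Split 5 (Split 6 (Cut 2 [:: 4; 0; 6;
  9; 2]) (Cut 2 [:: 2; 0; 5; 8; 6])) (Split 6 (Same 14 [:: 0; 1; 6; 5; 3; 2; 4] 24) (Same 14 [:: 0;
  1; 6; 5; 2; 3; 4] 44))) (Split 5 (Split 6 (Same 14 [:: 0; 1; 6; 4; 3; 2; 5] 24) (Same 14 [:: 0; 1;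
  6; 4; 2; 3; 5] 44)) (Split 6 (Cut 2 [:: 2; 0; 7; 8; 4]) (Cut 2 [:: 2; 1; 5; 7; 9]))))) (Split 3
  (Split 4 (Split 5 (Split 6 (Cut 2 [:: 4; 0; 6; 9; 2]) (Cut 2 [:: 2; 0; 5; 8; 6])) (Split 6 (Same
  14 [:: 0; 1; 6; 5; 2; 3; 4] 24) (Same 14 [:: 0; 1; 6; 5; 3; 2; 4] 44))) (Split 5 (Split 6 (Same 14
  [:: 0; 1; 6; 4; 2; 3; 5] 24) (Same 14 [:: 0; 1; 6; 4; 3; 2; 5] 44)) (Split 6 (Cut 2 [:: 2; 0; 7;
  8; 4]) (Cut 2 [:: 2; 1; 5; 7; 9])))) (Split 6 (Cut 2 [:: 2; 0; 6; 9; 4]) (Cut 2 [:: 2; 1; 5; 9;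
  7])))) (Split 2 (Split 3 (Split 4 (Split 5 (Split 6 (Cut 2 [:: 4; 1; 6; 8; 3]) (Cut 2 [:: 2; 0; 6;
  8; 5])) (Split 6 (Same 14 [:: 2; 3; 6; 5; 1; 0; 4] 24) (Same 14 [:: 2; 3; 6; 5; 0; 1; 4] 44)))
  (Split 5 (Split 6 (Same 14 [:: 2; 3; 6; 4; 1; 0; 5] 24) (Same 14 [:: 2; 3; 6; 4; 0; 1; 5] 44))
  (Split 6 (Cut 2 [:: 2; 0; 4; 8; 7]) (Cut 2 [:: 2; 1; 4; 6; 9])))) (Split 4 (Split 5 (Split 6 (Same
  14 [:: 4; 5; 6; 3; 1; 0; 2] 24) (Same 14 [:: 4; 5; 6; 3; 0; 1; 2] 44)) (Split 6 (Same 16 [:: 0; 1;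
  2; 3; 4; 5; 6] 0) (Same 16 [:: 1; 0; 3; 2; 5; 4; 6] 0))) (Split 5 (Split 6 (Same 16 [:: 0; 1; 2;
  3; 5; 4; 6] 0) (Same 16 [:: 1; 0; 3; 2; 4; 5; 6] 0)) (Split 6 (Same 14 [:: 4; 5; 6; 2; 1; 0; 3]
  44) (Same 14 [:: 4; 5; 6; 2; 0; 1; 3] 24))))) (Split 3 (Split 4 (Split 5 (Split 6 (Same 14 [:: 4;
  5; 6; 2; 1; 0; 3] 24) (Same 14 [:: 4; 5; 6; 2; 0; 1; 3] 44)) (Split 6 (Same 16 [:: 0; 1; 3; 2; 4;
  5; 6] 0) (Same 16 [:: 1; 0; 2; 3; 5; 4; 6] 0))) (Split 5 (Split 6 (Same 16 [:: 0; 1; 3; 2; 5; 4;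
  6] 0) (Same 16 [:: 1; 0; 2; 3; 4; 5; 6] 0)) (Split 6 (Same 14 [:: 4; 5; 6; 3; 1; 0; 2] 44) (Same
  14 [:: 4; 5; 6; 3; 0; 1; 2] 24)))) (Split 4 (Split 5 (Split 6 (Cut 2 [:: 2; 0; 4; 6; 9]) (Cut 2
  [:: 2; 1; 4; 8; 7])) (Split 6 (Same 14 [:: 2; 3; 6; 4; 1; 0; 5] 44) (Same 14 [:: 2; 3; 6; 4; 0; 1;
  5] 24))) (Split 5 (Split 6 (Same 14 [:: 2; 3; 6; 5; 1; 0; 4] 44) (Same 14 [:: 2; 3; 6; 5; 0; 1; 4]
  24)) (Split 6 (Cut 2 [:: 2; 1; 6; 8; 5]) (Cut 2 [:: 4; 0; 6; 8; 3]))))))); ([:: 0; 42; 76; 112],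
  Split 3 (Split 5 (Split 1 (Split 6 (Split 2 (Cut 2 [:: 4; 1; 6; 9; 3]) (Split 4 (Cut 2 [:: 4; 1;
  7; 8; 3]) (Same 3 [:: 1; 3; 5; 0; 6; 4; 2] 96))) (Cut 3 [:: 2; 0; 5; 6; 8])) (Split 2 (Split 4
  (Split 6 (Cut 2 [:: 4; 0; 7; 9; 2]) (Same 12 [:: 0; 2; 4; 3; 5; 1; 6] 96)) (Split 6 (Same 3 [:: 2;
  3; 6; 0; 5; 4; 1] 96) (Same 12 [:: 3; 4; 2; 6; 0; 1; 5] 42))) (Split 4 (Split 6 (Same 3 [:: 4; 5;
  6; 0; 3; 2; 1] 96) (Same 12 [:: 5; 2; 4; 6; 0; 1; 3] 42)) (Split 6 (Same 16 [:: 6; 1; 5; 2; 3; 4;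
  0] 42) (Same 12 [:: 6; 4; 2; 3; 5; 1; 0] 88))))) (Split 2 (Split 6 (Cut 3 [:: 2; 0; 7; 4; 8])
  (Split 1 (Cut 2 [:: 2; 0; 4; 6; 8]) (Split 4 (Same 3 [:: 2; 5; 0; 3; 6; 1; 4] 50) (Cut 2 [:: 2; 1;
  5; 6; 9])))) (Split 1 (Split 4 (Split 6 (Same 12 [:: 0; 1; 4; 3; 6; 2; 5] 96) (Same 3 [:: 1; 6; 0;
  3; 5; 2; 4] 50)) (Split 6 (Same 12 [:: 3; 4; 1; 5; 0; 2; 6] 42) (Cut 2 [:: 2; 1; 4; 7; 9])))
  (Split 4 (Split 6 (Same 12 [:: 6; 1; 4; 5; 0; 2; 3] 42) (Same 16 [:: 0; 4; 6; 2; 5; 1; 3] 60))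
  (Split 6 (Same 12 [:: 5; 4; 1; 3; 6; 2; 0] 88) (Same 3 [:: 4; 5; 6; 3; 0; 1; 2] 24)))))) (Split 4
  (Split 5 (Split 6 (Cut 3 [:: 2; 0; 9; 4; 6]) (Split 1 (Cut 2 [:: 2; 0; 4; 8; 6]) (Split 2 (Same 3
  [:: 4; 3; 0; 5; 6; 1; 2] 50) (Cut 2 [:: 2; 1; 5; 8; 7])))) (Split 1 (Split 2 (Split 6 (Cut 2 [::
  2; 0; 6; 8; 4]) (Cut 0 [:: 4; 0; 6; 8])) (Split 6 (Same 3 [:: 4; 3; 0; 6; 5; 2; 1] 50) (Cut 2 [::
  2; 1; 5; 9; 7]))) (Split 2 (Cut 2 [:: 2; 1; 7; 9; 5]) (Split 6 (Cut 2 [:: 2; 1; 7; 8; 5]) (Cut 0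
  [:: 2; 1; 5; 7]))))) (Split 1 (Split 2 (Split 5 (Split 6 (Same 12 [:: 0; 1; 2; 5; 6; 4; 3] 96)
  (Same 3 [:: 1; 6; 0; 5; 3; 4; 2] 50)) (Split 6 (Same 3 [:: 2; 5; 0; 6; 3; 4; 1] 50) (Cut 2 [:: 2;
  1; 5; 7; 9]))) (Split 5 (Split 6 (Same 12 [:: 5; 2; 1; 3; 0; 4; 6] 42) (Cut 2 [:: 2; 1; 4; 9; 7]))
  (Split 6 (Same 16 [:: 0; 1; 5; 4; 3; 2; 6] 60) (Cut 0 [:: 2; 1; 7; 9])))) (Split 2 (Split 5 (Split
  6 (Same 12 [:: 6; 1; 2; 3; 0; 4; 5] 42) (Same 16 [:: 0; 2; 6; 4; 3; 1; 5] 60)) (Split 6 (Cut 2 [::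
  2; 1; 6; 9; 5]) (Cut 0 [:: 2; 1; 5; 9]))) (Split 5 (Split 6 (Same 12 [:: 3; 2; 1; 5; 6; 4; 0] 88)
  (Same 3 [:: 2; 3; 6; 5; 0; 1; 4] 24)) (Split 6 (Same 3 [:: 1; 3; 5; 6; 0; 2; 4] 24) (Cut 2 [:: 4;
  0; 6; 8; 3]))))))); ([:: 0; 116; 56; 64], Split 6 (Cut 2 [:: 0; 2; 5; 6; 8]) (Cut 2 [:: 0; 3; 4;
  7; 9])); ([:: 0; 12; 80; 96], Split 4 (Split 1 (Cut 3 [:: 0; 4; 9; 2; 7]) (Split 5 (Split 6 (Cut 3
  [:: 0; 2; 6; 4; 8]) (Split 2 (Split 3 (Cut 2 [:: 0; 2; 6; 8; 4]) (Same 11 [:: 0; 1; 2; 3; 4; 5; 6]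
  0)) (Split 3 (Same 11 [:: 0; 1; 3; 2; 4; 5; 6] 0) (Cut 2 [:: 0; 3; 7; 9; 5])))) (Cut 3 [:: 0; 7;
  9; 3; 4]))) (Split 5 (Cut 3 [:: 0; 6; 8; 2; 5]) (Split 6 (Split 2 (Split 3 (Cut 2 [:: 0; 2; 6; 8;
  4]) (Split 1 (Same 15 [:: 0; 1; 2; 3; 4; 5; 6] 0) (Same 11 [:: 1; 0; 3; 2; 4; 5; 6] 0))) (Split 3
  (Split 1 (Same 15 [:: 0; 1; 3; 2; 4; 5; 6] 0) (Same 11 [:: 1; 0; 2; 3; 4; 5; 6] 0)) (Cut 2 [:: 0;
  3; 7; 9; 5]))) (Cut 3 [:: 0; 3; 9; 5; 7])))); ([:: 0; 44; 48; 64], Split 6 (Cut 2 [:: 0; 2; 4; 6;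
  8]) (Cut 2 [:: 0; 3; 5; 7; 9])); ([:: 0; 40; 48; 64], Split 6 (Cut 2 [:: 0; 2; 4; 6; 8]) (Cut 2
  [:: 0; 3; 5; 7; 9])); ([:: 0; 76; 80; 96], Split 4 (Split 5 (Split 1 (Split 6 (Cut 2 [:: 4; 0; 7;
  9; 2]) (Cut 2 [:: 2; 0; 6; 8; 4])) (Split 2 (Split 3 (Split 6 (Cut 2 [:: 4; 1; 6; 8; 3]) (Same 6
  [:: 2; 3; 0; 6; 4; 5; 1] 72)) (Split 6 (Same 11 [:: 0; 2; 1; 3; 4; 5; 6] 0) (Same 8 [:: 0; 1; 2;
  3; 4; 5; 6] 0))) (Split 3 (Split 6 (Same 11 [:: 0; 3; 1; 2; 4; 5; 6] 0) (Same 8 [:: 0; 1; 3; 2; 4;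
  5; 6] 0)) (Split 6 (Cut 3 [:: 2; 0; 7; 4; 9]) (Cut 2 [:: 2; 1; 6; 8; 5]))))) (Split 6 (Split 2
  (Split 3 (Cut 3 [:: 2; 0; 5; 7; 8]) (Split 1 (Same 4 [:: 0; 1; 2; 4; 3; 6; 5] 0) (Same 11 [:: 1;
  3; 0; 2; 6; 5; 4] 80))) (Split 3 (Split 1 (Same 4 [:: 0; 1; 3; 4; 2; 6; 5] 0) (Same 11 [:: 1; 2;
  0; 3; 6; 5; 4] 80)) (Cut 2 [:: 2; 0; 4; 8; 7]))) (Split 1 (Cut 2 [:: 2; 1; 5; 6; 9]) (Split 2
  (Split 3 (Cut 2 [:: 2; 1; 4; 6; 9]) (Same 11 [:: 0; 2; 1; 3; 6; 4; 5] 80)) (Split 3 (Same 11 [::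
  0; 3; 1; 2; 6; 4; 5] 80) (Cut 3 [:: 2; 1; 5; 6; 9])))))) (Split 5 (Split 6 (Split 2 (Split 3 (Cut
  3 [:: 2; 0; 5; 6; 9]) (Split 1 (Same 4 [:: 0; 1; 2; 5; 3; 6; 4] 0) (Same 11 [:: 1; 3; 0; 2; 6; 4;
  5] 80))) (Split 3 (Split 1 (Same 4 [:: 0; 1; 3; 5; 2; 6; 4] 0) (Same 11 [:: 1; 2; 0; 3; 6; 4; 5]
  80)) (Cut 2 [:: 2; 0; 4; 6; 9]))) (Split 1 (Cut 2 [:: 2; 1; 5; 8; 7]) (Split 2 (Split 3 (Cut 2 [::
  2; 1; 4; 8; 7]) (Same 11 [:: 0; 2; 1; 3; 6; 5; 4] 80)) (Split 3 (Same 11 [:: 0; 3; 1; 2; 6; 5; 4]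
  80) (Cut 3 [:: 2; 1; 5; 7; 8]))))) (Split 2 (Split 3 (Split 6 (Cut 2 [:: 2; 0; 6; 8; 5]) (Cut 3
  [:: 2; 1; 7; 4; 9])) (Split 1 (Split 6 (Same 1 [:: 0; 1; 2; 3; 4; 5; 6] 0) (Same 4 [:: 0; 1; 2; 6;
  3; 4; 5] 40)) (Split 6 (Same 8 [:: 1; 0; 3; 2; 4; 5; 6] 0) (Same 11 [:: 1; 3; 0; 2; 4; 5; 6] 0))))
  (Split 3 (Split 1 (Split 6 (Same 1 [:: 0; 1; 3; 2; 4; 5; 6] 0) (Same 4 [:: 0; 1; 3; 6; 2; 4; 5]
  40)) (Split 6 (Same 8 [:: 1; 0; 2; 3; 4; 5; 6] 0) (Same 11 [:: 1; 2; 0; 3; 4; 5; 6] 0))) (Split 6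
  (Split 1 (Same 0 [:: 0; 1; 2; 3; 4; 5; 6] 0) (Same 6 [:: 2; 3; 1; 6; 4; 5; 0] 72)) (Cut 2 [:: 4;
  0; 6; 8; 3])))))); ([:: 0; 40; 80; 96], Split 3 (Split 5 (Cut 3 [:: 0; 5; 3; 6; 9]) (Split 4 (Cut
  3 [:: 0; 7; 9; 3; 4]) (Split 6 (Split 1 (Split 2 (Cut 2 [:: 0; 4; 2; 8; 7]) (Same 4 [:: 0; 1; 2;
  3; 4; 5; 6] 0)) (Split 2 (Same 4 [:: 0; 2; 1; 3; 4; 5; 6] 0) (Same 4 [:: 1; 2; 0; 4; 3; 6; 5] 0)))
  (Cut 3 [:: 0; 3; 9; 5; 7])))) (Split 5 (Split 4 (Split 6 (Cut 3 [:: 0; 4; 8; 2; 7]) (Split 1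
  (Split 2 (Cut 2 [:: 0; 4; 2; 8; 7]) (Same 4 [:: 0; 1; 2; 4; 3; 6; 5] 0)) (Split 2 (Same 4 [:: 0;
  2; 1; 4; 3; 6; 5] 0) (Same 4 [:: 1; 2; 0; 3; 4; 5; 6] 0)))) (Cut 3 [:: 0; 6; 8; 2; 5])) (Cut 3 [::
  0; 4; 2; 7; 8]))); ([:: 0; 48; 80; 96], Split 4 (Split 5 (Split 6 (Cut 2 [:: 4; 1; 6; 8; 3]) (Cut
  2 [:: 2; 0; 6; 8; 5])) (Split 6 (Cut 2 [:: 2; 0; 4; 8; 7]) (Cut 2 [:: 2; 1; 4; 6; 9]))) (Split 5
  (Split 6 (Cut 2 [:: 2; 0; 4; 6; 9]) (Cut 2 [:: 2; 1; 4; 8; 7])) (Split 6 (Cut 2 [:: 2; 1; 6; 8;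
  5]) (Cut 2 [:: 4; 0; 6; 8; 3])))); ([:: 0; 60; 88; 96], Split 2 (Split 1 (Split 5 (Split 6 (Cut 2
  [:: 4; 0; 6; 9; 2]) (Cut 2 [:: 2; 0; 5; 8; 6])) (Split 6 (Split 3 (Split 4 (Cut 2 [:: 2; 0; 4; 7;
  8]) (Same 15 [:: 0; 1; 2; 3; 5; 6; 4] 80)) (Split 4 (Same 15 [:: 0; 1; 2; 4; 5; 6; 3] 80) (Cut 2
  [:: 2; 0; 6; 8; 4]))) (Cut 2 [:: 2; 1; 5; 7; 9]))) (Split 3 (Split 4 (Split 5 (Split 6 (Cut 2 [::
  4; 1; 6; 8; 3]) (Cut 2 [:: 2; 0; 6; 8; 5])) (Split 6 (Same 15 [:: 3; 4; 2; 0; 5; 6; 1] 80) (Cut 2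
  [:: 2; 1; 4; 6; 9]))) (Split 5 (Split 6 (Same 3 [:: 2; 0; 3; 5; 6; 1; 4] 0) (Same 7 [:: 2; 6; 5;
  0; 4; 3; 1] 82)) (Split 6 (Same 12 [:: 2; 0; 3; 1; 4; 6; 5] 0) (Same 3 [:: 2; 0; 3; 6; 5; 1; 4]
  24)))) (Split 4 (Split 5 (Split 6 (Same 3 [:: 2; 0; 4; 5; 6; 1; 3] 0) (Same 7 [:: 2; 6; 5; 0; 3;
  4; 1] 82)) (Split 6 (Same 12 [:: 2; 0; 4; 1; 3; 6; 5] 0) (Same 3 [:: 2; 0; 4; 6; 5; 1; 3] 24)))
  (Split 5 (Split 6 (Same 17 [:: 3; 4; 5; 6; 1; 0; 2] 108) (Cut 2 [:: 2; 1; 4; 8; 7])) (Split 6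
  (Same 5 [:: 3; 4; 6; 5; 0; 1; 2] 84) (Same 17 [:: 3; 4; 6; 5; 1; 0; 2] 96)))))) (Split 5 (Split 3
  (Split 1 (Split 4 (Split 6 (Cut 2 [:: 4; 0; 7; 9; 2]) (Same 0 [:: 0; 1; 3; 4; 6; 5; 2] 80)) (Split
  6 (Same 17 [:: 0; 1; 6; 5; 3; 4; 2] 96) (Same 5 [:: 0; 1; 6; 5; 4; 3; 2] 84))) (Split 4 (Split 6
  (Same 17 [:: 3; 4; 6; 5; 0; 1; 2] 96) (Same 5 [:: 3; 4; 6; 5; 1; 0; 2] 84)) (Split 6 (Same 3 [::
  2; 1; 4; 6; 5; 0; 3] 24) (Same 12 [:: 2; 1; 4; 0; 3; 6; 5] 0)))) (Split 4 (Split 1 (Split 6 (Same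
  17 [:: 0; 1; 6; 5; 4; 3; 2] 96) (Same 5 [:: 0; 1; 6; 5; 3; 4; 2] 84)) (Split 6 (Same 3 [:: 2; 1;
  3; 6; 5; 0; 4] 24) (Same 12 [:: 2; 1; 3; 0; 4; 6; 5] 0))) (Split 6 (Cut 2 [:: 2; 0; 4; 6; 9])
  (Split 1 (Cut 2 [:: 2; 1; 5; 8; 7]) (Same 15 [:: 3; 4; 2; 1; 5; 6; 0] 80))))) (Split 6 (Split 1
  (Cut 2 [:: 2; 0; 7; 8; 4]) (Split 3 (Split 4 (Cut 2 [:: 2; 0; 4; 8; 7]) (Same 7 [:: 2; 6; 5; 1; 3;
  4; 0] 82)) (Split 4 (Same 7 [:: 2; 6; 5; 1; 4; 3; 0] 82) (Cut 2 [:: 2; 1; 6; 8; 5])))) (Split 3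
  (Split 1 (Split 4 (Cut 2 [:: 2; 1; 5; 6; 9]) (Same 17 [:: 0; 1; 5; 6; 3; 4; 2] 108)) (Split 4
  (Same 17 [:: 3; 4; 5; 6; 0; 1; 2] 108) (Same 3 [:: 2; 1; 4; 5; 6; 0; 3] 0))) (Split 4 (Split 1
  (Same 17 [:: 0; 1; 5; 6; 4; 3; 2] 108) (Same 3 [:: 2; 1; 3; 5; 6; 0; 4] 0)) (Cut 2 [:: 4; 0; 6; 8;
  3])))))); ([:: 0; 72; 80; 96], Split 3 (Split 4 (Split 5 (Split 6 (Cut 2 [:: 4; 1; 6; 8; 3])
  (Split 1 (Split 2 (Cut 2 [:: 2; 0; 4; 6; 8]) (Same 10 [:: 0; 1; 6; 3; 4; 5; 2] 68)) (Split 2 (Same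
  10 [:: 0; 2; 6; 3; 4; 5; 1] 68) (Same 6 [:: 1; 2; 0; 3; 4; 5; 6] 0)))) (Split 6 (Cut 3 [:: 2; 0;
  5; 7; 8]) (Cut 2 [:: 2; 1; 4; 6; 9]))) (Split 5 (Split 6 (Cut 3 [:: 2; 0; 5; 6; 9]) (Cut 2 [:: 2;
  1; 4; 8; 7])) (Split 6 (Cut 2 [:: 2; 0; 6; 8; 5]) (Cut 3 [:: 2; 1; 7; 4; 9])))) (Split 4 (Split 5
  (Split 6 (Cut 3 [:: 2; 0; 7; 4; 9]) (Cut 2 [:: 2; 1; 6; 8; 5])) (Split 6 (Cut 2 [:: 2; 0; 4; 8;
  7]) (Cut 3 [:: 2; 1; 5; 6; 9]))) (Split 5 (Split 6 (Cut 2 [:: 2; 0; 4; 6; 9]) (Cut 3 [:: 2; 1; 5;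
  7; 8])) (Split 6 (Split 1 (Split 2 (Same 18 [:: 0; 1; 2; 3; 4; 5; 6] 0) (Same 6 [:: 0; 1; 2; 3; 4;
  5; 6] 0)) (Split 2 (Same 6 [:: 0; 2; 1; 3; 4; 5; 6] 0) (Same 10 [:: 1; 2; 6; 3; 4; 5; 0] 68)))
  (Cut 2 [:: 4; 0; 6; 8; 3]))))); ([:: 0; 116; 24; 96], Split 2 (Split 1 (Cut 3 [:: 0; 8; 7; 2; 4])
  (Split 4 (Cut 3 [:: 0; 8; 4; 2; 7]) (Split 3 (Split 5 (Split 6 (Cut 2 [:: 0; 2; 5; 6; 8]) (Same 13
  [:: 0; 2; 1; 3; 4; 5; 6] 0)) (Split 6 (Same 13 [:: 0; 2; 1; 3; 4; 6; 5] 0) (Cut 2 [:: 0; 3; 4; 7;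
  9]))) (Cut 3 [:: 0; 3; 7; 4; 9])))) (Split 4 (Split 3 (Cut 3 [:: 0; 2; 6; 5; 8]) (Split 5 (Split 6
  (Cut 2 [:: 0; 2; 5; 6; 8]) (Split 1 (Same 17 [:: 0; 1; 2; 4; 3; 5; 6] 0) (Same 13 [:: 1; 2; 0; 3;
  4; 6; 5] 0))) (Split 6 (Split 1 (Same 17 [:: 0; 1; 2; 4; 3; 6; 5] 0) (Same 13 [:: 1; 2; 0; 3; 4;
  5; 6] 0)) (Cut 2 [:: 0; 3; 4; 7; 9])))) (Cut 3 [:: 0; 9; 5; 3; 6])))]; [:: ([:: 0; 60; 76; 80;
  96], Split 4 (Split 5 (Split 6 (Cut 4 [:: 0; 2; 4; 6; 8; 10]) (Cut 5 [:: 0; 3; 5; 7; 9; 11]))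
  (Split 6 (Cut 4 [:: 0; 9; 5; 7; 3; 11]) (Cut 4 [:: 0; 10; 4; 6; 2; 8]))) (Split 5 (Split 6 (Cut 4
  [:: 0; 11; 5; 7; 3; 9]) (Cut 4 [:: 0; 8; 4; 6; 2; 10])) (Split 6 (Cut 5 [:: 0; 2; 4; 6; 8; 10])
  (Cut 4 [:: 0; 3; 5; 7; 9; 11])))); ([:: 0; 76; 56; 80; 96], Split 3 (Split 4 (Split 5 (Cut 5 [::
  0; 5; 2; 6; 9; 11]) (Split 6 (Cut 6 [:: 0; 9; 5; 7; 3; 11]) (Cut 2 [:: 2; 1; 6; 8; 11]))) (Split 5
  (Split 6 (Cut 6 [:: 0; 11; 5; 7; 3; 9]) (Cut 2 [:: 2; 1; 6; 10; 9])) (Split 6 (Split 2 (Cut 2 [::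
  2; 0; 6; 8; 5]) (Split 1 (Same 5 [:: 0; 1; 2; 3; 4; 5; 6] 0) (Same 4 [:: 1; 0; 2; 3; 4; 5; 6] 0)))
  (Cut 6 [:: 0; 3; 5; 7; 9; 11])))) (Split 4 (Split 5 (Split 1 (Cut 5 [:: 0; 6; 2; 5; 9; 11]) (Split
  6 (Cut 6 [:: 0; 2; 4; 6; 8; 10]) (Split 2 (Same 4 [:: 0; 1; 2; 3; 4; 5; 6] 0) (Cut 5 [:: 0; 3; 4;
  6; 9; 11])))) (Split 6 (Cut 2 [:: 2; 0; 6; 10; 9]) (Cut 6 [:: 0; 10; 4; 6; 2; 8]))) (Split 5
  (Split 6 (Cut 5 [:: 0; 4; 11; 7; 2; 8]) (Cut 6 [:: 0; 8; 4; 6; 2; 10])) (Cut 5 [:: 0; 4; 3; 7; 8;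
  10])))); ([:: 0; 50; 84; 88; 96], Split 2 (Split 4 (Split 5 (Split 6 (Split 3 (Cut 2 [:: 4; 0; 7;
  11; 2]) (Cut 3 [:: 2; 0; 11; 7; 8])) (Split 1 (Cut 3 [:: 2; 0; 5; 8; 10]) (Split 3 (Same 4 [:: 0;
  2; 3; 4; 6; 5; 1] 80) (Same 2 [:: 0; 2; 1; 3; 4; 5; 6] 0)))) (Split 3 (Cut 2 [:: 4; 0; 7; 9; 10])
  (Split 6 (Cut 2 [:: 2; 0; 8; 10; 7]) (Cut 3 [:: 2; 1; 11; 6; 9])))) (Split 3 (Split 5 (Cut 6 [::
  0; 4; 2; 11; 7; 9]) (Cut 2 [:: 6; 0; 8; 10; 4])) (Split 5 (Cut 5 [:: 0; 2; 8; 10; 4; 7]) (Cut 6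
  [:: 0; 8; 3; 10; 5; 6])))) (Split 4 (Split 5 (Split 1 (Split 6 (Cut 6 [:: 0; 2; 9; 6; 4; 10]) (Cut
  2 [:: 2; 0; 6; 10; 5])) (Split 3 (Split 6 (Cut 3 [:: 2; 0; 11; 6; 9]) (Same 2 [:: 0; 3; 1; 2; 4;
  5; 6] 0)) (Split 6 (Same 2 [:: 1; 6; 0; 5; 4; 3; 2] 82) (Same 7 [:: 5; 6; 3; 2; 4; 0; 1] 78))))
  (Split 3 (Split 6 (Cut 2 [:: 2; 0; 6; 10; 9]) (Cut 3 [:: 2; 1; 11; 7; 8])) (Split 1 (Split 6 (Same
  1 [:: 0; 1; 2; 3; 4; 5; 6] 0) (Cut 6 [:: 0; 10; 9; 6; 4; 2])) (Split 6 (Same 4 [:: 1; 6; 5; 4; 2;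
  3; 0] 74) (Same 2 [:: 1; 5; 0; 6; 4; 3; 2] 88))))) (Split 5 (Cut 5 [:: 0; 2; 6; 10; 4; 9]) (Split
  3 (Cut 6 [:: 0; 6; 3; 10; 5; 8]) (Split 6 (Split 1 (Same 1 [:: 1; 0; 6; 5; 4; 3; 2] 84) (Cut 6 [::
  4; 0; 7; 8; 3; 11])) (Cut 5 [:: 0; 10; 8; 2; 4; 7])))))); ([:: 0; 50; 84; 24; 96], Split 3 (Split
  4 (Split 5 (Split 6 (Cut 0 [:: 0; 2; 8; 10]) (Cut 6 [:: 8; 2; 6; 4; 0; 10])) (Cut 6 [:: 8; 2; 4;
  6; 0; 10])) (Cut 8 [:: 0; 2; 4; 6; 8; 10])) (Split 4 (Split 5 (Split 1 (Cut 3 [:: 0; 2; 4; 8; 10])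
  (Split 6 (Cut 7 [:: 0; 2; 4; 6; 8; 10]) (Split 2 (Same 3 [:: 0; 2; 1; 3; 4; 6; 5] 0) (Same 2 [::
  2; 6; 3; 5; 4; 1; 0] 88)))) (Split 2 (Cut 3 [:: 0; 10; 6; 2; 9]) (Split 1 (Split 6 (Same 3 [:: 0;
  1; 2; 3; 4; 5; 6] 0) (Cut 4 [:: 10; 0; 6; 9; 3; 5])) (Split 6 (Same 2 [:: 1; 5; 3; 6; 4; 2; 0] 88)
  (Cut 4 [:: 10; 2; 5; 6; 1; 8]))))) (Split 5 (Cut 9 [:: 0; 2; 6; 4; 8; 10]) (Split 6 (Cut 9 [:: 0;
  2; 4; 6; 8; 10]) (Cut 0 [:: 0; 3; 9; 11]))))); ([:: 0; 52; 40; 80; 96], Split 3 (Split 5 (Cut 3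
  [:: 0; 7; 3; 8; 11]) (Split 4 (Cut 3 [:: 0; 9; 11; 3; 6]) (Cut 9 [:: 2; 9; 1; 4; 6; 11]))) (Split
  5 (Split 4 (Cut 9 [:: 2; 9; 0; 4; 6; 11]) (Cut 3 [:: 0; 8; 10; 2; 7])) (Cut 3 [:: 0; 6; 2; 9;
  10]))); ([:: 0; 44; 84; 88; 96], Split 2 (Split 5 (Split 1 (Cut 5 [:: 0; 11; 8; 3; 4; 7]) (Split 3
  (Cut 5 [:: 0; 11; 5; 3; 7; 9]) (Split 6 (Cut 3 [:: 2; 0; 11; 7; 8]) (Split 4 (Same 2 [:: 0; 1; 2;
  4; 3; 5; 6] 0) (Cut 2 [:: 2; 1; 4; 6; 9]))))) (Split 6 (Split 4 (Cut 4 [:: 0; 7; 5; 9; 3; 11])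
  (Split 1 (Split 3 (Same 5 [:: 0; 1; 2; 3; 5; 6; 4] 80) (Cut 6 [:: 0; 8; 10; 3; 5; 6])) (Split 3
  (Same 1 [:: 0; 1; 2; 3; 4; 5; 6] 0) (Same 2 [:: 1; 0; 3; 4; 2; 5; 6] 0)))) (Split 3 (Cut 5 [:: 0;
  3; 5; 11; 7; 9]) (Cut 3 [:: 2; 1; 11; 6; 9])))) (Split 5 (Split 1 (Split 3 (Cut 2 [:: 2; 0; 4; 9;
  6]) (Cut 6 [:: 0; 4; 11; 2; 7; 9])) (Split 6 (Split 3 (Cut 3 [:: 2; 0; 11; 6; 9]) (Cut 5 [:: 0; 2;
  4; 10; 6; 8])) (Split 4 (Split 3 (Same 2 [:: 0; 1; 3; 4; 2; 5; 6] 0) (Same 1 [:: 1; 0; 2; 3; 4; 5;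
  6] 0)) (Cut 4 [:: 0; 6; 4; 8; 2; 10])))) (Split 3 (Split 1 (Cut 6 [:: 0; 6; 10; 3; 5; 8]) (Split 6
  (Split 4 (Cut 2 [:: 2; 0; 4; 6; 9]) (Same 2 [:: 1; 0; 2; 4; 3; 5; 6] 0)) (Cut 3 [:: 2; 1; 11; 7;
  8]))) (Cut 5 [:: 0; 10; 4; 2; 6; 8])))); ([:: 0; 60; 72; 80; 96], Split 3 (Split 4 (Split 5 (Split
  6 (Cut 4 [:: 0; 2; 4; 8; 6; 10]) (Cut 10 [:: 0; 3; 5; 7; 9; 11])) (Cut 4 [:: 0; 10; 3; 5; 6; 8]))
  (Split 5 (Cut 4 [:: 0; 8; 3; 5; 6; 10]) (Cut 4 [:: 0; 7; 2; 4; 9; 11]))) (Split 4 (Split 5 (Cut 4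
  [:: 0; 6; 3; 5; 8; 10]) (Cut 4 [:: 0; 9; 2; 4; 7; 11])) (Split 5 (Cut 4 [:: 0; 11; 2; 4; 7; 9])
  (Split 6 (Cut 10 [:: 0; 2; 4; 6; 8; 10]) (Cut 4 [:: 0; 3; 5; 11; 7; 9]))))); ([:: 0; 82; 84; 24;
  96], Split 1 (Split 2 (Split 3 (Cut 6 [:: 8; 11; 4; 7; 3; 1]) (Split 4 (Cut 6 [:: 8; 11; 5; 6; 3;
  1]) (Cut 0 [:: 0; 8; 2; 11]))) (Cut 8 [:: 0; 2; 5; 6; 8; 10])) (Split 2 (Cut 8 [:: 0; 2; 4; 7; 8;
  10]) (Split 3 (Split 6 (Split 4 (Split 5 (Cut 0 [:: 0; 2; 8; 10]) (Cut 5 [:: 8; 11; 1; 3; 5; 7]))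
  (Split 5 (Cut 3 [:: 0; 11; 7; 3; 8]) (Same 2 [:: 0; 3; 5; 4; 6; 2; 1] 88))) (Cut 3 [:: 0; 9; 5; 3;
  10])) (Split 4 (Split 5 (Split 6 (Cut 5 [:: 10; 9; 1; 3; 5; 7]) (Same 2 [:: 0; 5; 3; 6; 4; 2; 1]
  88)) (Cut 5 [:: 2; 5; 8; 11; 7; 0])) (Cut 5 [:: 2; 11; 8; 0; 5; 7]))))); ([:: 0; 74; 76; 80; 96],
  Split 1 (Split 4 (Split 5 (Cut 5 [:: 0; 5; 2; 7; 9; 11]) (Split 6 (Cut 6 [:: 0; 9; 5; 6; 3; 11])
  (Cut 5 [:: 0; 5; 10; 7; 3; 9]))) (Split 5 (Split 6 (Cut 6 [:: 0; 11; 5; 6; 3; 9]) (Cut 5 [:: 0; 5;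
  8; 7; 3; 11])) (Split 2 (Split 3 (Cut 3 [:: 4; 1; 9; 6; 11]) (Split 6 (Same 4 [:: 0; 1; 2; 3; 4;
  5; 6] 0) (Cut 6 [:: 0; 3; 5; 6; 9; 11]))) (Cut 5 [:: 4; 3; 6; 0; 9; 11])))) (Split 2 (Split 4
  (Split 5 (Cut 5 [:: 4; 3; 6; 1; 9; 11]) (Cut 3 [:: 4; 0; 7; 9; 10])) (Split 5 (Cut 3 [:: 4; 0; 7;
  8; 11]) (Cut 5 [:: 6; 3; 4; 0; 9; 11]))) (Split 4 (Split 3 (Split 5 (Split 6 (Cut 6 [:: 0; 2; 4;
  7; 8; 10]) (Same 0 [:: 0; 6; 4; 5; 2; 1; 3] 50)) (Split 6 (Cut 10 [:: 2; 5; 10; 7; 9; 0]) (Cut 6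
  [:: 10; 0; 4; 7; 3; 9]))) (Cut 4 [:: 0; 9; 2; 11; 5; 7])) (Split 5 (Split 6 (Cut 10 [:: 4; 3; 6;
  9; 0; 11]) (Cut 6 [:: 0; 8; 4; 7; 2; 10])) (Cut 10 [:: 4; 9; 6; 11; 0; 3]))))); ([:: 0; 52; 56;
  80; 96], Split 2 (Split 4 (Split 5 (Cut 5 [:: 0; 6; 2; 4; 9; 11]) (Split 6 (Cut 6 [:: 0; 9; 6; 5;
  3; 11]) (Cut 5 [:: 0; 6; 10; 4; 3; 9]))) (Split 5 (Split 6 (Cut 6 [:: 0; 11; 6; 5; 3; 9]) (Cut 2
  [:: 2; 1; 4; 10; 9])) (Split 3 (Split 1 (Cut 3 [:: 4; 0; 8; 6; 10]) (Split 6 (Same 0 [:: 0; 1; 2;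
  3; 4; 5; 6] 0) (Cut 6 [:: 2; 1; 5; 6; 9; 11]))) (Cut 5 [:: 0; 5; 3; 7; 8; 10])))) (Split 4 (Split
  5 (Split 3 (Cut 5 [:: 6; 2; 4; 0; 8; 10]) (Split 6 (Cut 6 [:: 0; 2; 5; 6; 8; 10]) (Split 1 (Same 5
  [:: 0; 1; 2; 3; 4; 5; 6] 0) (Same 0 [:: 1; 0; 2; 3; 4; 5; 6] 0)))) (Split 6 (Cut 5 [:: 0; 7; 9; 5;
  2; 10]) (Cut 6 [:: 0; 10; 7; 4; 2; 8]))) (Split 5 (Split 6 (Cut 5 [:: 0; 7; 11; 5; 2; 8]) (Cut 6
  [:: 0; 8; 7; 4; 2; 10])) (Cut 5 [:: 0; 7; 3; 5; 8; 10])))); ([:: 0; 68; 72; 80; 96], Split 2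
  (Split 3 (Split 4 (Split 5 (Cut 10 [:: 0; 5; 2; 7; 9; 11]) (Cut 2 [:: 4; 1; 6; 8; 11])) (Cut 4 [::
  0; 8; 3; 10; 4; 6])) (Split 4 (Cut 4 [:: 0; 6; 3; 10; 4; 8]) (Cut 4 [:: 0; 5; 2; 11; 7; 9])))
  (Split 3 (Split 4 (Cut 4 [:: 0; 4; 3; 10; 6; 8]) (Cut 4 [:: 0; 7; 2; 11; 5; 9])) (Split 4 (Cut 4
  [:: 0; 9; 2; 11; 5; 7]) (Split 5 (Cut 4 [:: 0; 11; 2; 5; 7; 9]) (Cut 10 [:: 0; 4; 3; 6; 8;
  10]))))); ([:: 0; 74; 12; 80; 96], Split 4 (Split 1 (Cut 3 [:: 0; 6; 11; 2; 9]) (Split 5 (Cut 6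
  [:: 2; 6; 0; 5; 9; 11]) (Cut 3 [:: 0; 9; 11; 3; 6]))) (Split 5 (Cut 3 [:: 0; 8; 10; 2; 7]) (Split
  6 (Split 1 (Cut 6 [:: 6; 2; 4; 0; 8; 10]) (Split 3 (Cut 5 [:: 2; 0; 8; 7; 5; 11]) (Cut 4 [:: 6; 2;
  0; 4; 8; 10]))) (Cut 3 [:: 0; 3; 11; 7; 9])))); ([:: 0; 42; 52; 88; 96], Split 3 (Split 4 (Split 5
  (Split 6 (Cut 7 [:: 8; 2; 4; 6; 10; 0]) (Split 1 (Cut 6 [:: 4; 1; 9; 7; 3; 11]) (Split 2 (Cut 6
  [:: 6; 1; 9; 5; 3; 11]) (Same 6 [:: 0; 1; 2; 3; 4; 5; 6] 0)))) (Split 6 (Cut 3 [:: 2; 0; 9; 4; 6])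
  (Cut 7 [:: 8; 10; 4; 6; 2; 0]))) (Split 1 (Split 5 (Cut 3 [:: 2; 0; 5; 6; 8]) (Split 6 (Cut 2 [::
  2; 0; 4; 8; 6]) (Cut 3 [:: 2; 1; 11; 7; 9]))) (Split 2 (Split 5 (Split 6 (Same 3 [:: 0; 2; 3; 1;
  4; 5; 6] 0) (Same 1 [:: 0; 2; 1; 3; 4; 5; 6] 0)) (Split 6 (Same 2 [:: 0; 2; 3; 1; 4; 6; 5] 0)
  (Same 3 [:: 0; 2; 3; 1; 4; 6; 5] 96))) (Split 5 (Split 6 (Cut 9 [:: 2; 1; 8; 4; 10; 7]) (Same 1
  [:: 4; 2; 5; 6; 3; 1; 0] 84)) (Split 6 (Cut 5 [:: 0; 3; 9; 7; 11; 5]) (Cut 9 [:: 6; 3; 9; 5; 0;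
  11])))))) (Split 5 (Split 2 (Split 6 (Cut 3 [:: 2; 0; 11; 4; 8]) (Cut 5 [:: 0; 4; 7; 9; 2; 10]))
  (Split 4 (Split 1 (Split 6 (Same 3 [:: 0; 1; 4; 2; 3; 5; 6] 0) (Same 1 [:: 0; 1; 2; 4; 3; 5; 6]
  0)) (Split 6 (Cut 9 [:: 2; 1; 8; 6; 10; 5]) (Same 1 [:: 3; 1; 5; 6; 4; 2; 0] 84))) (Split 6 (Cut 2
  [:: 2; 0; 6; 8; 11]) (Split 1 (Cut 5 [:: 0; 6; 5; 9; 2; 10]) (Cut 4 [:: 8; 0; 4; 7; 3; 11])))))
  (Split 6 (Split 1 (Split 2 (Split 4 (Cut 2 [:: 2; 0; 6; 8; 4]) (Cut 0 [:: 4; 0; 6; 8])) (Split 4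
  (Same 2 [:: 0; 1; 4; 2; 3; 6; 5] 0) (Cut 2 [:: 2; 1; 5; 9; 7]))) (Cut 2 [:: 2; 1; 7; 10; 5]))
  (Split 2 (Cut 3 [:: 2; 1; 11; 5; 9]) (Split 4 (Split 1 (Same 3 [:: 0; 1; 4; 2; 3; 6; 5] 96) (Cut 9
  [:: 4; 3; 9; 7; 0; 11])) (Cut 2 [:: 6; 0; 8; 10; 3])))))); ([:: 0; 114; 84; 24; 96], Split 1
  (Split 2 (Cut 3 [:: 0; 10; 9; 2; 4]) (Split 4 (Cut 3 [:: 0; 10; 4; 2; 9]) (Cut 6 [:: 2; 10; 1; 6;
  9; 4]))) (Split 4 (Split 3 (Cut 3 [:: 0; 2; 8; 5; 10]) (Split 2 (Cut 9 [:: 4; 2; 6; 0; 10; 8])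
  (Split 5 (Split 6 (Cut 5 [:: 2; 0; 8; 11; 5; 7]) (Cut 7 [:: 4; 3; 7; 0; 9; 11])) (Cut 5 [:: 2; 5;
  8; 11; 7; 0])))) (Cut 3 [:: 0; 11; 5; 3; 8]))); ([:: 0; 44; 84; 24; 96], Split 2 (Split 3 (Split 1
  (Cut 6 [:: 8; 11; 5; 7; 3; 1]) (Split 5 (Cut 3 [:: 0; 2; 4; 8; 10]) (Split 4 (Cut 3 [:: 2; 0; 9;
  7; 10]) (Split 6 (Same 3 [:: 0; 1; 2; 3; 4; 5; 6] 0) (Cut 3 [:: 0; 10; 4; 2; 9]))))) (Split 6 (Cut
  3 [:: 0; 8; 6; 2; 11]) (Split 4 (Split 1 (Cut 6 [:: 8; 11; 4; 6; 3; 1]) (Split 5 (Same 3 [:: 0; 1;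
  2; 5; 6; 3; 4] 0) (Cut 3 [:: 0; 10; 6; 2; 9]))) (Split 5 (Cut 3 [:: 0; 8; 4; 2; 11]) (Cut 0 [:: 0;
  3; 9; 11]))))) (Split 1 (Cut 8 [:: 0; 2; 4; 6; 8; 10]) (Split 3 (Split 6 (Split 4 (Split 5 (Cut 0
  [:: 0; 2; 8; 10]) (Cut 3 [:: 0; 9; 5; 3; 10])) (Split 5 (Cut 3 [:: 0; 11; 7; 3; 8]) (Same 3 [:: 1;
  0; 2; 5; 6; 3; 4] 0))) (Cut 3 [:: 0; 9; 7; 3; 10])) (Split 5 (Split 4 (Split 6 (Cut 3 [:: 0; 11;
  5; 3; 8]) (Same 3 [:: 1; 0; 2; 3; 4; 5; 6] 0)) (Cut 3 [:: 0; 11; 7; 3; 8])) (Cut 3 [:: 0; 3; 5; 9;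
  11]))))); ([:: 0; 12; 56; 80; 96], Split 4 (Split 5 (Split 6 (Cut 3 [:: 0; 2; 8; 4; 10]) (Cut 6
  [:: 4; 2; 0; 6; 8; 10])) (Cut 3 [:: 0; 9; 11; 3; 4])) (Split 5 (Cut 3 [:: 0; 8; 10; 2; 5]) (Split
  6 (Cut 6 [:: 4; 2; 1; 6; 8; 10]) (Cut 3 [:: 0; 3; 11; 5; 9])))); ([:: 0; 42; 60; 76; 112], Split 1
  (Split 2 (Split 3 (Split 6 (Cut 2 [:: 6; 0; 9; 10; 2]) (Cut 2 [:: 2; 0; 7; 8; 10])) (Split 4
  (Split 6 (Cut 3 [:: 2; 0; 6; 4; 8]) (Split 5 (Cut 2 [:: 2; 0; 7; 10; 8]) (Cut 0 [:: 4; 0; 8;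
  10]))) (Split 5 (Split 6 (Same 3 [:: 0; 1; 6; 2; 5; 4; 3] 96) (Same 3 [:: 1; 0; 6; 4; 2; 3; 5]
  44)) (Split 6 (Cut 2 [:: 2; 0; 9; 10; 6]) (Cut 2 [:: 2; 1; 7; 9; 11]))))) (Split 3 (Split 4 (Split
  5 (Split 6 (Cut 2 [:: 4; 1; 7; 9; 3]) (Cut 2 [:: 2; 0; 7; 10; 8])) (Split 6 (Same 3 [:: 0; 1; 6;
  5; 2; 3; 4] 24) (Same 3 [:: 1; 0; 6; 2; 4; 5; 3] 44))) (Split 6 (Split 5 (Cut 0 [:: 2; 0; 5; 6])
  (Cut 2 [:: 2; 0; 9; 10; 6])) (Cut 7 [:: 8; 0; 3; 7; 5; 10]))) (Split 6 (Cut 2 [:: 2; 0; 8; 11; 6])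
  (Cut 2 [:: 2; 1; 7; 11; 9])))) (Split 2 (Split 4 (Split 3 (Split 6 (Cut 3 [:: 2; 0; 9; 4; 7])
  (Split 5 (Cut 2 [:: 2; 0; 4; 8; 7]) (Cut 0 [:: 4; 0; 7; 10]))) (Split 5 (Split 6 (Cut 3 [:: 2; 0;
  11; 4; 8]) (Cut 0 [:: 4; 0; 7; 8])) (Cut 2 [:: 2; 1; 6; 9; 5]))) (Split 5 (Split 3 (Split 6 (Same
  3 [:: 2; 3; 6; 0; 5; 4; 1] 96) (Same 3 [:: 3; 2; 6; 4; 0; 1; 5] 44)) (Split 6 (Same 6 [:: 6; 1; 3;
  2; 0; 5; 4] 70) (Same 8 [:: 0; 3; 2; 1; 6; 5; 4] 90))) (Split 6 (Cut 7 [:: 6; 0; 2; 11; 4; 9])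
  (Split 3 (Cut 2 [:: 2; 1; 5; 6; 11]) (Cut 0 [:: 2; 1; 5; 11]))))) (Split 3 (Split 4 (Split 5
  (Split 6 (Same 3 [:: 4; 5; 6; 0; 3; 2; 1] 96) (Same 3 [:: 5; 4; 6; 2; 0; 1; 3] 44)) (Split 6 (Same
  6 [:: 6; 1; 5; 4; 0; 3; 2] 70) (Same 8 [:: 0; 5; 4; 1; 6; 3; 2] 90))) (Split 5 (Split 6 (Same 8
  [:: 2; 5; 4; 3; 6; 1; 0] 90) (Same 6 [:: 6; 3; 5; 4; 2; 1; 0] 70)) (Split 6 (Same 3 [:: 5; 4; 6;
  0; 2; 3; 1] 44) (Same 3 [:: 4; 5; 6; 3; 0; 1; 2] 24)))) (Split 4 (Split 6 (Cut 7 [:: 6; 0; 2; 9;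
  4; 11]) (Split 5 (Cut 2 [:: 2; 1; 5; 6; 9]) (Cut 0 [:: 2; 1; 5; 9]))) (Split 5 (Split 6 (Same 3
  [:: 3; 2; 6; 0; 4; 5; 1] 44) (Same 3 [:: 2; 3; 6; 5; 0; 1; 4] 24)) (Split 6 (Cut 3 [:: 2; 1; 5; 7;
  10]) (Cut 2 [:: 6; 0; 8; 10; 3]))))))); ([:: 0; 108; 84; 24; 96], Split 2 (Split 3 (Cut 3 [:: 0;
  10; 4; 2; 9]) (Split 4 (Cut 9 [:: 4; 2; 0; 6; 10; 8]) (Cut 3 [:: 0; 3; 9; 4; 11]))) (Split 3
  (Split 4 (Cut 3 [:: 0; 2; 8; 5; 10]) (Cut 9 [:: 4; 2; 1; 6; 10; 8])) (Cut 3 [:: 0; 11; 5; 3;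
  8]))); ([:: 0; 56; 72; 80; 96], Split 3 (Split 4 (Split 5 (Cut 5 [:: 0; 7; 2; 4; 9; 11]) (Cut 4
  [:: 0; 10; 3; 5; 6; 8])) (Split 5 (Cut 4 [:: 0; 8; 3; 5; 6; 10]) (Cut 4 [:: 0; 7; 2; 4; 9; 11])))
  (Split 4 (Split 5 (Cut 4 [:: 0; 6; 3; 5; 8; 10]) (Cut 4 [:: 0; 9; 2; 4; 7; 11])) (Split 5 (Cut 4
  [:: 0; 11; 2; 4; 7; 9]) (Cut 5 [:: 0; 6; 3; 5; 8; 10])))); ([:: 0; 20; 56; 88; 96], Split 5 (Split
  6 (Split 2 (Split 4 (Cut 0 [:: 0; 2; 4; 10]) (Cut 6 [:: 2; 10; 6; 9; 5; 1])) (Cut 6 [:: 2; 10; 7;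
  8; 5; 1])) (Cut 8 [:: 0; 2; 7; 8; 4; 10])) (Split 6 (Cut 8 [:: 0; 2; 6; 9; 4; 10]) (Split 2 (Cut 6
  [:: 2; 10; 7; 8; 5; 0]) (Split 4 (Cut 6 [:: 2; 10; 6; 9; 5; 0]) (Cut 0 [:: 0; 3; 5; 11])))))]; [::
  ([:: 0; 50; 52; 56; 80; 96], Split 1 (Split 4 (Split 5 (Cut 5 [:: 0; 6; 2; 4; 11; 13]) (Split 2
  (Cut 5 [:: 0; 5; 12; 9; 7; 3]) (Cut 3 [:: 4; 1; 7; 10; 13]))) (Split 2 (Cut 5 [:: 0; 3; 8; 11; 5;
  7]) (Split 3 (Cut 2 [:: 4; 1; 8; 11; 7]) (Cut 6 [:: 0; 5; 3; 10; 7; 9])))) (Split 4 (Split 2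
  (Split 5 (Cut 5 [:: 6; 2; 4; 0; 10; 12]) (Cut 3 [:: 4; 0; 7; 11; 12])) (Split 5 (Cut 10 [:: 10; 5;
  12; 7; 0; 9]) (Cut 5 [:: 10; 9; 12; 0; 5; 7]))) (Split 5 (Split 2 (Cut 3 [:: 4; 0; 7; 10; 13])
  (Cut 5 [:: 12; 9; 10; 0; 5; 7])) (Cut 5 [:: 0; 7; 3; 5; 10; 12])))); ([:: 0; 50; 44; 84; 88; 96],
  Split 2 (Split 3 (Split 5 (Cut 5 [:: 0; 13; 7; 3; 9; 11]) (Cut 5 [:: 0; 6; 12; 5; 9; 11])) (Split
  5 (Split 6 (Cut 3 [:: 2; 0; 13; 9; 10]) (Cut 11 [:: 0; 2; 4; 6; 10; 8; 12])) (Split 6 (Cut 3 [::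
  4; 0; 6; 9; 10]) (Cut 3 [:: 2; 1; 13; 8; 11])))) (Split 3 (Split 5 (Split 6 (Cut 3 [:: 2; 0; 13;
  8; 11]) (Cut 11 [:: 0; 2; 4; 6; 8; 10; 12])) (Split 6 (Cut 3 [:: 4; 0; 6; 8; 11]) (Cut 3 [:: 2; 1;
  13; 9; 10]))) (Split 5 (Split 6 (Cut 5 [:: 0; 2; 6; 12; 8; 10]) (Cut 12 [:: 2; 9; 13; 6; 4; 1;
  11])) (Cut 5 [:: 0; 12; 6; 2; 8; 10])))); ([:: 0; 82; 76; 52; 88; 96], Split 5 (Split 6 (Cut 8 [::
  0; 4; 2; 13; 7; 10]) (Split 1 (Cut 6 [:: 4; 7; 2; 13; 11; 1]) (Split 3 (Cut 0 [:: 0; 4; 7; 10])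
  (Cut 6 [:: 4; 7; 3; 12; 11; 1])))) (Split 6 (Split 4 (Split 2 (Cut 11 [:: 6; 2; 8; 0; 10; 4; 12])
  (Cut 5 [:: 10; 5; 6; 0; 3; 13])) (Split 1 (Cut 11 [:: 0; 2; 6; 4; 8; 11; 12]) (Cut 5 [:: 10; 0; 4;
  7; 3; 13]))) (Cut 8 [:: 0; 4; 3; 12; 7; 10]))); ([:: 0; 50; 44; 84; 24; 96], Split 3 (Split 4
  (Split 5 (Split 6 (Cut 0 [:: 0; 2; 10; 12]) (Cut 6 [:: 10; 2; 8; 4; 0; 12])) (Cut 6 [:: 10; 2; 4;
  8; 0; 12])) (Cut 8 [:: 0; 2; 4; 8; 10; 12])) (Split 4 (Split 2 (Cut 13 [:: 8; 2; 6; 4; 0; 10; 12])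
  (Split 5 (Cut 11 [:: 10; 1; 9; 7; 2; 12; 4]) (Cut 3 [:: 0; 11; 7; 3; 12]))) (Split 5 (Cut 9 [:: 0;
  2; 8; 4; 10; 12]) (Split 6 (Cut 9 [:: 0; 2; 4; 8; 10; 12]) (Cut 0 [:: 0; 3; 11; 13]))))); ([:: 0;
  74; 76; 56; 80; 96], Split 3 (Split 4 (Split 5 (Cut 5 [:: 0; 5; 2; 8; 11; 13]) (Split 6 (Cut 6 [::
  0; 11; 5; 9; 3; 13]) (Cut 2 [:: 2; 1; 8; 10; 13]))) (Split 5 (Split 6 (Cut 6 [:: 0; 13; 5; 9; 3;
  11]) (Cut 2 [:: 2; 1; 8; 12; 11])) (Split 6 (Split 1 (Cut 5 [:: 0; 2; 5; 9; 10; 12]) (Cut 10 [::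
  0; 2; 7; 10; 4; 12])) (Cut 6 [:: 0; 3; 5; 9; 11; 13])))) (Split 4 (Split 1 (Split 2 (Cut 6 [:: 0;
  8; 2; 11; 5; 7]) (Cut 5 [:: 0; 2; 6; 10; 8; 5])) (Cut 5 [:: 0; 2; 4; 10; 8; 7])) (Split 5 (Split 1
  (Cut 3 [:: 6; 0; 8; 10; 13]) (Cut 5 [:: 0; 2; 4; 12; 8; 7])) (Cut 5 [:: 0; 4; 3; 9; 10; 12]))));
  ([:: 0; 76; 52; 56; 80; 96], Split 2 (Split 4 (Split 5 (Cut 5 [:: 0; 5; 2; 6; 11; 13]) (Split 3
  (Cut 5 [:: 0; 7; 12; 4; 9; 3]) (Cut 3 [:: 6; 1; 9; 10; 13]))) (Split 3 (Cut 5 [:: 0; 3; 5; 11; 7;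
  9]) (Split 5 (Cut 3 [:: 6; 1; 9; 11; 12]) (Cut 5 [:: 0; 4; 3; 9; 10; 12])))) (Split 4 (Split 3
  (Split 5 (Cut 5 [:: 0; 11; 9; 3; 13; 5]) (Cut 3 [:: 6; 0; 9; 11; 12])) (Cut 5 [:: 0; 2; 4; 10; 6;
  8])) (Split 5 (Split 3 (Cut 3 [:: 6; 0; 9; 10; 13]) (Cut 5 [:: 0; 2; 4; 12; 6; 8])) (Cut 5 [:: 0;
  4; 3; 7; 10; 12])))); ([:: 0; 70; 42; 52; 88; 96], Split 1 (Split 5 (Split 6 (Cut 13 [:: 8; 2; 10;
  4; 6; 0; 12]) (Split 3 (Cut 3 [:: 2; 0; 7; 4; 10]) (Cut 11 [:: 10; 2; 8; 6; 0; 4; 12]))) (Split 6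
  (Split 2 (Cut 3 [:: 2; 0; 5; 6; 8]) (Cut 11 [:: 8; 2; 10; 4; 0; 6; 12])) (Cut 13 [:: 8; 12; 10; 4;
  6; 0; 2]))) (Split 5 (Split 6 (Cut 13 [:: 4; 2; 8; 10; 6; 12; 0]) (Split 2 (Split 3 (Cut 11 [:: 4;
  2; 8; 6; 0; 10; 12]) (Cut 5 [:: 0; 3; 9; 11; 13; 5])) (Cut 2 [:: 2; 1; 11; 12; 5]))) (Split 6
  (Split 2 (Cut 11 [:: 6; 2; 10; 4; 0; 8; 12]) (Split 3 (Cut 5 [:: 0; 3; 11; 9; 13; 7]) (Cut 2 [::
  2; 1; 9; 12; 7]))) (Cut 13 [:: 4; 12; 8; 10; 6; 2; 0])))); ([:: 0; 78; 50; 84; 88; 96], Split 2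
  (Split 4 (Split 5 (Cut 5 [:: 0; 6; 2; 5; 9; 13]) (Cut 5 [:: 0; 10; 12; 8; 4; 3])) (Split 5 (Cut 5
  [:: 0; 4; 10; 7; 13; 9]) (Cut 12 [:: 6; 8; 4; 0; 2; 12; 10]))) (Split 4 (Cut 12 [:: 4; 2; 6; 0;
  10; 8; 12]) (Cut 12 [:: 8; 3; 11; 0; 7; 4; 13]))); ([:: 0; 90; 42; 60; 76; 112], Split 4 (Split 5
  (Split 6 (Cut 13 [:: 6; 0; 5; 9; 10; 2; 13]) (Cut 13 [:: 2; 0; 13; 7; 4; 10; 9])) (Split 6 (Cut 13
  [:: 2; 0; 13; 11; 8; 6; 5]) (Split 1 (Split 2 (Split 3 (Cut 2 [:: 2; 0; 9; 10; 12]) (Cut 0 [:: 6;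
  0; 10; 12])) (Split 3 (Cut 0 [:: 4; 1; 11; 13]) (Cut 13 [:: 2; 9; 4; 13; 7; 1; 10]))) (Split 2
  (Split 3 (Cut 0 [:: 6; 0; 9; 12]) (Cut 13 [:: 2; 5; 8; 13; 11; 1; 6])) (Split 3 (Same 0 [:: 0; 5;
  4; 2; 6; 1; 3] 44) (Cut 0 [:: 2; 1; 7; 11])))))) (Split 5 (Split 6 (Split 1 (Split 2 (Split 3 (Cut
  2 [:: 8; 0; 11; 12; 2]) (Cut 0 [:: 2; 0; 4; 8])) (Split 3 (Cut 0 [:: 2; 0; 7; 8]) (Cut 2 [:: 2; 0;
  4; 7; 8]))) (Split 2 (Split 3 (Cut 0 [:: 2; 0; 4; 11]) (Cut 13 [:: 2; 6; 8; 13; 11; 0; 5])) (Split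
  3 (Same 0 [:: 2; 5; 4; 0; 6; 3; 1] 44) (Cut 0 [:: 4; 0; 8; 13])))) (Cut 13 [:: 10; 0; 9; 3; 12; 4;
  7])) (Split 6 (Cut 13 [:: 6; 0; 5; 3; 12; 8; 11]) (Cut 13 [:: 4; 0; 7; 11; 8; 12; 3]))))]].

(** * The three computations and the theorem *)

(** [F = J - 2I] has [F F^T = 4I + J], with eigenvalue 9 on the constants: [a = 2], [d = 3],
    [m = 5]. Here [121 / 25] is [r^2] itself. *)
Lemma search5_correct :
  search 5 5 4 9 121 25 certificates5 search5 [:: 1; 2; 4; 8; 16]%N.
Proof. by vm_compute. Qed.

(** Here [U] has two blocks of size 3. The row sums of the blocks of [F] form the matrix [[1, 3],
    [-3, 1]], which is [sqrt 10] times an orthogonal one; hence [D = 10]. The bound [569 / 100] lies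
    just below [r^2 = (26 + 8 sqrt 10) / 9]. *)
Lemma search6_correct :
  search 6 3 4 10 569 100 certificates6 search6 [:: 1; 2; 4; 15; 23; 39]%N.
Proof. by vm_compute. Qed.

(** Rows have three entries -1 and any two lines meet in one point, so [F F^T = 8I - J], with
    eigenvalue 1 on the constants. The bound [659 / 100] lies just below
    [r^2 = (289 + 24 sqrt 2) / 49]. *)
Lemma search7_correct :
  search 7 7 8 1 659 100 certificates7 search7 [:: 22; 44; 88; 49; 98; 69; 11]%N.
Proof. by vm_compute. Qed.

Theorem theorem8 (R : realType) :
  [/\ schur_radius R 5 = 11 / 5,
      schur_radius R 6 = 1 / 3 * (4 + Num.sqrt 10)
    & schur_radius R 7 = 1 / 7 * (1 + 12 * Num.sqrt 2)].
Proof.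
have sqr10 : Num.sqrt 10 ^+ 2 = 10 :> R by rewrite sqr_sqrtr ?ler0n.
have sqr2 : Num.sqrt 2 ^+ 2 = 2 :> R by rewrite sqr_sqrtr ?ler0n.
have le10 : 79 / 25 <= Num.sqrt 10 :> R.
  by have := sqrtr_ge0 (10 : R); nra.
have le2 : 1413 / 1000 <= Num.sqrt 2 :> R.
  by have := sqrtr_ge0 (2 : R); nra.
split.
- have [p4 p9 p121 p25] : [/\ phi R 4 = 4, phi R 9 = 9, phi R 121 = 121 & phi R 25 = 25].
    by [].
  have := @schur_radius_search R 5 5 4 9 121 25 _ _ _ 2 3 isT isT.
  rewrite p4 p9 p121 p25 => H.
  by rewrite (H _ _ _ _ _ _ _ _ _ search5_correct); lra.
- have [p4 p10 p569 p100] : [/\ phi R 4 = 4, phi R 10 = 10, phi R 569 = 569 & phi R 100 = 100].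
    by [].
  have := @schur_radius_search R 6 3 4 10 569 100 _ _ _ 2 (Num.sqrt 10) isT isT.
  rewrite p4 p10 p569 p100 => H.
  by rewrite (H _ _ _ _ _ _ _ _ _ search6_correct); nra.
have [p8 p1 p659 p100] : [/\ phi R 8 = 8, phi R 1 = 1, phi R 659 = 659 & phi R 100 = 100].
  by [].
have := @schur_radius_search R 7 7 8 1 659 100 _ _ _ (2 * Num.sqrt 2) 1 isT isT.
rewrite p8 p1 p659 p100 => H.
by rewrite (H _ _ _ _ _ _ _ _ _ search7_correct); nra.
Qed.
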